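(* (Large batch.) Let $F=f_K\circ f_{K-1}\circ\cdots\circ f_1$ be a $K$-level compositional objective on the closed convex set $\mathcal X\subset\mathbb R^d$, and suppose Assumptions (A1)-(A5) of the context hold. By setting $B_1=\mathcal O(\epsilon^{-1})$, $\eta=\mathcal O(\epsilon)$ and $\alpha=\mathcal O(\epsilon)$, the PMVR algorithm guarantees that $\mathbb E[\mathcal F(x_\tau)]\le\epsilon$ within $T=\mathcal O(\epsilon^{-2})$ iterations, where $\mathcal F(x)=\max_{\hat x\in\mathcal X}\langle\hat x-x,-\nabla F(x)\rangle$ is the Frank-Wolfe gap.
   Context: Problem: minimise $F(x)=f_K\circ\cdots\circ f_1(x)$ over $x\in\mathcal X$. Each $f_i$ and its gradient (Jacobian) $\nabla f_i$ are accessed only through noisy estimates $f_i(\cdot;\xi)$ and $\nabla f_i(\cdot;\xi)$, where $\xi$ is a sample drawn from the oracle. Jacobians are arranged so that the chain rule reads $\nabla F(x)=\prod_{i=1}^K\nabla f_i(y^{i-1})$ with $y^0=x$, $y^i=f_i(y^{i-1})$, products being taken in increasing order of $i$ from left to right. Assumptions. (A1) $\mathcal X$ is closed and convex with $\max_{x,y\in\mathcal X}\|x-y\|\le D$. (A2) All $f_1,\dots,f_K$ are $L_f$-Lipschitz continuous and their Jacobians $\nabla f_1,\dots,\nabla f_K$ are $L_J$-Lipschitz continuous. (A3) For $1\le i\le K$: $\mathbb E[f_i(x;\xi_t^i)]=f_i(x)$, $\mathbb E[\nabla f_i(x;\xi_t^i)]=\nabla f_i(x)$, $\mathbb E\|f_i(x;\xi_t^i)-f_i(x)\|^2\le\sigma^2$,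 $\mathbb E\|\nabla f_i(x;\xi_t^i)-\nabla f_i(x)\|^2\le\sigma_J^2$, where $\{\xi_t^i\}_{i=1}^K$ are mutually independent. (A4) For $1\le i\le K$: $\mathbb E\|f_i(x;\xi_t^i)-f_i(y;\xi_t^i)\|^2\le\mathcal L_f^2\|x-y\|^2$ and $\mathbb E\|\nabla f_i(x;\xi_t^i)-\nabla f_i(y;\xi_t^i)\|^2\le\mathcal L_J^2\|x-y\|^2$. (A5) The initial solution $x_1$ satisfies $F(x_1)-F_\star\le\Delta_F$, where $F_\star=\min_{x\in\mathcal X}F(x)$. PMVR algorithm (parameters $T,\eta,\alpha$, batch size $B_1$, first-iteration batch size $B_0$). At each time step $t=1,\dots,T$ set $u_t^0=x_t$ and, for each level $i=1,\dots,K$, draw a batch of samples $\xi_t^{i,1},\dots,\xi_t^{i,B_1}$ and compute $$u_t^i=(1-\alpha)u_{t-1}^i+\frac1{B_1}\sum_{j=1}^{B_1}f_i(u_t^{i-1};\xi_t^{i,j})-(1-\alpha)\frac1{B_1}\sum_{j=1}^{B_1}f_i(u_{t-1}^{i-1};\xi_t^{i,j});$$ then $$v_t=(1-\alpha)v_{t-1}+\frac1{B_1}\sum_{j=1}^{B_1}\prod_{i=1}^K\nabla f_i(u_t^{i-1};\xi_t^{i,j})-(1-\alpha)\frac1{B_1}\sum_{j=1}^{B_1}\prod_{i=1}^K\nabla f_i(u_{t-1}^{i-1};\xi_t^{i,j}).$$ In the first iteration ($t=1$) one sets instead $u_1^i=\frac1{B_0}\sum_{j=1}^{B_0}f_i(u_1^{i-1};\xi_1^{i,j})$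 and $v_1=\frac1{B_0}\sum_{j=1}^{B_0}\prod_{i=1}^K\nabla f_i(u_1^{i-1};\xi_1^{i,j})$, where $B_0$ is the batch size for the first iteration. Next compute $z_t=\arg\min_{x\in\mathcal X}\langle x,v_t\rangle$ and update $x_{t+1}=x_t+\eta(z_t-x_t)$. Finally choose $\tau$ uniformly at random from $\{1,\dots,T\}$ and return $(x_\tau,u_\tau,v_\tau)$. $\mathcal O(\cdot)$ is the usual order notation in the displayed quantities. *)

(* Defs.v *)
From HB Require Import structures.
From mathcomp Require Export all_boot all_order all_algebra finmap.
From mathcomp Require Export all_classical all_reals all_analysis.

Set Implicit Arguments.
Unset Strict Implicit.
Unset Printing Implicit Defensive.

Export numFieldNormedType.Exports.
Import Order.TTheory GRing.Theory Num.Theory.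

Local Open Scope classical_set_scope.
Local Open Scope ring_scope.

(* Points are row vectors and a Jacobian of a map R^m -> R^n is an m x n matrix
   acting on them from the right, as for the library's 'J ('D_v f x = v *m 'J f x);
   chain-rule products are then taken in increasing order of the level.
   Levels and iterations are numbered from 0: f i : R^(d i) -> R^(d i.+1) for
   i < K is the level i.+1, and iteration t < T is the time step t.+1. *)

(* The library norm on 'rV is the sup norm; this is the Euclidean one. *)
Definition enorm (R : realType) (n : nat) (x : 'rV[R]_n) : R :=
  Num.sqrt (\sum_(k < n) x 0 k ^+ 2).

(* spectral norm *)
Definition opnorm (R : realType) (m n : nat) (A : 'M[R]_(m, n)) : R :=
  sup [set enorm (v *m A) | v in [set v | enorm v <= 1]].

Definition inner (R : realType) (n : nat) (x : 'rV[R]_n) (g : 'cV[R]_n) : R :=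
  (x *m g) 0 0.

Definition grad (R : realType) (n : nat) (F : 'rV[R]_n -> R) (x : 'rV[R]_n) :
    'cV[R]_n :=
  'J (fun y => (F y)%:M : 'rV[R]_1) x.

(* X being compact in the intended use, the supremum is a maximum. *)
Definition fw_gap (R : realType) (n : nat) (X : set 'rV[R]_n)
    (F : 'rV[R]_n -> R) (x : 'rV[R]_n) : R :=
  sup [set inner (y - x) (- grad F x) | y in X].

Definition borel (T : ptopologicalType) := g_sigma_algebraType (@open T).

Definition mutually_independent (dO : measure_display) (Om : measurableType dO)
    (R : realType) (P : probability Om R) (I : choiceType) (D : set I)
    (G : I -> set (set Om)) : Prop :=
  forall J : {fset I}, [set` J] `<=` D ->
  forall A : I -> set Om, (forall i, i \in J -> G i (A i)) ->
  P (\bigcap_(i in [set` J]) A i) = (\prod_(i <- J) P (A i))%E.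

Section multilevel.
Context {R : realType} (d : nat -> nat).

Definition level_maps := forall i : nat, 'rV[R]_(d i) -> 'rV[R]_(d i.+1).

Fixpoint compose (f : level_maps) (n : nat) (x : 'rV[R]_(d 0)) : 'rV[R]_(d n) :=
  if n is n'.+1 then f n' (compose f n' x) else x.

Fixpoint chain_prod (A : forall i, 'M[R]_(d i, d i.+1)) (n : nat) :
    'M[R]_(d 0, d n) :=
  if n is n'.+1 then chain_prod A n' *m A n' else 1%:M.

Definition objective (K : nat) (dK : d K = 1%N) (f : level_maps)
    (x : 'rV[R]_(d 0)) : R :=
  castmx (erefl, dK) (compose f K x) 0 0.

(* oval i x s and ojac i x s estimate f i x and 'J (f i) x from the sample s.
   Joint measurability makes them random variables at random points x. *)
Record oracle (dS : measure_display) (S : measurableType dS) := Oracle {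
  oval : forall i, 'rV[R]_(d i) -> S -> 'rV[R]_(d i.+1);
  ojac : forall i, 'rV[R]_(d i) -> S -> 'M[R]_(d i, d i.+1);
  oval_measurable : forall i k,
    measurable_fun [set: borel 'rV[R]_(d i) * S]
      (fun p : borel 'rV[R]_(d i) * S => oval p.1 p.2 0 k : R);
  ojac_measurable : forall i k l,
    measurable_fun [set: borel 'rV[R]_(d i) * S]
      (fun p : borel 'rV[R]_(d i) * S => ojac p.1 p.2 k l : R)
}.

Section assumptions.
Variables (K : nat) (X : set 'rV[R]_(d 0)) (f : level_maps).

Definition assumption1 (D : R) :=
  [/\ closed X, @convex_set R 'rV[R]_(d 0) X &
      forall x y, X x -> X y -> enorm (x - y) <= D].

Definition assumption2 (Lf LJ : R) := forall i, (i < K)%N ->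
  [/\ forall x y : 'rV[R]_(d i), enorm (f x - f y) <= Lf * enorm (x - y),
      forall x : 'rV[R]_(d i), differentiable (@f i) x &
      forall x y, opnorm ('J (@f i) x - 'J (@f i) y) <= LJ * enorm (x - y)].

Context (dS dO : measure_display) (S : measurableType dS)
  (Om : measurableType dO) (P : probability Om R) (o : oracle S).

(* requirements on a sample s of level i *)
Definition assumption3 (sigma sigmaJ : R) (i : nat) (s : {RV P >-> S}) :=
  forall x : 'rV[R]_(d i),
  [/\ forall k, ('E_P[fun w => (oval o x (s w) 0 k)%R] = (f x 0%R k)%:E)%E,
      forall k l, ('E_P[fun w => ojac o x (s w) k l] = ('J (@f i) x k l)%:E)%E,
      ('E_P[fun w => (enorm (oval o x (s w) - f x) ^+ 2)%R]
         <= (sigma ^+ 2)%:E)%E &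
      ('E_P[fun w => (opnorm (ojac o x (s w) - 'J (@f i) x) ^+ 2)%R]
         <= (sigmaJ ^+ 2)%:E)%E].

Definition assumption4 (cLf cLJ : R) (i : nat) (s : {RV P >-> S}) :=
  forall x y : 'rV[R]_(d i),
  ('E_P[fun w => (enorm (oval o x (s w) - oval o y (s w)) ^+ 2)%R]
     <= (cLf ^+ 2 * enorm (x - y) ^+ 2)%:E)%E /\
  ('E_P[fun w => (opnorm (ojac o x (s w) - ojac o y (s w)) ^+ 2)%R]
     <= (cLJ ^+ 2 * enorm (x - y) ^+ 2)%:E)%E.

Definition assumption5 (F : 'rV[R]_(d 0) -> R) (x1 : 'rV[R]_(d 0))
    (DeltaF : R) :=
  X x1 /\ F x1 - inf [set F x | x in X] <= DeltaF.

End assumptions.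

(* A linear minimisation oracle: lmo v is a minimiser of inner x v over X,
   chosen measurably in v. *)
Definition is_lmo (X : set 'rV[R]_(d 0))
    (lmo : 'cV[R]_(d 0) -> 'rV[R]_(d 0)) : Prop :=
  (forall v, X (lmo v) /\ forall x, X x -> inner (lmo v) v <= inner x v) /\
  (forall k, measurable_fun [set: borel 'cV[R]_(d 0)]
     (fun v : borel 'cV[R]_(d 0) => lmo v 0 k : R)).

Section pmvr.
Context (dS : measure_display) (S : measurableType dS).
Variables (o : oracle S) (K : nat) (dK : d K = 1%N).
Variables (lmo : 'cV[R]_(d 0) -> 'rV[R]_(d 0)) (x1 : 'rV[R]_(d 0)).
Variables (B0 B1 : nat) (eta alpha : R).

(* (x_t, u_t, v_t), where ut 0 is x_t *)
Record pmvr_state := PMVRState {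
  xt : 'rV[R]_(d 0);
  ut : forall i, 'rV[R]_(d i);
  vt : 'cV[R]_(d 0)
}.

Definition batch_mean (V : lmodType R) (B : nat) (g : nat -> V) : V :=
  (B%:R)^-1 *: \sum_(j < B) g j.

(* s i j is the j-th sample of level i at the current iteration *)
Definition jac_prod (u : forall i, 'rV[R]_(d i)) (s : nat -> nat -> S)
    (j : nat) : 'cV[R]_(d 0) :=
  castmx (erefl, dK) (chain_prod (fun i => ojac o (u i) (s i j)) K).

Fixpoint u_first (x : 'rV[R]_(d 0)) (s : nat -> nat -> S) (i : nat) :
    'rV[R]_(d i) :=
  if i is i'.+1 then
    batch_mean B0 (fun j => oval o (u_first x s i') (s i' j))
  else x.

Fixpoint u_next (up : forall i, 'rV[R]_(d i)) (x : 'rV[R]_(d 0))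
    (s : nat -> nat -> S) (i : nat) : 'rV[R]_(d i) :=
  if i is i'.+1 then
    (1 - alpha) *: up i'.+1
    + batch_mean B1 (fun j => oval o (u_next up x s i') (s i' j))
    - (1 - alpha) *: batch_mean B1 (fun j => oval o (up i') (s i' j))
  else x.

Definition pmvr_first (s : nat -> nat -> S) : pmvr_state :=
  let u := u_first x1 s in
  PMVRState x1 u (batch_mean B0 (jac_prod u s)).

Definition pmvr_next (p : pmvr_state) (s : nat -> nat -> S) : pmvr_state :=
  let x := xt p + eta *: (lmo (vt p) - xt p) in
  let u := u_next (ut p) x s in
  PMVRState x u
    ((1 - alpha) *: vt p + batch_mean B1 (jac_prod u s)
     - (1 - alpha) *: batch_mean B1 (jac_prod (ut p) s)).

Fixpoint pmvr (s : nat -> nat -> nat -> S) (t : nat) : pmvr_state :=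
  if t is t'.+1 then pmvr_next (pmvr s t') (s t) else pmvr_first (s 0%N).

End pmvr.
End multilevel.

(* The (t, i, j) such that the j-th sample of level i is drawn at iteration t. *)
Definition drawn (T K B0 B1 : nat) (tij : nat * nat * nat) : bool :=
  let: (t, i, j) := tij in
  [&& (t < T)%N, (i < K)%N & (j < if t == 0%N then B0 else B1)%N].

(* tau is uniform on the T iterations; tau (index None) and the drawn samples
   are mutually independent. *)
Definition pmvr_randomness (R : realType) (dS dO : measure_display)
    (S : measurableType dS) (Om : measurableType dO) (P : probability Om R)
    (T K B0 B1 : nat) (xi : nat -> nat -> nat -> {RV P >-> S})
    (tau : {RV P >-> nat}) : Prop :=
  (forall t, (t < T)%N -> P (tau @^-1` [set t]) = (T%:R^-1)%:E) /\
  mutually_independent P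
    [set k : option (nat * nat * nat) | oapp (drawn T K B0 B1) true k]
    (fun k => if k is Some (t, i, j)
              then preimage_set_system setT (xi t i j) measurable
              else preimage_set_system setT tau measurable).

(* Main.v *)
(* With alpha = eta = e of order epsilon, B1 >= 1/e and T >= 1/e^2, the expected gap
   is O(e).

   Level errors. Let m_i bound E|u_{t+1}^i - u_t^i|^2 / e^2. The error
   u_t^{i+1} - f_i(u_t^i) contracts by 1 - e and receives a noise with conditional
   mean 0 and variance O((e^2 + m_i e^2) / B1) = O(e^3), so that its second moment is
   at most (1 - e)^t L^2 + O(e^2), which in turn gives m_{i+1} = O(1).

   Gradient estimator. The Jacobians of an iteration reuse the samples that produced
   the points u_t^i at which they are evaluated, so their product is biased. In the
   j-th product, u_t is replaced by the point at which the j-th samples of all levels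
   are averaged out; it differs from u_t by O(e^2) in L^2, since a single sample has
   weight 1/B1 <= e. The replaced products have the right conditional mean and
   contribute a martingale increment with second moment O(e^3); the replacement costs
   O(e^2) in L^1. Summed with the contraction factor 1 - e, the first contributes
   O(e^2) to the second moment and the second O(e) to the mean of |v_t - g_t|, where
   g_t is the product of exact Jacobians at the u_t^i, and |g_t - grad F(x_t)| is
   controlled by the level errors.

   Descent. Smoothness of F gives
   e gap(x_t) <= F(x_t) - F(x_{t+1}) + e L |v_t - grad F(x_t)| + O(e^2);
   sum over t < T, divide by e T, and use that tau is independent of the samples. *)

Require Import Defs.
From HB Require Import structures.
From mathcomp Require Import ring lra measurable_realfun.

Set Implicit Arguments.
Unset Strict Implicit.
Unset Printing Implicit Defensive.

Import Order.TTheory GRing.Theory Num.Theory.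
Local Open Scope classical_set_scope.
Local Open Scope ring_scope.

(** * Norms of matrices *)

(** The parameters are fixed before the dimensions, so no constant may depend on [d]. Jacobians are
    therefore measured in operator norm; the Frobenius norm, which agrees with it only up to a
    dimension factor, enters the final bounds for rows and columns alone. The hypotheses give second
    moments and nothing higher. When the points of a product of sampled Jacobians are correlated
    with its own samples, differences of such products are products of two correlated L^2 factors,
    hence controlled in L^1 only. This forces the split of the error of [vt] into a martingale part,
    followed in second moment, and a bias, followed in mean norm; the descent inequality needs no
    more than a mean norm. Conditional expectations are replaced by functions of two arguments: the
    first carries the past and is frozen, the second carries the fresh samples and is integrated by
    Fubini. [B0] is arbitrary, so the initial errors are O(1) and not small. They decay like
    [(1 - e) ^+ t], their sum is at most [1/e], and [T >= 1/e^2] makes their average O(e). *)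

Section norms.
Context {R : realType}.

(** Squared Frobenius norm. Being polynomial in the entries it makes measurability and the expansion
    of squares immediate; on rows it is [enorm _ ^+ 2]. *)
Definition fsq m n (A : 'M[R]_(m, n)) : R := \sum_i \sum_j A i j ^+ 2.

Lemma fsq_ge0 m n (A : 'M[R]_(m, n)) : 0 <= fsq A.
Proof. by do 2! (apply: sumr_ge0 => ? _); exact: sqr_ge0. Qed.

Lemma fsqZ m n c (A : 'M[R]_(m, n)) : fsq (c *: A) = c ^+ 2 * fsq A.
Proof.
rewrite /fsq mulr_sumr; apply: eq_bigr => i _; rewrite mulr_sumr.
by apply: eq_bigr => j _; rewrite mxE exprMn.
Qed.

Lemma fsq0 m n : fsq (0 : 'M[R]_(m, n)) = 0.
Proof. by rewrite -(scale0r 0) fsqZ expr0n mul0r. Qed.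

Lemma fsqN m n (A : 'M[R]_(m, n)) : fsq (- A) = fsq A.
Proof. by rewrite -scaleN1r fsqZ sqrrN expr1n mul1r. Qed.

Lemma fsqBC m n (A B : 'M[R]_(m, n)) : fsq (A - B) = fsq (B - A).
Proof. by rewrite -opprB fsqN. Qed.

Lemma fsqD_le2 m n (A B : 'M[R]_(m, n)) : fsq (A + B) <= 2 * fsq A + 2 * fsq B.
Proof.
rewrite /fsq !mulr_sumr -big_split/=; apply: ler_sum => i _.
rewrite !mulr_sumr -big_split/=; apply: ler_sum => j _.
by rewrite mxE; have := sqr_ge0 (A i j - B i j); lra.
Qed.

Lemma fsqD_le3 m n (A B C : 'M[R]_(m, n)) :
  fsq (A + B + C) <= 3 * fsq A + 3 * fsq B + 3 * fsq C.
Proof.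
rewrite /fsq !mulr_sumr -!big_split/=; apply: ler_sum => i _.
rewrite !mulr_sumr -!big_split/=; apply: ler_sum => j _.
rewrite !mxE; have := sqr_ge0 (A i j - B i j).
by have := sqr_ge0 (A i j - C i j); have := sqr_ge0 (B i j - C i j); lra.
Qed.

Lemma fsq_le_entry m n (A : 'M[R]_(m, n)) i j : A i j ^+ 2 <= fsq A.
Proof.
rewrite /fsq (bigD1 i)//= (bigD1 j)//= -addrA lerDl.
by apply: addr_ge0; do ?(apply: sumr_ge0 => ? _); exact: sqr_ge0.
Qed.

(** Cauchy-Schwarz: the sum of the squares of [B * a i - C * b i] equals [B * (A * B - C ^+ 2)].
    Cancelling [B] leaves the case [B = 0], where all [b i] vanish. *)
Lemma sumr_CS (I : finType) (a b : I -> R) :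
  (\sum_i a i * b i) ^+ 2 <= (\sum_i a i ^+ 2) * (\sum_i b i ^+ 2).
Proof.
set A := \sum_i a i ^+ 2; set B := \sum_i b i ^+ 2; set C := \sum_i _.
have B0 : 0 <= B by apply: sumr_ge0 => i _; exact: sqr_ge0.
have [B1|B1] := eqVneq B 0.
  have b0 i : b i = 0.
    apply/eqP; rewrite -sqrf_eq0; apply/eqP; move: B1.
    by move=> /psumr_eq0P -> // j _; exact: sqr_ge0.
  by rewrite B1 mulr0 /C big1 ?expr0n// => i _; rewrite b0 mulr0.
have Bp : 0 < B by rewrite lt0r B1.
have : 0 <= \sum_i (B * a i - C * b i) ^+ 2 by apply: sumr_ge0 => i _; exact: sqr_ge0.
have -> : \sum_i (B * a i - C * b i) ^+ 2 = B * (A * B - C ^+ 2).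
  transitivity (B ^+ 2 * A + (- 2 * B * C) * C + C ^+ 2 * B); last by ring.
  transitivity (\sum_i (B ^+ 2 * a i ^+ 2 + (- 2 * B * C) * (a i * b i)
      + C ^+ 2 * b i ^+ 2)); first by apply: eq_bigr => i _; ring.
  by rewrite !big_split/= -!mulr_sumr.
by rewrite pmulr_rge0// subr_ge0.
Qed.

(** Convexity of the square, by Cauchy-Schwarz against the constant 1 in each entry. *)
Lemma fsq_mean m n B (g : nat -> 'M[R]_(m, n)) : (0 < B)%N ->
  fsq (batch_mean B g) <= B%:R^-1 * \sum_(j < B) fsq (g j).
Proof.
move=> B0; have Bp : 0 < B%:R :> R by rewrite ltr0n.
have h i j : (\sum_(k < B) g k i j) ^+ 2 <= (\sum_(k < B) g k i j ^+ 2) * B%:R.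
  have := sumr_CS (fun k : 'I_B => g k i j) (fun=> 1).
  rewrite expr1n sumr_const card_ord.
  by under eq_bigr do rewrite mulr1.
rewrite /batch_mean fsqZ expr2 -mulrA ler_pM2l ?invr_gt0// mulrC ler_pdivrMr//.
rewrite /fsq [X in _ <= X * _]exchange_big/= mulr_suml; apply: ler_sum => i _.
rewrite [X in _ <= X * _]exchange_big/= mulr_suml; apply: ler_sum => j _.
by rewrite summxE.
Qed.

Lemma fsqM_le m n p (A : 'M[R]_(m, n)) (B : 'M[R]_(n, p)) :
  fsq (A *m B) <= fsq A * fsq B.
Proof.
rewrite /fsq mulr_suml; apply: ler_sum => i _.
apply: (@le_trans _ _ (\sum_k (\sum_j A i j ^+ 2) * (\sum_j B j k ^+ 2))).
  by apply: ler_sum => k _; rewrite mxE; exact: sumr_CS.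
by rewrite -mulr_sumr exchange_big.
Qed.

Lemma fsq_tr m n (A : 'M[R]_(m, n)) : fsq A^T = fsq A.
Proof.
by rewrite /fsq exchange_big; do 2!(apply: eq_bigr => ? _); rewrite mxE.
Qed.

Lemma fsq_castmx m n m' n' (e : (m = m') * (n = n')) (A : 'M[R]_(m, n)) :
  fsq (castmx e A) = fsq A.
Proof. by case: e => e1 e2; case: _ / e1; case: _ / e2; rewrite castmx_id. Qed.

Lemma enorm_sqr n (x : 'rV[R]_n) : enorm x ^+ 2 = fsq x.
Proof.
by rewrite /enorm sqr_sqrtr /fsq ?big_ord1// sumr_ge0// => k _; exact: sqr_ge0.
Qed.

Lemma enorm_ge0 n (x : 'rV[R]_n) : 0 <= enorm x. Proof. exact: sqrtr_ge0. Qed.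

Lemma enormE n (x : 'rV[R]_n) : enorm x = Num.sqrt (fsq x).
Proof. by rewrite /enorm /fsq big_ord1. Qed.

Lemma enormZ n c (x : 'rV[R]_n) : enorm (c *: x) = `|c| * enorm x.
Proof. by rewrite !enormE fsqZ sqrtrM ?sqr_ge0// sqrtr_sqr. Qed.

Lemma enorm0 n : enorm (0 : 'rV[R]_n) = 0.
Proof. by rewrite enormE fsq0 sqrtr0. Qed.

Lemma enormN n (x : 'rV[R]_n) : enorm (- x) = enorm x.
Proof. by rewrite !enormE fsqN. Qed.

Lemma enormBC n (x y : 'rV[R]_n) : enorm (x - y) = enorm (y - x).
Proof. by rewrite -opprB enormN. Qed.

Lemma fsqD m n (A B : 'M[R]_(m, n)) :
  fsq (A + B) = fsq A + 2 * (\sum_i \sum_j A i j * B i j) + fsq B.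
Proof.
rewrite /fsq mulr_sumr -!big_split/=; apply: eq_bigr => i _.
rewrite mulr_sumr -!big_split/=; apply: eq_bigr => j _.
by rewrite mxE; ring.
Qed.

Lemma enormD n (x y : 'rV[R]_n) : enorm (x + y) <= enorm x + enorm y.
Proof.
rewrite -(@ler_pXn2r _ 2)// ?nnegrE ?addr_ge0 ?enorm_ge0//.
rewrite sqrrD !enorm_sqr fsqD lerD2r lerD2l -[leRHS]mulr_natl ler_pM2l//.
rewrite big_ord1; apply: ler_normlW.
rewrite -(@ler_pXn2r _ 2)// ?nnegrE ?mulr_ge0 ?enorm_ge0// real_normK ?num_real//.
by rewrite exprMn !enorm_sqr /fsq !big_ord1; exact: sumr_CS.
Qed.

Lemma enorm_eq0 n (x : 'rV[R]_n) : enorm x = 0 -> x = 0.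
Proof.
move=> x0; apply/rowP => k; rewrite mxE; apply/eqP; rewrite -sqrf_eq0.
rewrite eq_le sqr_ge0 andbT (le_trans (fsq_le_entry x 0 k))//.
by rewrite -enorm_sqr x0 expr0n.
Qed.

Lemma enormM_fsq m n (v : 'rV[R]_m) (A : 'M[R]_(m, n)) :
  enorm (v *m A) <= Num.sqrt (fsq A) * enorm v.
Proof.
rewrite -(@ler_pXn2r _ 2)// ?nnegrE ?mulr_ge0 ?enorm_ge0 ?sqrtr_ge0//.
rewrite exprMn !enorm_sqr sqr_sqrtr ?fsq_ge0// mulrC; exact: fsqM_le.
Qed.

Lemma opnorm_has_sup m n (A : 'M[R]_(m, n)) :
  has_sup [set enorm (v *m A) | v in [set v : 'rV[R]_m | enorm v <= 1]].
Proof.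
split; first by exists (enorm (0 *m A)), 0 => //=; rewrite enorm0.
exists (Num.sqrt (fsq A)) => _ [v /= v1 <-].
by rewrite (le_trans (enormM_fsq _ _))// ler_piMr// sqrtr_ge0.
Qed.

Lemma opnorm_ge0 m n (A : 'M[R]_(m, n)) : 0 <= opnorm A.
Proof.
have := sup_upper_bound (opnorm_has_sup A) => /(_ (enorm (0 *m A))).
by rewrite mul0mx enorm0; apply; exists 0; rewrite /= ?enorm0 ?mul0mx// ?enorm0.
Qed.

Lemma enormM m n (v : 'rV[R]_m) (A : 'M[R]_(m, n)) :
  enorm (v *m A) <= opnorm A * enorm v.
Proof.
have [v0|v0] := eqVneq (enorm v) 0.
  by rewrite (enorm_eq0 v0) mul0mx !enorm0 mulr0.
have vp : 0 < enorm v by rewrite lt0r v0 enorm_ge0.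
rewrite -ler_pdivrMr// mulrC -[X in X * _]ger0_norm ?invr_ge0 ?enorm_ge0//.
rewrite -enormZ scalemxAl; apply: (sup_upper_bound (opnorm_has_sup A)).
exists ((enorm v)^-1 *: v) => //=.
by rewrite enormZ ger0_norm ?invr_ge0 ?enorm_ge0// mulVf.
Qed.

Lemma opnorm_le m n (A : 'M[R]_(m, n)) c : 0 <= c ->
  (forall v, enorm (v *m A) <= c * enorm v) -> opnorm A <= c.
Proof.
move=> c0 h; apply: ge_sup; first by have [] := opnorm_has_sup A.
by move=> _ [v /= v1 <-]; rewrite (le_trans (h v))// ler_piMr.
Qed.

Lemma opnormM m n p (A : 'M[R]_(m, n)) (B : 'M[R]_(n, p)) :
  opnorm (A *m B) <= opnorm A * opnorm B.
Proof.
apply: opnorm_le => [|v]; first by rewrite mulr_ge0 ?opnorm_ge0.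
rewrite mulmxA (le_trans (enormM _ _))// [leRHS]mulrAC [leRHS]mulrC.
by rewrite ler_wpM2l// ?opnorm_ge0// enormM.
Qed.

Lemma opnormD m n (A B : 'M[R]_(m, n)) : opnorm (A + B) <= opnorm A + opnorm B.
Proof.
apply: opnorm_le => [|v]; first by rewrite addr_ge0 ?opnorm_ge0.
by rewrite mulmxDr (le_trans (enormD _ _))// mulrDl lerD ?enormM.
Qed.

Lemma opnormZ_le m n c (A : 'M[R]_(m, n)) : opnorm (c *: A) <= `|c| * opnorm A.
Proof.
apply: opnorm_le => [|v]; first by rewrite mulr_ge0 ?opnorm_ge0.
by rewrite -scalemxAr enormZ -mulrA ler_wpM2l// enormM.
Qed.

Lemma opnorm1_le n : opnorm (1%:M : 'M[R]_n) <= 1.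
Proof. by apply: opnorm_le => // v; rewrite mulmx1 mul1r. Qed.

Lemma opnorm_fsq m n (A : 'M[R]_(m, n)) : opnorm A ^+ 2 <= fsq A.
Proof.
rewrite -[leRHS]sqr_sqrtr ?fsq_ge0// ler_pXn2r// ?nnegrE ?opnorm_ge0 ?sqrtr_ge0//.
by apply: opnorm_le => [|v]; [exact: sqrtr_ge0 | exact: enormM_fsq].
Qed.

Lemma fsq_rowM m n (v : 'rV[R]_m) (A : 'M[R]_(m, n)) :
  fsq (v *m A) <= opnorm A ^+ 2 * fsq v.
Proof.
rewrite -!enorm_sqr -exprMn ler_pXn2r// ?nnegrE ?mulr_ge0 ?enorm_ge0 ?opnorm_ge0//.
exact: enormM.
Qed.

(** Apply [A] to the transpose of its column [j], of squared norm [c]: entry [j] of the result is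
    [c], so [c ^+ 2 <= opnorm A ^+ 2 * c]. Then sum over the [n] columns. The factor [n] is harmless
    for continuity and integrability, and is 1 for a gradient. *)
Lemma fsq_opnorm m n (A : 'M[R]_(m, n)) : fsq A <= n%:R * opnorm A ^+ 2.
Proof.
rewrite /fsq exchange_big/= -[n in n%:R]card_ord -sum1_card natr_sum mulr_suml.
apply: ler_sum => j _; rewrite mul1r.
set c := \sum_i _; have c0 : 0 <= c by apply: sumr_ge0 => i _; exact: sqr_ge0.
pose v : 'rV[R]_m := (col j A)^T.
have ev : enorm v ^+ 2 = c.
  by rewrite enorm_sqr fsq_tr /fsq; apply: eq_bigr => i _; rewrite big_ord1 mxE.
have h := fsq_rowM v A; rewrite -(enorm_sqr v) ev in h.
have := le_trans (fsq_le_entry _ 0 j) h.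
have -> : (v *m A) 0 j = c.
  by rewrite mxE; apply: eq_bigr => i _; rewrite !mxE expr2.
have [->|cn0] := eqVneq c 0; first by rewrite sqr_ge0.
by rewrite expr2 ler_pM2r// lt0r cn0.
Qed.

Lemma abs_inner_le n (x : 'rV[R]_n) (g : 'cV[R]_n) :
  `|inner x g| <= enorm x * Num.sqrt (fsq g).
Proof.
rewrite -(@ler_pXn2r _ 2)// ?nnegrE ?mulr_ge0 ?enorm_ge0 ?sqrtr_ge0//.
rewrite real_normK ?num_real// exprMn enorm_sqr sqr_sqrtr ?fsq_ge0//.
by rewrite (le_trans _ (fsqM_le x g))// fsq_le_entry.
Qed.

End norms.

(** * Measurability of matrix-valued maps *)

Section matrix_measurability.
Context {R : realType}.

Definition mmx d (T : measurableType d) m n (f : T -> 'M[R]_(m, n)) :=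
  forall i j, measurable_fun [set: T] (fun t => f t i j).

(** An open set is the union of the boxes with rational centre and radius [1/(k+1)] that it
    contains. This union is countable, and the preimage of a box is a finite intersection of
    conditions on single entries. *)
Lemma mmx_borel d (T : measurableType d) m n (f : T -> 'M[R]_(m, n)) :
  mmx f -> measurable_fun [set: T] (f : T -> borel 'M[R]_(m, n)).
Proof.
move=> mf; apply: (@measurability _ _ T (borel 'M[R]_(m, n)) setT f (@open 'M[R]_(m, n))) => //.
move=> _ [U oU <-]; rewrite setTI.
pose box (p : 'M[rat]_(m, n) * nat) : set 'M[R]_(m, n) :=
  [set M | forall i j, `|M i j - ratr (p.1 i j)| < p.2.+1%:R^-1].
pose F (p : 'M[rat]_(m, n) * nat) : set T :=
  if pselect (box p `<=` U) is left _ then f @^-1` box p else set0.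
have -> : f @^-1` U = \bigcup_p F p.
  apply/seteqP; split=> [t Ut|t [p _]]; last by rewrite /F; case: pselect => // h /h.
  have [e /= e0 be] : nbhs_ball (f t) U by rewrite nbhs_ballE; exact: open_nbhs_nbhs.
  (* The radius [1/(k+1)] is below [e / 2], so that a box around a rational point near [f t] stays
     inside the ball of radius [e] around [f t]. *)
  pose k := Num.truncn (2 / e).
  have ke : k.+1%:R^-1 < e / 2.
    by rewrite -[e / 2]invf_div ltf_pV2 ?posrE ?divr_gt0// truncnS_gt.
  have /(_ _ _)/cid hq i j : exists q : rat, `|f t i j - ratr q| < k.+1%:R^-1.
    have [] := @rat_in_itvoo R (f t i j - k.+1%:R^-1) (f t i j + k.+1%:R^-1).
      by rewrite ltrD2l gt0_cp// invr_gt0.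
    by move=> q; rewrite in_itv/= => qi; exists q; rewrite distrC ltr_distl.
  pose q := \matrix_(i, j) sval (hq i j).
  have fq i j : `|f t i j - ratr (q i j)| < k.+1%:R^-1.
    by rewrite mxE; exact: svalP (hq i j).
  exists (q, k) => //; rewrite /F; case: pselect => //= -[] M bM.
  apply: be; rewrite mx_norm_ball/=.
  rewrite /ball_/= /Num.norm/= mx_normrE; apply/bigmax_ltP; split => // -[i j] _ /=.
  rewrite !mxE (_ : f t i j - M i j = (f t i j - ratr (q i j)) - (M i j - ratr (q i j))).
    rewrite (le_lt_trans (ler_normB _ _))// (splitr e) ltrD//.
      exact: lt_trans (fq i j) _.
    exact: lt_trans (bM i j) _.
  by ring.
apply: countable_bigcupT_measurable; first exact: countableP.
move=> p; rewrite /F; case: pselect => // _.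
have -> : f @^-1` box p = \big[setI/setT]_i \big[setI/setT]_j
    (fun t => f t i j - ratr (p.1 i j)) @^-1` [set x | `|x| < p.2.+1%:R^-1].
  apply/seteqP; split=> [t /= h|t].
    by rewrite -bigcap_seq => i _ /=; rewrite -bigcap_seq => j _ /=; exact: h.
  rewrite -bigcap_seq => h i j.
  by have := h i (mem_index_enum i); rewrite -bigcap_seq => /(_ j (mem_index_enum j)).
apply: bigsetI_measurable => i _; apply: bigsetI_measurable => j _.
rewrite -[X in measurable X]setTI.
have mg : measurable_fun [set: T] (fun t => `|f t i j - ratr (p.1 i j)|).
  apply: measurableT_comp => //; apply: measurable_funB => //; exact: mf.
rewrite [X in measurable X](_ : _ = setT `&`
   (fun t => `|f t i j - ratr (p.1 i j)|) @^-1` [set` `]-oo, (p.2.+1%:R^-1 : R)[]).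
  exact: mg.
by apply/seteqP; split => t /=; rewrite in_itv.
Qed.

Lemma continuous_borel_measurable m n (h : 'M[R]_(m, n) -> R) :
  continuous h -> measurable_fun [set: borel 'M[R]_(m, n)] h.
Proof.
move=> ch; apply: (measurability _ (RGenOpens.measurableE R)).
move=> _ [_ [a [b ->]] <-]; rewrite setTI; apply: sub_sigma_algebra.
apply: open_comp => [x _|]; [exact: ch|exact: interval_open].
Qed.

Lemma measurable_continuous_mx d (T : measurableType d) m n
    (f : T -> 'M[R]_(m, n)) (h : 'M[R]_(m, n) -> R) :
  mmx f -> continuous h -> measurable_fun [set: T] (h \o f).
Proof.
move=> mf ch; apply: (@measurableT_comp _ _ _ _ (borel 'M[R]_(m, n))).
  exact: continuous_borel_measurable.
exact: mmx_borel.
Qed.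

Section closure.
Context d (T : measurableType d).

Lemma mmx_cst m n (A : 'M[R]_(m, n)) : mmx (fun _ : T => A).
Proof. by move=> i j; exact: measurable_cst. Qed.

Lemma mmxD m n (f g : T -> 'M[R]_(m, n)) :
  mmx f -> mmx g -> mmx (fun t => f t + g t).
Proof.
move=> mf mg i j; under eq_fun do rewrite mxE.
by apply: measurable_funD; [exact: mf|exact: mg].
Qed.

Lemma mmxZ m n c (f : T -> 'M[R]_(m, n)) : mmx f -> mmx (fun t => c *: f t).
Proof.
move=> mf i j; under eq_fun do rewrite mxE.
by apply: measurable_funM; [exact: measurable_cst|exact: mf].
Qed.

Lemma mmxB m n (f g : T -> 'M[R]_(m, n)) :
  mmx f -> mmx g -> mmx (fun t => f t - g t).
Proof.
move=> mf mg i j; under eq_fun do rewrite !mxE.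
by apply: measurable_funB; [exact: mf|exact: mg].
Qed.

Lemma mmxM m n p (f : T -> 'M[R]_(m, n)) (g : T -> 'M[R]_(n, p)) :
  mmx f -> mmx g -> mmx (fun t => f t *m g t).
Proof.
move=> mf mg i j; under eq_fun do rewrite mxE.
by apply: measurable_sum => k; apply: measurable_funM; [exact: mf|exact: mg].
Qed.

Lemma mmx_sum m n B (f : 'I_B -> T -> 'M[R]_(m, n)) :
  (forall j, mmx (f j)) -> mmx (fun t => \sum_j f j t).
Proof.
move=> mf i k; under eq_fun do rewrite summxE.
by apply: measurable_sum => j; exact: mf.
Qed.

Lemma mmx_batch_mean m n B (f : T -> nat -> 'M[R]_(m, n)) :
  (forall j, (j < B)%N -> mmx (fun t => f t j)) -> mmx (fun t => batch_mean B (f t)).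
Proof. by move=> mf; apply: mmxZ; apply: mmx_sum => j; exact: mf. Qed.

Lemma mmx_castmx m n m' n' (e : (m = m') * (n = n')) (f : T -> 'M[R]_(m, n)) :
  mmx f -> mmx (fun t => castmx e (f t)).
Proof.
by move=> mf i j; under eq_fun do rewrite castmxE; exact: mf.
Qed.

Lemma measurable_fsq m n (f : T -> 'M[R]_(m, n)) :
  mmx f -> measurable_fun setT (fun t => fsq (f t)).
Proof.
move=> mf; apply: measurable_sum => i; apply: measurable_sum => j.
by apply: measurable_funX; exact: mf.
Qed.

Lemma measurable_enorm n (f : T -> 'rV[R]_n) :
  mmx f -> measurable_fun setT (fun t => enorm (f t)).
Proof.
move=> mf; under eq_fun do rewrite enormE.
apply: (@measurableT_comp _ _ _ _ _ _ (@Num.sqrt R)); last exact: measurable_fsq.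
by apply: continuous_measurable_fun; exact: sqrt_continuous.
Qed.

Lemma mmx_continuous m n p q (h : 'M[R]_(m, n) -> 'M[R]_(p, q)) (f : T -> 'M[R]_(m, n)) :
  continuous h -> mmx f -> mmx (fun t => h (f t)).
Proof.
move=> ch mf i j; apply: (@measurable_continuous_mx _ T _ _ f (fun M => h M i j)) => //.
by move=> x; apply: (@continuous_comp _ _ _ h (fun M => M i j));
  [exact: ch|exact: coord_continuous].
Qed.

End closure.

Lemma mmx_comp d d' (T : measurableType d) (T' : measurableType d') m n
    (f : T -> 'M[R]_(m, n)) (g : T' -> T) :
  measurable_fun setT g -> mmx f -> mmx (fun t => f (g t)).
Proof. by move=> mg mf i j; exact: (measurableT_comp (mf i j) mg). Qed.

Lemma normr_le_sqrt_fsq m n (A : 'M[R]_(m, n)) : `|A| <= Num.sqrt (fsq A).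
Proof.
rewrite /Num.norm/= mx_normrE; apply/bigmax_leP; split => [|[i j] _]; first exact: sqrtr_ge0.
by rewrite -sqrtr_sqr ler_wsqrtr// fsq_le_entry.
Qed.

Lemma fsq_le_normr m n (A : 'M[R]_(m, n)) : fsq A <= (m * n)%:R * `|A| ^+ 2.
Proof.
rewrite natrM -mulrA /fsq -[m in m%:R]card_ord -sum1_card natr_sum mulr_suml.
apply: ler_sum => i _; rewrite mul1r -[n in n%:R]card_ord -sum1_card natr_sum mulr_suml.
apply: ler_sum => j _; rewrite mul1r -real_normK ?num_real// ler_pXn2r ?nnegrE//.
by rewrite [leRHS]/Num.norm/= mx_normrE; exact: (le_bigmax _ (fun ij => `|A ij.1 ij.2|) (i, j)).
Qed.

(** The topology comes from the sup norm while the hypothesis is Euclidean; the two norms differ by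
    at most the factor [Num.sqrt (m * n)%:R]. The [+ 1] in [c'] only makes it positive. *)
Lemma lipschitz_mx_continuous m n p q (h : 'M[R]_(m, n) -> 'M[R]_(p, q)) c :
  (forall x y, Num.sqrt (fsq (h x - h y)) <= c * Num.sqrt (fsq (x - y))) ->
  continuous h.
Proof.
move=> hl x.
pose c' := `|c| * Num.sqrt (m * n)%:R + 1.
have c'0 : 0 < c' by rewrite ltr_wpDl// mulr_ge0// sqrtr_ge0.
move=> A /nbhs_ballP[e /= e0 eA].
change (nbhs x (h @^-1` A)); apply/nbhs_ballP.
exists (e / c') => /=; first by rewrite divr_gt0.
rewrite mx_norm_ball => y /= xy; apply: eA; rewrite mx_norm_ball /ball_/=.
apply: le_lt_trans (normr_le_sqrt_fsq _) _.
apply: le_lt_trans (hl _ _) _.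
apply: (@le_lt_trans _ _ (c' * `|x - y|)).
  apply: (@le_trans _ _ (`|c| * (Num.sqrt (m * n)%:R * `|x - y|))).
    apply: (@le_trans _ _ (`|c| * Num.sqrt (fsq (x - y)))).
      by rewrite ler_wpM2r ?sqrtr_ge0// ler_norm.
    rewrite ler_wpM2l//.
    rewrite -[X in _ * X]ger0_norm// -sqrtr_sqr -sqrtrM// ler_wsqrtr//.
    exact: fsq_le_normr.
  by rewrite mulrA ler_wpM2r// /c' lerDl.
by rewrite mulrC -ltr_pdivlMr.
Qed.

End matrix_measurability.

(** * Independence *)

(** The closure conditions make the finite intersections of events of the systems a pi-system, from
    which independence extends to generated sigma-algebras by uniqueness of measures. *)
Record independent_systems {R : realType} {dO : measure_display}
    {Om : measurableType dO} (P : probability Om R) (I : choiceType) (Dm : set I)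
    (G : I -> set (set Om)) : Prop := IndependentSystems {
  system_measurable : forall i, Dm i -> G i `<=` measurable;
  system_setI : forall i, setI_closed (G i);
  system_setT : forall i, G i setT;
  system_indep : mutually_independent P Dm G }.

Section independence.
Context {R : realType} {dO : measure_display} {Om : measurableType dO}.
Context {P : probability Om R} {I : choiceType} {Dm : set I} {G : I -> set (set Om)}.
Hypothesis GI : independent_systems P Dm G.

Let G_sub := system_measurable GI.
Let G_setI := system_setI GI.
Let G_setT := system_setT GI.
Let G_indep := system_indep GI.

Definition joint (G : I -> set (set Om)) (A : set I) : set (set Om) := \bigcup_(i in A) G i.

(** [joint G A] is not closed under intersection. These finite intersections are, and they contain
    it. *)
Let cyl (A : set I) : set (set Om) :=
  [set X | exists2 J : {fset I}, [set` J] `<=` A &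
     exists2 F : I -> set Om, (forall i, G i (F i)) &
       X = \bigcap_(i in [set` J]) F i].

Let cyl_setI A : setI_closed (cyl A).
Proof.
move=> _ _ [J JA [F GF ->]] [J' JA' [F' GF' ->]].
exists (J `|` J')%fset; first by move=> i /=; rewrite in_fsetU => /orP[/JA|/JA'].
exists (fun i => (if i \in J then F i else setT) `&` (if i \in J' then F' i else setT)).
  by move=> i; apply: G_setI; case: ifP => // _; exact: G_setT.
apply/seteqP; split=> [w [h h'] i /= _|w h].
  by split; case: ifP => // ij; [exact: h|exact: h'].
split=> i /= ij; have := h i; rewrite /= in_fsetU ij ?orbT => /(_ isT)[] //.
Qed.

Let cyl_setT A : cyl A setT.
Proof.
exists fset0 => //; exists (fun=> setT) => //.
by apply/seteqP; split.
Qed.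

Let cyl_measurable A : A `<=` Dm -> cyl A `<=` measurable.
Proof.
move=> AD _ [J JA [F GF ->]].
by apply: fin_bigcap_measurable => // i ij; apply: G_sub (GF i); apply/AD/JA.
Qed.

Let joint_cyl A : joint G A `<=` cyl A.
Proof.
move=> X [i Ai GX]; exists [fset i]%fset.
  by move=> j; rewrite /= inE => /eqP ->.
exists (fun j => if j == i then X else setT).
  by move=> j; case: eqP => [->//|_]; exact: G_setT.
apply/seteqP; split=> [w Xw j /=|w]; first by rewrite inE => /eqP ->; rewrite eqxx.
by move=> /(_ i); rewrite /= inE eqxx; apply.
Qed.

Let cyl_indep A B X Y : A `<=` Dm -> B `<=` Dm -> A `&` B `<=` set0 ->
  cyl A X -> cyl B Y -> P (X `&` Y) = (P X * P Y)%E.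
Proof.
move=> AD BD AB [J JA [F GF ->]] [J' JB [F' GF' ->]].
have dis i : i \in J -> i \in J' -> False.
  by move=> /JA Ai /JB Bi; exact: (AB i).
pose F'' i := if i \in J then F i else F' i.
have -> : \bigcap_(i in [set` J]) F i `&` \bigcap_(i in [set` J']) F' i =
    \bigcap_(i in [set` (J `|` J')%fset]) F'' i.
  apply/seteqP; split=> [w [h h'] i /=|w h].
    rewrite in_fsetU /F''; case: ifP => [ij _|_ /= ij]; [exact: h|exact: h'].
  split=> i /= ij; have := h i; rewrite /= in_fsetU ij ?orbT => /(_ isT).
    by rewrite /F'' ij.
  by rewrite /F''; case: ifP => // /dis /(_ ij).
rewrite !G_indep//.
- have pe : perm_eq (J `|` J')%fset (J ++ J').
    apply: uniq_perm => [||i]; first exact: fset_uniq.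
      rewrite cat_uniq !fset_uniq/= andbT; apply/hasPn => i /= iJ'.
      by apply/negP => iJ; exact: (dis i).
    by rewrite in_fsetU mem_cat.
  rewrite (perm_big _ pe)/= big_cat/=; congr (_ * _)%E.
    by apply: eq_big_seq => i ij; rewrite /F'' ij.
  by apply: eq_big_seq => i ij; rewrite /F''; case: ifP => // /dis /(_ ij).
- by move=> i /JB /BD.
- by move=> i /JA /AD.
- by move=> i /=; rewrite in_fsetU => /orP[/JA/AD|/JB/BD].
- by move=> i _; rewrite /F''; case: ifP.
Qed.

(** Both sides are finite measures in [X]: the restriction of [P] to [Y], and [P] scaled by [P Y].
    They agree on the pi-system [C], hence on what it generates. *)
Let indep_ext (C : set (set Om)) (Y : set Om) :
  C `<=` measurable -> setI_closed C -> C setT -> measurable Y ->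
  (forall X, C X -> P (X `&` Y) = (P X * P Y)%E) ->
  forall X, <<s C >> X -> P (X `&` Y) = (P X * P Y)%E.
Proof.
move=> Cm CI CT mY h X sX.
have r0 : 0 <= fine (P Y) by rewrite fine_ge0.
have key : forall X, <<s C >> X -> mrestr P mY X = mscale (NngNum r0) P X.
  apply: (@g_sigma_algebra_measure_unique _ R _ C Cm (fun=> setT)) => //.
  - by rewrite bigcup_const.
  - by move=> A CA; rewrite /= /mrestr/mscale/= h// fineK ?fin_num_measure// muleC.
  - by move=> _; rewrite [X in (X < _)%E]/(P (setT `&` Y)) setTI (le_lt_trans (probability_le1 _ mY))// ltey.
by rewrite -[LHS]/(mrestr P mY X) key// /mscale/= fineK ?fin_num_measure// muleC.
Qed.

(** The extension from cylinders is made in one argument at a time, first reducing [X], then [Y]. *)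
Lemma joint_indep A B X Y : A `<=` Dm -> B `<=` Dm -> A `&` B `<=` set0 ->
  <<s joint G A >> X -> <<s joint G B >> Y -> P (X `&` Y) = (P X * P Y)%E.
Proof.
move=> AD BD AB sX sY.
have sub C : <<s joint G C >> `<=` <<s cyl C >>.
  by apply: sub_sigma_algebra2; exact: joint_cyl.
have sm C : C `<=` Dm -> <<s cyl C >> `<=` measurable.
  by move=> CD; apply: smallest_sub; [exact: sigma_algebra_measurable|exact: cyl_measurable].
have mY : measurable Y by apply: (sm B) => //; exact: sub.
apply: (indep_ext (cyl_measurable AD) (@cyl_setI A) (cyl_setT A) mY); last exact: sub.
move=> {sX}X cX; rewrite setIC muleC.
have mX : measurable X by exact: (cyl_measurable AD).
apply: (indep_ext (cyl_measurable BD) (@cyl_setI B) (cyl_setT B) mX); last exact: sub.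
by move=> {sY mY}Y cY; rewrite setIC muleC; exact: (cyl_indep AD BD).
Qed.

(** [Om] itself with a coarser sigma-algebra: measurability on it expresses that a map depends only
    on the draws indexed by [A]. *)
Definition jointT (G : I -> set (set Om)) (A : set I) := g_sigma_algebraType (joint G A).

Lemma jointT_id_measurable A : A `<=` Dm ->
  measurable_fun [set: Om] (id : Om -> jointT G A).
Proof.
move=> AD _ X mX; rewrite setTI; move: X mX.
apply: smallest_sub; first exact: sigma_algebra_measurable.
by move=> X [i Ai]; apply: G_sub; exact: AD.
Qed.

Lemma jointT_measurable_fun A d (T : measurableType d) (f : Om -> T) :
  A `<=` Dm -> measurable_fun [set: jointT G A] f -> measurable_fun [set: Om] f.
Proof. by move=> AD mf; exact: (measurableT_comp mf (jointT_id_measurable AD)). Qed.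

(** The identity of [Om], read into the two coarser algebras, gives two independent random
    variables. The joint law of the diagonal [w |-> (w, w)] is thus the product of their laws, and
    Tonelli applies. This plays the part of conditioning on [A]. *)
Lemma freeze (A B : set I) (h : jointT G A * jointT G B -> \bar R) :
  A `<=` Dm -> B `<=` Dm -> A `&` B `<=` set0 ->
  measurable_fun [set: jointT G A * jointT G B] h -> (forall p, (0 <= h p)%E) ->
  (\int[P]_w h (w, w) = \int[P]_w \int[P]_w' h (w, w'))%E.
Proof.
move=> AD BD AB mh h0.
pose iA : {RV P >-> jointT G A} := HB.pack (id : Om -> jointT G A)
  (isMeasurableFun.Build _ _ _ _ _ (jointT_id_measurable AD)).
pose iB : {RV P >-> jointT G B} := HB.pack (id : Om -> jointT G B)
  (isMeasurableFun.Build _ _ _ _ _ (jointT_id_measurable BD)).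
have mdiag : measurable_fun [set: Om] (fun w => (w, w) : jointT G A * jointT G B).
  by apply: measurable_fun_pair; exact: jointT_id_measurable.
pose iAB : {RV P >-> (jointT G A * jointT G B)%type} := HB.pack
  (fun w : Om => (w, w) : jointT G A * jointT G B)
  (isMeasurableFun.Build _ _ _ _ _ mdiag).
rewrite -[LHS]/(\int[P]_w (h \o iAB) w)%E -ge0_integral_distribution//.
rewrite -(@eq_measure_integral _ _ _ setT _ (distribution P iA \x distribution P iB)%E).
  rewrite fubini_tonelli1// ge0_integral_distribution//=; last first.
  - by move=> y; exact: integral_ge0.
  - exact: measurable_fun_fubini_tonelli_F.
  apply: eq_integral => w _ /=; rewrite /fubini_F ge0_integral_distribution//.
  exact: measurableT_comp.
move=> X mX _; apply: product_measure_unique => // X1 X2 mX1 mX2.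
exact: (joint_indep AD BD AB).
Qed.

Lemma freeze_measurable (A B : set I) (h : jointT G A * jointT G B -> \bar R) :
  B `<=` Dm -> measurable_fun [set: jointT G A * jointT G B] h ->
  (forall p, (0 <= h p)%E) ->
  measurable_fun [set: jointT G A] (fun w => \int[P]_w' h (w, w'))%E.
Proof.
move=> BD mh h0.
pose iB : {RV P >-> jointT G B} := HB.pack (id : Om -> jointT G B)
  (isMeasurableFun.Build _ _ _ _ _ (jointT_id_measurable BD)).
have := @measurable_fun_fubini_tonelli_F _ _ _ _ _ (distribution P iB) _ mh h0.
apply: eq_measurable_fun => w _; rewrite /fubini_F ge0_integral_distribution//.
exact: measurableT_comp.
Qed.

End independence.

(** * Calculus of bounded expectations and of means *)

Section expectation.
Context {R : realType} {dO : measure_display} {Om : measurableType dO}.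
Variable P : probability Om R.

(* Carrying measurability and sign along with the bound lets the bounds be added,
   scaled and compared without integrability conditions. *)
Definition bE (h : Om -> R) (r : R) : Prop :=
  [/\ measurable_fun setT h, forall w, 0 <= h w &
      (\int[P]_w (h w)%:E <= r%:E)%E].

Lemma bE_r_ge0 h r : bE h r -> 0 <= r.
Proof.
case=> _ h0 hr; rewrite -lee_fin; apply: le_trans hr.
by apply: integral_ge0 => w _; rewrite lee_fin.
Qed.

Lemma bE_le (h h' : Om -> R) r r' : measurable_fun setT h -> (forall w, 0 <= h w) ->
  (forall w, h w <= h' w) -> bE h' r -> r <= r' -> bE h r'.
Proof.
move=> mh h0 hh' [mh' _ hr] rr'; split => //.
apply: (@le_trans _ _ r%:E); last by rewrite lee_fin.
apply: le_trans hr; apply: ge0_le_integral => //.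
- by move=> w _; rewrite lee_fin.
- exact/measurable_EFinP.
- exact/measurable_EFinP.
- by move=> w _; rewrite lee_fin.
Qed.

Lemma bE_ler h r r' : bE h r -> r <= r' -> bE h r'.
Proof. by move=> [mh h0 hr] rr'; apply: (@bE_le h h r). Qed.

Lemma integral_prob_cst c : (\int[P]__ c%:E = c%:E)%E.
Proof. by rewrite integral_cst//= probability_setT mule1. Qed.

Lemma bE_cst c : 0 <= c -> bE (fun=> c) c.
Proof.
move=> c0; split => //.
by rewrite integral_prob_cst.
Qed.

Lemma bED h h' r r' : bE h r -> bE h' r' -> bE (fun w => h w + h' w) (r + r').
Proof.
move=> [mh h0 hr] [mh' h'0 hr']; split; first exact: measurable_funD.
  by move=> w; rewrite addr_ge0.
under eq_integral do rewrite EFinD.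
rewrite ge0_integralD//; first by rewrite EFinD leeD.
all: by first [move=> w _; rewrite lee_fin | exact/measurable_EFinP].
Qed.

Lemma bEZ c h r : 0 <= c -> bE h r -> bE (fun w => c * h w) (c * r).
Proof.
move=> c0 [mh h0 hr]; split; first exact: (measurable_funM (measurable_cst c) mh).
  by move=> w; rewrite mulr_ge0.
under eq_integral do rewrite EFinM.
rewrite ge0_integralZl//; first by rewrite EFinM lee_wpmul2l// lee_fin.
all: by first [move=> w _; rewrite lee_fin | exact/measurable_EFinP].
Qed.

Lemma bE_sum n (h : 'I_n -> Om -> R) (r : 'I_n -> R) :
  (forall j, bE (h j) (r j)) -> bE (fun w => \sum_j h j w) (\sum_j r j).
Proof.
elim: n h r => [|n IH] h r hr.
  by rewrite big_ord0; under eq_fun do rewrite big_ord0; exact: bE_cst.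
rewrite big_ord_recl; under eq_fun do rewrite big_ord_recl.
by apply: bED; [exact: hr|exact: IH].
Qed.

(** From [h <= h^2 / (2 r) + r / 2], which avoids square roots of integrals; this is why [r] has to
    be positive. *)
Lemma bE_sqrt (h : Om -> R) r : measurable_fun setT h -> (forall w, 0 <= h w) -> 0 < r ->
  bE (fun w => h w ^+ 2) (r ^+ 2) -> bE h r.
Proof.
move=> mh h0 r0 h2.
have := bED (bEZ (_ : 0 <= (2 * r)^-1) h2) (bE_cst (_ : 0 <= r / 2)).
rewrite invr_ge0 mulr_ge0 ?divr_ge0 ?(ltW r0)// => /(_ isT isT) b.
apply: bE_le b _ => //; last first.
  by rewrite invfM expr2 mulrA -[X in _ * _ * X * _]mulr1 mulrA mulfVK ?gt_eqF//; lra.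
move=> w; have : 0 <= (h w - r) ^+ 2 / (2 * r).
  by rewrite divr_ge0 ?sqr_ge0// mulr_ge0// ltW.
have -> : (h w - r) ^+ 2 / (2 * r) = (2 * r)^-1 * h w ^+ 2 + r / 2 - h w.
  by field; rewrite gt_eqF.
by rewrite subr_ge0.
Qed.

Definition hasE (X : Om -> R) (m : R) : Prop :=
  P.-integrable setT (EFin \o X) /\ (\int[P]_w (X w)%:E = m%:E)%E.

Lemma hasE_cst c : hasE (fun=> c) c.
Proof.
split; last by rewrite integral_prob_cst.
by apply: finite_measure_integrable_cst.
Qed.

Lemma hasED X Y m n : hasE X m -> hasE Y n -> hasE (fun w => X w + Y w) (m + n).
Proof.
move=> [iX eX] [iY eY]; split.
  exact: (integrableD measurableT iX iY).
by under eq_integral do rewrite EFinD; rewrite (integralD _ iX iY)//= eX eY.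
Qed.

Lemma hasEZ c X m : hasE X m -> hasE (fun w => c * X w) (c * m).
Proof.
move=> [iX eX]; split.
  exact: (integrableZl measurableT c iX).
by under eq_integral do rewrite EFinM; rewrite (integralZl _ iX)//= eX.
Qed.

Lemma hasE_sum n (X : 'I_n -> Om -> R) (m : 'I_n -> R) :
  (forall j, hasE (X j) (m j)) -> hasE (fun w => \sum_j X j w) (\sum_j m j).
Proof.
elim: n X m => [|n IH] X m h.
  by rewrite big_ord0; under eq_fun do rewrite big_ord0; exact: hasE_cst.
rewrite big_ord_recl; under eq_fun do rewrite big_ord_recl.
by apply: hasED; [exact: h|exact: IH].
Qed.

Lemma bE_hasE h r : bE h r -> exists2 m, hasE h m & m <= r.
Proof.
move=> [mh h0 hr].
have f : (\int[P]_w (h w)%:E)%E \is a fin_num.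
  rewrite ge0_fin_numE; first by rewrite (le_lt_trans hr)// ltry.
  by apply: integral_ge0 => w _; rewrite lee_fin.
exists (fine (\int[P]_w (h w)%:E)%E); last by rewrite -lee_fin fineK.
split; last by rewrite fineK.
apply/integrableP; split; first exact/measurable_EFinP.
under eq_integral do rewrite /= ger0_norm//.
by rewrite (le_lt_trans hr)// ltry.
Qed.

Lemma hasE_bE (h : Om -> R) m r : (forall w, 0 <= h w) -> hasE h m -> m <= r -> bE h r.
Proof.
move=> h0 [ih eh] mr; split => //; last by rewrite eh lee_fin.
by apply/measurable_EFinP; exact: measurable_int ih.
Qed.

Lemma sqr_integrable (X : Om -> R) r : measurable_fun setT X -> bE (fun w => X w ^+ 2) r ->
  exists m, hasE X m.
Proof.
move=> mX b; suff iX : P.-integrable setT (EFin \o X).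
  exists (fine (\int[P]_w (X w)%:E)%E); split => //.
  by rewrite fineK// integrable_fin_num.
have [m [ib _] _] := bE_hasE (bED (bE_cst (ler01 : 0 <= 1 :> R)) b).
apply: le_integrable ib => //; first exact/measurable_EFinP.
move=> w _ /=; rewrite lee_fin [leRHS]ger0_norm ?addr_ge0 ?sqr_ge0//.
have := sqr_ge0 (`|X w| - 1); rewrite -[X w ^+ 2](real_normK (num_real _)).
by have := normr_ge0 (X w); nra.
Qed.

Definition has_mean m n (Z : Om -> 'M[R]_(m, n)) (M : 'M[R]_(m, n)) :=
  forall i j, hasE (fun w => Z w i j) (M i j).

Lemma has_mean_cst m n (M : 'M[R]_(m, n)) : has_mean (fun=> M) M.
Proof. by move=> i j; exact: hasE_cst. Qed.

Lemma has_meanD m n (Z Z' : Om -> 'M[R]_(m, n)) M M' :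
  has_mean Z M -> has_mean Z' M' -> has_mean (fun w => Z w + Z' w) (M + M').
Proof.
by move=> h h' i j; rewrite mxE; under eq_fun do rewrite mxE; exact: hasED.
Qed.

Lemma has_meanZ m n c (Z : Om -> 'M[R]_(m, n)) M :
  has_mean Z M -> has_mean (fun w => c *: Z w) (c *: M).
Proof.
by move=> h i j; rewrite mxE; under eq_fun do rewrite mxE; exact: hasEZ.
Qed.

Lemma has_meanB m n (Z Z' : Om -> 'M[R]_(m, n)) M M' :
  has_mean Z M -> has_mean Z' M' -> has_mean (fun w => Z w - Z' w) (M - M').
Proof.
move=> h h'; have := has_meanD h (has_meanZ (-1) h'); rewrite scaleN1r.
by under eq_fun do rewrite scaleN1r.
Qed.

Lemma has_mean_L2 m n (Z : Om -> 'M[R]_(m, n)) (M : 'M[R]_(m, n)) r :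
  mmx Z -> bE (fun w => fsq (Z w)) r ->
  (forall i j, ('E_P[fun w => Z w i j] = (M i j)%:E)%E) -> has_mean Z M.
Proof.
move=> mZ b e i j.
have [] := @sqr_integrable (fun w => Z w i j) r (mZ i j).
  apply: bE_le b _ => //; first by apply: measurable_funX; exact: mZ.
  - by move=> w; exact: sqr_ge0.
  - by move=> w; exact: fsq_le_entry.
move=> x [iZ _]; split => //.
by have := e i j; rewrite unlock.
Qed.

(** The cross term is linear in [Z], hence has mean 0. Here [V] is fixed; freezing makes it
    random. *)
Lemma bE_pyth_cst m n (V : 'M[R]_(m, n)) (Z : Om -> 'M[R]_(m, n)) c :
  has_mean Z 0 -> bE (fun w => fsq (Z w)) c ->
  bE (fun w => fsq (V + Z w)) (fsq V + c).
Proof.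
move=> hZ bZ; have [c' hc cc'] := bE_hasE bZ.
apply: (@hasE_bE _ (fsq V + 2 * (\sum_i \sum_j V i j * 0) + c')).
- by move=> w; exact: fsq_ge0.
- under eq_fun do rewrite fsqD; apply: hasED => //.
  apply: hasED; first exact: hasE_cst.
  apply: hasEZ; apply: hasE_sum => i; apply: hasE_sum => j; apply: hasEZ.
  by have := hZ i j; rewrite mxE.
- rewrite big1 ?mulr0 ?addr0 ?lerD2l// => i _.
  by rewrite big1// => j _; rewrite mulr0.
Qed.

End expectation.

Section conditioning.
Context {R : realType} {dO : measure_display} {Om : measurableType dO}.
Context {P : probability Om R} {I : choiceType} {Dm : set I} {G : I -> set (set Om)}.
Hypothesis GI : independent_systems P Dm G.

(** The first argument of [h] carries what is known from [A], the second the fresh draws of [B]; [c]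
    bounds the conditional expectation given [A]. *)
Lemma bE_freeze (A B : set I) (h : Om -> Om -> R) (c : Om -> R) r :
  A `<=` Dm -> B `<=` Dm -> A `&` B `<=` set0 ->
  measurable_fun [set: jointT G A * jointT G B] (fun p => h p.1 p.2) ->
  (forall w w', 0 <= h w w') ->
  (forall w, (\int[P]_w' (h w w')%:E <= (c w)%:E)%E) -> bE P c r ->
  bE P (fun w => h w w) r.
Proof.
move=> AD BD AB mh h0 hc [mc c0 cr].
have mh' : measurable_fun [set: jointT G A * jointT G B] (fun p => (h p.1 p.2)%:E).
  exact/measurable_EFinP.
have h0' p : (0 <= (h p.1 p.2)%:E)%E by rewrite lee_fin.
split => //.
- have mw : measurable_fun [set: Om] (fun w => (w, w) : jointT G A * jointT G B).
    by apply: measurable_fun_pair; exact: (jointT_id_measurable GI).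
  exact: (measurableT_comp mh mw).
- have := freeze GI AD BD AB mh' h0' => /= ->.
  apply: le_trans cr; apply: ge0_le_integral => //.
  + by move=> w _; apply: integral_ge0 => w' _; rewrite lee_fin.
  + exact: (jointT_measurable_fun GI AD (freeze_measurable GI BD mh' h0')).
  + exact/measurable_EFinP.
Qed.

End conditioning.

Section joint_monotone.
Context {R : realType} {dO : measure_display} {Om : measurableType dO}.
Context {I : choiceType} {G : I -> set (set Om)}.

Lemma joint_id_sub (A A' : set I) : A `<=` A' ->
  measurable_fun [set: jointT G A'] (id : jointT G A' -> jointT G A).
Proof.
move=> AA' _ X mX; rewrite setTI.
by apply: sub_sigma_algebra2 mX; exact: bigcup_subset.
Qed.

Lemma joint_pair_sub (A B A' : set I) : A `<=` A' -> B `<=` A' ->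
  measurable_fun [set: jointT G A'] (fun w => (w, w) : jointT G A * jointT G B).
Proof. by move=> AA' BA'; apply: measurable_fun_pair; exact: joint_id_sub. Qed.

Lemma joint_map_sub (A B A' B' : set I) : A `<=` A' -> B `<=` B' ->
  measurable_fun [set: jointT G A' * jointT G B']
    (fun p => (p.1, p.2) : jointT G A * jointT G B).
Proof.
move=> AA' BB'; apply: measurable_fun_pair.
  exact: (measurableT_comp (joint_id_sub AA') measurable_fst).
exact: (measurableT_comp (joint_id_sub BB') measurable_snd).
Qed.

End joint_monotone.

Section pythagoras.
Context {R : realType} {dO : measure_display} {Om : measurableType dO}.
Context {P : probability Om R} {I : choiceType} {Dm : set I} {G : I -> set (set Om)}.
Hypothesis GI : independent_systems P Dm G.

Local Notation mmxJ A := (@mmx R _ (jointT G A) _ _).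
Local Notation mmxJ2 A B := (@mmx R _ (jointT G A * jointT G B)%type _ _).

Lemma bE_pyth (A B : set I) m n (V : Om -> 'M[R]_(m, n))
    (Z : Om -> Om -> 'M[R]_(m, n)) (c : Om -> R) r1 r2 :
  A `<=` Dm -> B `<=` Dm -> A `&` B `<=` set0 ->
  mmxJ A V -> mmxJ2 A B (fun p => Z p.1 p.2) ->
  (forall w, has_mean P (Z w) 0) ->
  (forall w, bE P (fun w' => fsq (Z w w')) (c w)) ->
  bE P (fun w => fsq (V w)) r1 -> bE P c r2 ->
  bE P (fun w => fsq (V w + Z w w)) (r1 + r2).
Proof.
move=> AD BD AB mV mZ hZ bZ bV bc.
apply: (bE_freeze GI AD BD AB (h := fun w w' => fsq (V w + Z w w'))
  (c := fun w => fsq (V w) + c w)).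
- apply: measurable_fsq; apply: mmxD => //.
  exact: (mmx_comp measurable_fst mV).
- by move=> w w'; exact: fsq_ge0.
- by move=> w; have [] := bE_pyth_cst (V w) (hZ w) (bZ w).
- exact: bED.
Qed.

(** The increments are added one by one: for the last one, [A] together with the [B j] of the
    earlier ones is the new past, and the partial sum plays the part of [V]. *)
Lemma bE_pyth_sum N (A : set I) (B : nat -> set I) m n (V : Om -> 'M[R]_(m, n))
    (Z : nat -> Om -> Om -> 'M[R]_(m, n)) (c : nat -> Om -> R) r1 (r2 : nat -> R) :
  A `<=` Dm -> (forall j, (j < N)%N -> B j `<=` Dm) ->
  (forall j, (j < N)%N -> A `&` B j `<=` set0) ->
  (forall j l, (j < l < N)%N -> B j `&` B l `<=` set0) ->
  mmxJ A V -> (forall j, (j < N)%N -> mmxJ2 A (B j) (fun p => Z j p.1 p.2)) ->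
  (forall j w, (j < N)%N -> has_mean P (Z j w) 0) ->
  (forall j w, (j < N)%N -> bE P (fun w' => fsq (Z j w w')) (c j w)) ->
  bE P (fun w => fsq (V w)) r1 -> (forall j, (j < N)%N -> bE P (c j) (r2 j)) ->
  bE P (fun w => fsq (V w + \sum_(j < N) Z j w w)) (r1 + \sum_(j < N) r2 j).
Proof.
move=> AD; elim: N => [|N IH] BD AB BB mV mZ hZ bZ bV bc.
  by rewrite big_ord0 addr0; under eq_fun do rewrite big_ord0 addr0.
pose A' := A `|` \bigcup_(j in `I_N) B j.
have AA' : A `<=` A' by left.
have BA' j : (j < N)%N -> B j `<=` A' by move=> jN k Bk; right; exists j.
rewrite big_ord_recr/= addrA; under eq_fun do rewrite big_ord_recr/= addrA.
apply: (@bE_pyth A' (B N) _ _ (fun w => V w + \sum_(j < N) Z j w w) (Z N) (c N)).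
- by move=> k [/AD//|[j /= jN]]; apply: BD; exact: ltnW.
- exact: BD.
- move=> k [[Ak|[j /= jN Bjk]] BNk]; first by apply: (AB N).
  by have := BB j N; rewrite jN ltnSn => /(_ isT k); apply.
- apply: mmxD; first exact: (mmx_comp (joint_id_sub (G := G) AA') mV).
  apply: mmx_sum => j.
  exact: (mmx_comp (joint_pair_sub (G := G) AA' (BA' _ (ltn_ord j))) (mZ j (ltnW (ltn_ord j)))).
- exact: (mmx_comp (joint_map_sub (G := G) AA' (@subset_refl _ (B N))) (mZ N (ltnSn N))).
- by move=> w; exact: hZ.
- by move=> w; exact: bZ.
- apply: IH => //.
  + by move=> j jN; apply: BD; exact: ltnW.
  + by move=> j jN; apply: AB; exact: ltnW.
  + by move=> j l /andP[jl lN]; apply: BB; rewrite jl ltnW.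
  + by move=> j jN; apply: mZ; exact: ltnW.
  + by move=> j w jN; apply: hZ; exact: ltnW.
  + by move=> j w jN; apply: bZ; exact: ltnW.
  + by move=> j jN; apply: bc; exact: ltnW.
- exact: bc.
Qed.

(** Freezing handles nonnegative integrands only, so the signed product is reached through squares:
    the mean of [(s x + (y - my))^2] is at most the mean of [x^2] plus that of [(y - my)^2], for
    [s = 1] and for [s = -1]. The cross term is then nonpositive with either sign, hence zero. *)
Lemma hasE_indepM (A B : set I) (x y : Om -> R) mx my rx ry :
  A `<=` Dm -> B `<=` Dm -> A `&` B `<=` set0 ->
  measurable_fun [set: jointT G A] x -> measurable_fun [set: jointT G B] y ->
  hasE P x mx -> hasE P y my ->
  bE P (fun w => x w ^+ 2) rx -> bE P (fun w => y w ^+ 2) ry ->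
  hasE P (fun w => x w * y w) (mx * my).
Proof.
move=> AD BD AB mx' my' hx hy bx by_.
have Mx := jointT_measurable_fun GI AD mx'.
have My := jointT_measurable_fun GI BD my'.
have [q hq] : exists q, hasE P (fun w => x w * y w) q.
  have b : bE P (fun w => (Num.sqrt `|x w * y w|) ^+ 2) ((rx + ry) / 2).
    apply: bE_le (bEZ (_ : 0 <= 2^-1) (bED bx by_)) _ => //.
    - apply: measurable_funX.
      apply: (measurableT_comp (continuous_measurable_fun (@sqrt_continuous R))).
      by apply: (measurableT_comp (@normr_measurable R setT)); exact: measurable_funM.
    - move=> w; rewrite sqr_sqrtr// normrM -(real_normK (num_real (x w))).
      rewrite -(real_normK (num_real (y w))).
      by have := sqr_ge0 (`|x w| - `|y w|); lra.
    - by rewrite mulrC.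
  have [c [ib _] _] := bE_hasE b.
  have ixy : P.-integrable setT (EFin \o (fun w => x w * y w)).
    apply: le_integrable ib => //; first exact/measurable_EFinP/measurable_funM.
    by move=> w _ /=; rewrite lee_fin sqr_sqrtr// normr_id.
  exists (fine (\int[P]_w (x w * y w)%:E)%E); split => //.
  by rewrite fineK// integrable_fin_num.
have [ex hex _] := bE_hasE bx.
have hy0 : hasE P (fun w => y w - my) 0.
  by rewrite -(subrr my); exact: (hasED hy (hasE_cst P (- my))).
have [c hc _] : exists2 c, hasE P (fun w => (y w - my) ^+ 2) c & True.
  have [ey hey _] := bE_hasE by_.
  exists (ey + (- 2 * my) * my + my ^+ 2) => //.
  have := hasED (hasED hey (hasEZ (- 2 * my) hy)) (hasE_cst P (my ^+ 2)).
  congr (hasE P _ _); apply/funext => w; ring.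
have scE T (g : T -> R) (i j : 'I_1) : (fun t => (g t)%:M i j) = g.
  by apply/funext => t; rewrite !ord1 mxE eqxx mulr1n.
have cross s : s ^+ 2 = 1 -> 2 * s * (q - my * mx) <= 0.
  move=> s1.
  have e1 w : fsq ((s * x w)%:M + (y w - my)%:M : 'M[R]_1) =
      x w ^+ 2 + 2 * s * (x w * y w - my * x w) + (y w - my) ^+ 2.
    rewrite /fsq !big_ord1 !mxE !mulr1n sqrrD exprMn s1; ring.
  have b : bE P (fun w => fsq ((s * x w)%:M + (y w - my)%:M : 'M[R]_1)) (ex + c).
    apply: (@bE_pyth A B _ _ (fun w => (s * x w)%:M : 'M[R]_1)
       (fun _ w' => (y w' - my)%:M : 'M[R]_1) (fun=> c)) => //.
    - by move=> i j; rewrite scE; exact: (measurable_funM (measurable_cst s) mx').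
    - move=> i j; rewrite scE.
      exact: (measurable_funB (measurableT_comp my' measurable_snd) (measurable_cst my)).
    - by move=> w i j; rewrite scE mxE.
    - move=> _; under eq_fun do rewrite /fsq !big_ord1 mxE mulr1n.
      by apply: hasE_bE hc _ => // w; exact: sqr_ge0.
    - under eq_fun do rewrite /fsq !big_ord1 mxE mulr1n exprMn s1 mul1r.
      by apply: hasE_bE hex _ => // w; exact: sqr_ge0.
    - by apply: bE_cst; apply: bE_r_ge0 (hasE_bE _ hc _) => // w; exact: sqr_ge0.
  have [e he le] := bE_hasE b.
  have he' : hasE P (fun w => fsq ((s * x w)%:M + (y w - my)%:M : 'M[R]_1))
      (ex + 2 * s * (q + (- my) * mx) + c).
    under eq_fun do rewrite e1 -mulNr.
    exact: (hasED (hasED hex (hasEZ _ (hasED hq (hasEZ _ hx)))) hc).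
  have ee : e = ex + 2 * s * (q + (- my) * mx) + c.
    by case: he he' => _ h1 [_]; rewrite h1 => -[].
  by move: le; rewrite ee mulNr; lra.
suff -> : mx * my = q by [].
have := cross 1 (expr1n _ _); have := cross (-1); rewrite sqrrN expr1n => /(_ erefl).
lra.
Qed.

Lemma has_mean_indepM (A B : set I) m n p (X : Om -> 'M[R]_(m, n))
    (Y : Om -> 'M[R]_(n, p)) MX MY rx ry :
  A `<=` Dm -> B `<=` Dm -> A `&` B `<=` set0 ->
  mmxJ A X -> mmxJ B Y -> has_mean P X MX -> has_mean P Y MY ->
  bE P (fun w => fsq (X w)) rx -> bE P (fun w => fsq (Y w)) ry ->
  has_mean P (fun w => X w *m Y w) (MX *m MY).
Proof.
move=> AD BD AB mX mY hX hY bX bY i j.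
rewrite mxE; under eq_fun do rewrite mxE.
apply: hasE_sum => k.
apply: (@hasE_indepM A B (fun w => X w i k) (fun w => Y w k j) _ _ rx ry) => //.
- apply: bE_le bX _ => //; last by move=> w; exact: fsq_le_entry.
    exact: (measurable_funX _ (jointT_measurable_fun GI AD (mX i k))).
  by move=> w; exact: sqr_ge0.
- apply: bE_le bY _ => //; last by move=> w; exact: fsq_le_entry.
    exact: (measurable_funX _ (jointT_measurable_fun GI BD (mY k j))).
  by move=> w; exact: sqr_ge0.
Qed.

End pythagoras.

(** * The algorithm under common constants *)

Section indices.
Variables T K B0 B1 : nat.

(** [None], the index of [tau], is always excluded, so that whatever is measurable for such a set is
    independent of [tau]. *)
Definition indices (p : pred (nat * nat * nat)) : set (option (nat * nat * nat)) :=
  [set k | if k is Some x then drawn T K B0 B1 x && p x else false].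

Lemma indices_sub (p q : pred (nat * nat * nat)) :
  (forall x, drawn T K B0 B1 x -> p x -> q x) -> indices p `<=` indices q.
Proof. by move=> pq [x|] //= /andP[dx px]; rewrite dx pq. Qed.

Lemma indices_disj (p q : pred (nat * nat * nat)) :
  (forall x, p x -> q x -> false) -> indices p `&` indices q `<=` set0.
Proof. by move=> pq [x|] /= [] // /andP[_ px] /andP[_ qx]; have := pq _ px qx. Qed.

Lemma indices_dom (p : pred (nat * nat * nat)) :
  indices p `<=` [set k | oapp (drawn T K B0 B1) true k].
Proof. by move=> [x|] //= h; case/andP: h. Qed.

Definition past t := indices (fun x => x.1.1 < t)%N.

(* the samples on which ut n of iteration t depends *)
Definition below t n :=
  indices (fun x => (x.1.1 < t) || ((x.1.1 == t) && (x.1.2 < n)))%N.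

Lemma past_below t n : past t `<=` below t n.
Proof. by apply: indices_sub => x _ ->. Qed.

Lemma below_past t n : below t n `<=` past t.+1.
Proof.
apply: indices_sub => x _ /orP[/ltnW//|/andP[/eqP -> _]]; exact: ltnSn.
Qed.

Lemma below_mono t n n' : (n <= n')%N -> below t n `<=` below t n'.
Proof.
move=> nn'; apply: indices_sub => x _ /orP[->//|/andP[-> xn]].
by rewrite (leq_trans xn nn') orbT.
Qed.

Lemma past_mono t t' : (t <= t')%N -> past t `<=` past t'.
Proof. by move=> tt'; apply: indices_sub => x _ xt; exact: leq_trans xt tt'. Qed.

(** The draws on which a point with the j-th samples averaged out depends. This set is disjoint from
    [column t j K], the draws that enter the j-th product of Jacobians. *)
Definition others t j :=
  indices (fun x => (x.1.1 < t) || ((x.1.1 == t) && (x.2 != j)))%N.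

Definition column t j n :=
  indices (fun x => (x.1.1 == t) && (x.2 == j) && (x.1.2 < n))%N.

End indices.

Definition sample_systems (R : realType) (dS dO : measure_display)
    (S : measurableType dS) (Om : measurableType dO) (P : probability Om R)
    (xi : nat -> nat -> nat -> {RV P >-> S}) (tau : {RV P >-> nat})
    (k : option (nat * nat * nat)) : set (set Om) :=
  if k is Some (t, i, j) then preimage_set_system setT (xi t i j) measurable
  else preimage_set_system setT tau measurable.

Section run.
Context {R : realType} {K : nat} {d : nat -> nat} (dK : d K = 1%N).
Context {dS dO : measure_display} {S : measurableType dS} {Om : measurableType dO}.
Context {P : probability Om R} (o : @oracle R d dS S).
Context (lmo : 'cV[R]_(d 0%N) -> 'rV[R]_(d 0%N)) (x1 : 'rV[R]_(d 0%N)).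
Context (B0 B1 : nat) (xi : nat -> nat -> nat -> {RV P >-> S}) (e : R).

Definition run t w := pmvr o dK lmo x1 B0 B1 e e (fun t i j => xi t i j w) t.
Definition run_u t w i := ut (run t w) i.

Definition level_err (f : @level_maps R d) t w i : 'rV[R]_(d i.+1) :=
  run_u t w i.+1 - @f i (run_u t w i).

(** The contribution of one sample to the update of a level, minus its mean at fixed points. The
    same sample serves at the new point and, with weight [1 - e], at the old one, which is what
    reduces the variance. *)
Definition noise (f : @level_maps R d) t i j (y y' : 'rV[R]_(d i)) w : 'rV[R]_(d i.+1) :=
  (oval o y (xi t i j w) - @f i y) - (1 - e) *: (oval o y' (xi t i j w) - @f i y').

End run.

(* A common bound L >= 1 for all the constants, and equal parameters alpha = eta = e. *)
Record pmvr_setup {R : realType} {K : nat} {d : nat -> nat} (dK : d K = 1%N)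
    (X : set 'rV[R]_(d 0%N)) (f : @level_maps R d) {dS dO : measure_display}
    {S : measurableType dS} {Om : measurableType dO} {P : probability Om R}
    (o : @oracle R d dS S) (lmo : 'cV[R]_(d 0%N) -> 'rV[R]_(d 0%N)) (x1 : 'rV[R]_(d 0%N))
    (T B0 B1 : nat) (xi : nat -> nat -> nat -> {RV P >-> S}) (tau : {RV P >-> nat})
    (L e : R) : Prop := PmvrSetup {
  su_indep : independent_systems P
    [set k | oapp (drawn T K B0 B1) true k] (sample_systems xi tau);
  su_L : 1 <= L;
  su_e0 : 0 < e;
  su_e1 : e <= 1;
  su_B0 : (0 < B0)%N;
  su_B1 : (0 < B1)%N;
  su_B1e : B1%:R^-1 <= e;
  su_lmoX : forall v, X (lmo v);
  su_x1 : X x1;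
  su_step : forall x y, X x -> X y -> X (x + e *: (y - x));
  su_diam : forall x y, X x -> X y -> fsq (x - y) <= L ^+ 2;
  su_lmo_meas : forall k, measurable_fun [set: borel 'cV[R]_(d 0%N)]
     (fun v : borel 'cV[R]_(d 0%N) => lmo v 0 k : R);
  su_diff : forall i, (i < K)%N -> forall x, differentiable (@f i) x;
  su_lip : forall i, (i < K)%N -> forall x y : 'rV[R]_(d i),
    fsq (@f i x - @f i y) <= L ^+ 2 * fsq (x - y);
  su_jbound : forall i, (i < K)%N -> forall x, opnorm ('J (@f i) x) <= L;
  su_jlip : forall i, (i < K)%N -> forall x y : 'rV[R]_(d i),
    opnorm ('J (@f i) x - 'J (@f i) y) ^+ 2 <= L ^+ 2 * fsq (x - y);
  su_mean : forall t i j, drawn T K B0 B1 (t, i, j) -> forall x : 'rV[R]_(d i),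
    has_mean P (fun w => oval o x (xi t i j w)) (@f i x);
  su_var : forall t i j, drawn T K B0 B1 (t, i, j) -> forall x : 'rV[R]_(d i),
    bE P (fun w => fsq (oval o x (xi t i j w) - @f i x)) (L ^+ 2);
  su_jmean : forall t i j, drawn T K B0 B1 (t, i, j) -> forall x : 'rV[R]_(d i),
    has_mean P (fun w => ojac o x (xi t i j w)) ('J (@f i) x);
  su_jvar : forall t i j, drawn T K B0 B1 (t, i, j) -> forall x : 'rV[R]_(d i),
    bE P (fun w => opnorm (ojac o x (xi t i j w) - 'J (@f i) x) ^+ 2) (L ^+ 2);
  su_oval_lip : forall t i j, drawn T K B0 B1 (t, i, j) -> forall x y : 'rV[R]_(d i),
    bE P (fun w => fsq (oval o x (xi t i j w) - oval o y (xi t i j w)))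
      (L ^+ 2 * fsq (x - y));
  su_ojac_lip : forall t i j, drawn T K B0 B1 (t, i, j) -> forall x y : 'rV[R]_(d i),
    bE P (fun w => opnorm (ojac o x (xi t i j w) - ojac o y (xi t i j w)) ^+ 2)
      (L ^+ 2 * fsq (x - y)) }.

Section setup_continuity.
Context {R : realType} {K : nat} {d : nat -> nat} {dK : d K = 1%N}.
Context {X : set 'rV[R]_(d 0%N)} {f : @level_maps R d}.
Context {dS dO : measure_display} {S : measurableType dS} {Om : measurableType dO}.
Context {P : probability Om R} {o : @oracle R d dS S}.
Context {lmo : 'cV[R]_(d 0%N) -> 'rV[R]_(d 0%N)} {x1 : 'rV[R]_(d 0%N)}.
Context {T B0 B1 : nat} {xi : nat -> nat -> nat -> {RV P >-> S}} {tau : {RV P >-> nat}}.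
Context {L e : R}.
Hypothesis H : pmvr_setup dK X f o lmo x1 T B0 B1 xi tau L e.


Lemma su_cont i : (i < K)%N -> continuous (@f i).
Proof. by move=> iK x; apply: differentiable_continuous; exact: (su_diff H iK). Qed.

Lemma su_jcont i : (i < K)%N -> continuous (fun x => 'J (@f i) x).
Proof.
move=> iK; apply: (@lipschitz_mx_continuous _ _ _ _ _ _ (Num.sqrt (d i.+1)%:R * L)) => x y.
have L0 := le_trans ler01 (su_L H).
rewrite -[X in _ * X * _]ger0_norm// -sqrtr_sqr -!sqrtrM ?mulr_ge0 ?sqr_ge0//.
rewrite ler_wsqrtr// (le_trans (fsq_opnorm _))// -mulrA ler_wpM2l//.
exact: (su_jlip H iK).
Qed.

End setup_continuity.

Section oracle_measurability.
Context {R : realType} {d : nat -> nat} {dS : measure_display} {S : measurableType dS}.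
Context (o : @oracle R d dS S) {dT : measure_display} (T : measurableType dT).

Lemma mmx_oval i (y : T -> 'rV[R]_(d i)) (s : T -> S) :
  mmx y -> measurable_fun setT s -> mmx (fun t => oval o (y t) (s t)).
Proof.
move=> my ms k l; rewrite ord1.
apply: (measurableT_comp (oval_measurable o l)
  (g := fun t => (y t : borel 'rV[R]_(d i), s t))).
by apply: measurable_fun_pair => //; exact: mmx_borel.
Qed.

Lemma mmx_ojac i (y : T -> 'rV[R]_(d i)) (s : T -> S) :
  mmx y -> measurable_fun setT s -> mmx (fun t => ojac o (y t) (s t)).
Proof.
move=> my ms k l.
apply: (measurableT_comp (ojac_measurable o k l)
  (g := fun t => (y t : borel 'rV[R]_(d i), s t))).
by apply: measurable_fun_pair => //; exact: mmx_borel.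
Qed.

(** A supremum over an uncountable ball is not visibly measurable, but [opnorm] is 1-Lipschitz for
    the Frobenius norm. The value is wrapped as a 1 x 1 matrix to fit the continuity lemma. *)
Lemma measurable_opnorm m n (A : T -> 'M[R]_(m, n)) :
  mmx A -> measurable_fun setT (fun t => opnorm (A t)).
Proof.
move=> mA; have mB : mmx (fun t => (opnorm (A t))%:M : 'M[R]_1).
  apply: (@mmx_continuous _ _ _ _ _ _ _ (fun B => (opnorm B)%:M : 'M[R]_1)) => //.
  apply: (@lipschitz_mx_continuous _ _ _ _ _ _ 1) => x y.
  rewrite mul1r /fsq !big_ord1 !mxE !mulr1n sqrtr_sqr.
  have hB (B C : 'M[R]_(m, n)) : opnorm B - opnorm C <= Num.sqrt (fsq (B - C)).
    apply: (@le_trans _ _ (opnorm (B - C))).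
      by rewrite lerBlDr -{1}(subrK C B) opnormD.
    by rewrite -(ger0_norm (opnorm_ge0 _)) -sqrtr_sqr ler_wsqrtr// opnorm_fsq.
  rewrite ler_norml hB andbT lerNl opprB.
  by rewrite (le_trans (hB _ _))// fsqBC.
have := mB 0 0; congr (measurable_fun _ _); apply/funext => t.
by rewrite mxE mulr1n.
Qed.

Lemma mmx_chain_prod n (A : T -> forall i, 'M[R]_(d i, d i.+1)) :
  (forall i, (i < n)%N -> mmx (fun t => A t i)) -> mmx (fun t => chain_prod (A t) n).
Proof.
elim: n => [|n IH] mA /=; first exact: mmx_cst.
by apply: mmxM; [apply: IH => i /ltnW; exact: mA|exact: mA].
Qed.

End oracle_measurability.

(** * Level errors *)

Section masked_update.
Context {R : realType} {d : nat -> nat} (f : @level_maps R d).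
Context {dS : measure_display} {S : measurableType dS} (o : @oracle R d dS S).
Variables (B1 : nat) (e : R).

Definition masked_val (b : nat -> bool) (s : nat -> nat -> S) i (y : 'rV[R]_(d i)) j :
    'rV[R]_(d i.+1) :=
  if b j then @f i y else oval o y (s i j).

(* Averaging a sample out of an unbiased oracle answer leaves the exact value;
   u_mask averages out the samples j selected by b, on all levels. *)
Fixpoint u_mask (b : nat -> bool) (up : forall i, 'rV[R]_(d i)) (x : 'rV[R]_(d 0))
    (s : nat -> nat -> S) (i : nat) : 'rV[R]_(d i) :=
  if i is i'.+1 then
    (1 - e) *: up i'.+1 + batch_mean B1 (masked_val b s (u_mask b up x s i'))
    - (1 - e) *: batch_mean B1 (masked_val b s (up i'))
  else x.

Lemma u_mask_none up x s i : u_mask (fun=> false) up x s i = u_next o B1 e up x s i.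
Proof. by elim: i => //= i ->. Qed.

End masked_update.

(** The counterpart of [run_u] at iteration [t.+1]. Only this iteration is masked: the previous
    [run_u t] and the new [xt] are the true ones, both determined by the past. *)
Definition masked_u {R : realType} {K : nat} {d : nat -> nat} (dK : d K = 1%N)
    {dS dO : measure_display} {S : measurableType dS} {Om : measurableType dO}
    {P : probability Om R} (o : @oracle R d dS S)
    (lmo : 'cV[R]_(d 0%N) -> 'rV[R]_(d 0%N)) (x1 : 'rV[R]_(d 0%N)) (B0 B1 : nat)
    (xi : nat -> nat -> nat -> {RV P >-> S}) (e : R) (f : @level_maps R d)
    (b : nat -> bool) t w i :=
  u_mask f o B1 e b (run_u dK o lmo x1 B0 B1 xi e t w)
    (xt (run dK o lmo x1 B0 B1 xi e t.+1 w)) (fun i j => xi t.+1 i j w) i.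

Section measurability.
Context {R : realType} {K : nat} {d : nat -> nat} {dK : d K = 1%N}.
Context {X : set 'rV[R]_(d 0%N)} {f : @level_maps R d}.
Context {dS dO : measure_display} {S : measurableType dS} {Om : measurableType dO}.
Context {P : probability Om R} {o : @oracle R d dS S}.
Context {lmo : 'cV[R]_(d 0%N) -> 'rV[R]_(d 0%N)} {x1 : 'rV[R]_(d 0%N)}.
Context {T B0 B1 : nat} {xi : nat -> nat -> nat -> {RV P >-> S}} {tau : {RV P >-> nat}}.
Context {L e : R}.
Hypothesis H : pmvr_setup dK X f o lmo x1 T B0 B1 xi tau L e.

Local Notation G := (sample_systems xi tau).
Local Notation past := (past T K B0 B1).
Local Notation below := (below T K B0 B1).
Local Notation mmxJ A := (@mmx R _ (jointT G A) _ _).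
Local Notation run := (run dK o lmo x1 B0 B1 xi e).
Local Notation U := (run_u dK o lmo x1 B0 B1 xi e).

Lemma xi_measurable A t i j : A (Some (t, i, j)) ->
  measurable_fun [set: jointT G A] (xi t i j).
Proof.
move=> Ax _ B mB; rewrite setTI; apply: sub_sigma_algebra.
by exists (Some (t, i, j)) => //; exists B => //; rewrite setTI.
Qed.


Lemma u_mask_measurable A b t (up : Om -> forall i, 'rV[R]_(d i)) (x : Om -> 'rV[R]_(d 0)) n :
  (n <= K)%N ->
  (forall i j, (i < n)%N -> (j < B1)%N -> ~~ b j -> A (Some (t, i, j))) ->
  (forall i, (i <= n)%N -> mmxJ A (fun w => up w i)) -> mmxJ A x ->
  mmxJ A (fun w => u_mask f o B1 e b (up w) (x w) (fun i j => xi t i j w) n).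
Proof.
move=> + + + mx; elim: n => [//|n IH] nK As mup /=.
have mval (y : Om -> 'rV[R]_(d n)) j : (j < B1)%N -> mmxJ A y ->
    mmxJ A (fun w => masked_val f o b (fun i j => xi t i j w) (y w) j).
  move=> jB my; rewrite /masked_val; have [_|bj] := boolP (b j).
    by apply: (@mmx_continuous _ _ _ _ _ _ _ (@f n)) => //; exact: (su_cont H nK).
  by apply: mmx_oval => //; apply: xi_measurable; exact: As.
apply: mmxB; [apply: mmxD|].
- by apply: mmxZ; exact: mup.
- apply: mmx_batch_mean => j jB; apply: mval => //; apply: IH.
  + exact: ltnW.
  + by move=> i k /ltnW; exact: As.
  + by move=> i /leqW; exact: mup.
- by apply: mmxZ; apply: mmx_batch_mean => j jB; apply: mval => //; exact: mup.
Qed.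

Lemma jac_prod_measurable dT (T0 : measurableType dT) (y : T0 -> forall i, 'rV[R]_(d i))
    (s : T0 -> nat -> nat -> S) j :
  (forall i, (i < K)%N -> mmx (fun t => y t i)) ->
  (forall i, (i < K)%N -> measurable_fun setT (fun t => s t i j)) ->
  mmx (fun t => jac_prod o dK (y t) (s t) j).
Proof.
move=> my ms; apply: mmx_castmx; apply: mmx_chain_prod => i iK.
by apply: mmx_ojac; [exact: my|exact: ms].
Qed.

(** One induction for both claims, since the points of iteration [t.+1] pass through [vt] of
    iteration [t] by way of [lmo]. Any [A] containing the draws involved is allowed, which spares
    changes of sigma-algebra. *)
Lemma run_measurable t : (t < T)%N -> forall A,
  (past t.+1 `<=` A -> mmxJ A (fun w => vt (run t w))) /\
  (forall i, (i <= K)%N -> below t i `<=` A -> mmxJ A (fun w => U t w i)).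
Proof.
elim: t => [|t IH] tT A.
  have mu A' i : (i <= K)%N -> below 0 i `<=` A' -> mmxJ A' (fun w => U 0 w i).
    elim: i => [|i IHi] iK /= sA; first exact: mmx_cst.
    apply: mmx_batch_mean => j jB; apply: mmx_oval.
      by apply: IHi; [exact: ltnW|exact: subset_trans (@below_mono _ _ _ _ 0 _ _ (leqnSn i)) sA].
    by apply: xi_measurable; apply: sA; rewrite /= tT iK jB ltnSn.
  split; last exact: mu.
  move=> sA; apply: mmx_batch_mean => j jB; apply: jac_prod_measurable => i iK.
    by apply: mu; [exact: ltnW|exact: subset_trans (@below_past _ _ _ _ 0 i) sA].
  by apply: xi_measurable; apply: sA; rewrite /= tT iK jB.
have tT' : (t < T)%N by exact: ltnW.
have mx A' : past t.+1 `<=` A' -> mmxJ A' (fun w => xt (run t.+1 w)).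
  move=> sA; have [mv mU] := IH tT' A'.
  have mxt : mmxJ A' (fun w => xt (run t w)).
    have -> : (fun w => xt (run t w)) = (fun w => U t w 0) by case: (t).
    by apply: mU => //; exact: subset_trans (@below_past _ _ _ _ t 0) sA.
  apply: mmxD => //; apply: mmxZ; apply: mmxB => // i k; rewrite ord1.
  exact: (measurableT_comp (su_lmo_meas H k) (mmx_borel (mv sA))).
have mu A' i : (i <= K)%N -> below t.+1 i `<=` A' -> mmxJ A' (fun w => U t.+1 w i).
  move=> iK sA.
  have sA' : past t.+1 `<=` A' by exact: subset_trans (@past_below _ _ _ _ t.+1 i) sA.
  have -> : (fun w => U t.+1 w i) = (fun w => u_mask f o B1 e (fun=> false) (U t w)
      (xt (run t.+1 w)) (fun i j => xi t.+1 i j w) i).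
    by apply/funext => w; rewrite u_mask_none.
  apply: u_mask_measurable => //; last exact: mx.
    move=> i' j i'i jB _; apply: sA.
    by rewrite /= tT (leq_trans i'i iK) jB eqxx i'i orbT.
  move=> i' i'i; have [_ mU] := IH tT' A'.
  apply: mU; first exact: leq_trans i'i iK.
  exact: subset_trans (@below_past _ _ _ _ t i') sA'.
split; last exact: mu.
move=> sA.
have mjac A' (y : Om -> forall i, 'rV[R]_(d i)) j : (j < B1)%N -> past t.+2 `<=` A' ->
   (forall i, (i < K)%N -> mmxJ A' (fun w => y w i)) ->
   mmxJ A' (fun w => jac_prod o dK (y w) (fun i j => xi t.+1 i j w) j).
  move=> jB sA' my; apply: jac_prod_measurable => // i iK.
  by apply: xi_measurable; apply: sA'; rewrite /= tT iK jB ltnSn.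
have [mv mU] := IH tT' A.
have sA' : past t.+1 `<=` A by exact: subset_trans (@past_mono _ _ _ _ _ _ (leqnSn _)) sA.
apply: mmxB; [apply: mmxD|].
- by apply: mmxZ; exact: mv.
- apply: mmx_batch_mean => j jB; apply: mjac => // i iK.
  by apply: (mu A i (ltnW iK)); exact: subset_trans (@below_past _ _ _ _ t.+1 i) sA.
- apply: mmxZ; apply: mmx_batch_mean => j jB; apply: mjac => // i iK.
  by apply: mU; [exact: ltnW|exact: subset_trans (@below_past _ _ _ _ t i) sA'].
Qed.

Lemma v_measurable t A : (t < T)%N -> past t.+1 `<=` A ->
  mmxJ A (fun w => vt (run t w)).
Proof. by move=> tT; have [mv _] := run_measurable tT A; exact: mv. Qed.

Lemma u_measurable t i A : (t < T)%N -> (i <= K)%N -> below t i `<=` A ->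
  mmxJ A (fun w => U t w i).
Proof. by move=> tT; have [_ mU] := run_measurable tT A; exact: mU. Qed.

Lemma u0E t w : U t w 0 = xt (run t w). Proof. by case: t. Qed.

Lemma x_measurable t A : (t < T)%N -> past t `<=` A -> mmxJ A (fun w => xt (run t w)).
Proof.
move=> tT sA; have -> : (fun w => xt (run t w)) = (fun w => U t w 0).
  by apply/funext => w; rewrite u0E.
apply: u_measurable => //; apply: subset_trans sA; apply: indices_sub => x _.
by rewrite ltn0 andbF orbF.
Qed.

End measurability.

Section batch_mean_theory.
Context {R : realType}.

Lemma batch_meanB (V : lmodType R) B (g h : nat -> V) :
  batch_mean B (fun j => g j - h j) = batch_mean B g - batch_mean B h.
Proof. by rewrite /batch_mean sumrB scalerBr. Qed.

Lemma batch_meanD (V : lmodType R) B (g h : nat -> V) :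
  batch_mean B (fun j => g j + h j) = batch_mean B g + batch_mean B h.
Proof. by rewrite /batch_mean big_split/= scalerDr. Qed.

Lemma batch_meanZ (V : lmodType R) B c (g : nat -> V) :
  batch_mean B (fun j => c *: g j) = c *: batch_mean B g.
Proof. by rewrite /batch_mean -scaler_sumr !scalerA mulrC. Qed.

Lemma batch_mean_cst (V : lmodType R) B (v : V) : (0 < B)%N ->
  batch_mean B (fun=> v) = v.
Proof.
move=> B_gt0; rewrite /batch_mean sumr_const card_ord -[v *+ B]scaler_nat scalerA mulVf ?scale1r//.
by rewrite pnatr_eq0 -lt0n.
Qed.

End batch_mean_theory.

Section level_errors.
Context {R : realType} {K : nat} {d : nat -> nat} {dK : d K = 1%N}.
Context {X : set 'rV[R]_(d 0%N)} {f : @level_maps R d}.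
Context {dS dO : measure_display} {S : measurableType dS} {Om : measurableType dO}.
Context {P : probability Om R} {o : @oracle R d dS S}.
Context {lmo : 'cV[R]_(d 0%N) -> 'rV[R]_(d 0%N)} {x1 : 'rV[R]_(d 0%N)}.
Context {T B0 B1 : nat} {xi : nat -> nat -> nat -> {RV P >-> S}} {tau : {RV P >-> nat}}.
Context {L e : R}.
Hypothesis H : pmvr_setup dK X f o lmo x1 T B0 B1 xi tau L e.

Local Notation G := (sample_systems xi tau).
Local Notation drawn := (drawn T K B0 B1).
Local Notation indices := (indices T K B0 B1).
Local Notation below := (below T K B0 B1).
Local Notation mmxJ A := (@mmx R _ (jointT G A) _ _).
Local Notation U := (run_u dK o lmo x1 B0 B1 xi e).
Local Notation level_err := (level_err dK o lmo x1 B0 B1 xi e f).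
Local Notation noise := (noise o xi e f).

Let L0 : 0 <= L. Proof. exact: le_trans ler01 (su_L H). Qed.
Let e0 : 0 <= e. Proof. exact: ltW (su_e0 H). Qed.
Let e1 := su_e1 H.

Lemma noise_mean t i j (y y' : 'rV[R]_(d i)) : drawn (t, i, j) -> has_mean P (noise t j y y') 0.
Proof.
move=> dr; have h z := has_meanB (su_mean H dr z) (has_mean_cst P (@f i z)).
have := has_meanB (h y) (has_meanZ (1 - e) (h y')).
by rewrite !subrr scaler0 subr0.
Qed.

Lemma noise_fsq t i j (y y' : 'rV[R]_(d i)) : drawn (t, i, j) ->
  bE P (fun w => fsq (noise t j y y' w))
    (2 * (e ^+ 2 * L ^+ 2) + 8 * L ^+ 2 * fsq (y - y')).
Proof.
move=> dr; have xm := measurable_funPT (xi t i j).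
have mo z : mmx (fun w => oval o z (xi t i j w)).
  by apply: mmx_oval => //; exact: mmx_cst.
have b1 := bEZ (_ : 0 <= 2 * e ^+ 2) (su_var H dr y).
have b2 := bEZ (_ : 0 <= 4) (bED (su_oval_lip H dr y y')
  (bE_cst P (fsq_ge0 (@f i y - @f i y')))).
apply: bE_le (bED (b1 (mulr_ge0 (ler0n _ _) (sqr_ge0 _))) (b2 (ler0n _ _))) _.
- apply: measurable_fsq; apply: mmxB; first by apply: mmxB => //; exact: mmx_cst.
  by apply: mmxZ; apply: mmxB => //; exact: mmx_cst.
- by move=> w; exact: fsq_ge0.
- move=> w; set s := xi t i j w.
  (* The sampling error proper has coefficient [e]; what comes with [1 - e] is a difference between
     the two points, controlled by the mean-square Lipschitz hypothesis. *)
  have -> : noise t j y y' w = e *: (oval o y s - @f i y)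
     + (1 - e) *: ((oval o y s - oval o y' s) - (@f i y - @f i y')).
    rewrite /noise -/s; apply/rowP => k; rewrite !mxE; ring.
  apply: le_trans (fsqD_le2 _ _) _; rewrite !fsqZ mulrA lerD2l.
  have h : (1 - e) ^+ 2 <= 1 by rewrite exprn_ile1// ?subr_ge0// lerBlDr lerDl.
  have := fsqD_le2 (oval o y s - oval o y' s) (- (@f i y - @f i y')).
  rewrite fsqN => h2.
  have := ler_pM (sqr_ge0 _) (fsq_ge0 _) h h2; rewrite mul1r; lra.
- have := su_lip H (_ : (i < K)%N) y y'.
  by move: dr => /and3P[_ iK _] /(_ iK); lra.
Qed.

Lemma noise_measurable dT (T0 : measurableType dT) t i j
    (y y' : T0 -> 'rV[R]_(d i)) (g : T0 -> Om) : (i < K)%N ->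
  mmx y -> mmx y' -> measurable_fun setT (fun p => xi t i j (g p)) ->
  mmx (fun p => noise t j (y p) (y' p) (g p)).
Proof.
move=> iK my my' mg.
have mf (z : T0 -> 'rV[R]_(d i)) : mmx z -> mmx (fun p => oval o (z p) (xi t i j (g p)) - @f i (z p)).
  move=> mz; apply: mmxB; first exact: mmx_oval.
  by apply: (@mmx_continuous _ _ _ _ _ _ _ (@f i)) => //; exact: (su_cont H iK).
by apply: mmxB; [exact: mf|apply: mmxZ; exact: mf].
Qed.

(** Given [below t.+1 i] the points are fixed, and the samples of level [i] give independent
    centered terms. Pythagoras then yields the factor [1 / B1], with no cross term against [V]. *)
Lemma bE_noise_avg t i (y y' : Om -> 'rV[R]_(d i)) (V : Om -> 'rV[R]_(d i.+1)) r m :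
  (t.+1 < T)%N -> (i < K)%N -> mmxJ (below t.+1 i) y -> mmxJ (below t.+1 i) y' ->
  mmxJ (below t.+1 i) V -> bE P (fun w => fsq (V w)) r ->
  bE P (fun w => fsq (y w - y' w)) m ->
  bE P (fun w => fsq (V w + batch_mean B1 (fun j => noise t.+1 j (y w) (y' w) w)))
    (r + B1%:R^-1 * (2 * (e ^+ 2 * L ^+ 2) + 8 * L ^+ 2 * m)).
Proof.
move=> tT iK my my' mV bV bm.
have Bp : 0 < B1%:R :> R by rewrite ltr0n (su_B1 H).
have dr j : (j < B1)%N -> drawn (t.+1, i, j) by move=> jB; rewrite /= tT iK jB.
set c := _ + _ * m.
have -> : B1%:R^-1 * c = \sum_(j < B1) (B1%:R^-1) ^+ 2 * c.
  rewrite sumr_const card_ord -[RHS]mulr_natl expr2 !mulrA mulfV ?gt_eqF//.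
  by rewrite mul1r.
under eq_fun do rewrite /batch_mean scaler_sumr.
apply: (bE_pyth_sum (su_indep H) (A := below t.+1 i)
  (B := fun j => indices (fun x => x == (t.+1, i, j)))
  (Z := fun j w w' => B1%:R^-1 *: noise t.+1 j (y w) (y' w) w')
  (c := fun _ w => B1%:R^-1 ^+ 2 * (2 * (e ^+ 2 * L ^+ 2) + 8 * L ^+ 2 * fsq (y w - y' w)))
  (r2 := fun=> B1%:R^-1 ^+ 2 * c)) => //.
- exact: indices_dom.
- by move=> j _; exact: indices_dom.
- move=> j _; apply: indices_disj => x /orP[xt /eqP xE|/andP[_ xi' /eqP xE]].
    by move: xt; rewrite xE/= ltnn.
  by move: xi'; rewrite xE/= ltnn.
- move=> j l /andP[jl _]; apply: indices_disj => x /eqP -> /eqP[jlE].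
  by move: jl; rewrite jlE ltnn.
- move=> j jB; apply: mmxZ; apply: noise_measurable => //.
  + exact: (mmx_comp measurable_fst my).
  + exact: (mmx_comp measurable_fst my').
  + apply: (measurableT_comp (f := xi t.+1 i j : jointT G _ -> S)); last exact: measurable_snd.
    by apply: xi_measurable; apply/andP; split; [exact: dr|exact: eqxx].
- move=> j w jB; rewrite -(scaler0 _ B1%:R^-1).
  by apply: has_meanZ; apply: noise_mean; exact: dr.
- move=> j w jB; under eq_fun do rewrite fsqZ.
  by apply: bEZ; [exact: sqr_ge0|apply: noise_fsq; exact: dr].
- move=> j _; apply: bEZ; first exact: sqr_ge0.
  apply: bED; first by apply: bE_cst; rewrite !mulr_ge0 ?sqr_ge0.
  by apply: bEZ => //; rewrite mulr_ge0 ?sqr_ge0.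
Qed.

Lemma noise_avgE t i w : (i < K)%N -> U t.+1 w i.+1 =
  (1 - e) *: U t w i.+1 + (@f i (U t.+1 w i) - (1 - e) *: @f i (U t w i))
  + batch_mean B1 (fun j => noise t.+1 j (U t.+1 w i) (U t w i) w).
Proof.
move=> iK; rewrite /noise !(batch_meanB, batch_meanZ) !batch_mean_cst ?(su_B1 H)//.
rewrite [LHS]/=; apply/rowP => k; rewrite !mxE; ring.
Qed.

Lemma level_errS t i w : (i < K)%N -> level_err t.+1 w i = (1 - e) *: level_err t w i
  + batch_mean B1 (fun j => noise t.+1 j (U t.+1 w i) (U t w i) w).
Proof.
by move=> iK; rewrite /level_err noise_avgE//; apply/rowP => k; rewrite !mxE; ring.
Qed.

Lemma u_moveE t i w : (i < K)%N -> U t.+1 w i.+1 - U t w i.+1 =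
  - e *: level_err t w i + (@f i (U t.+1 w i) - @f i (U t w i))
  + batch_mean B1 (fun j => noise t.+1 j (U t.+1 w i) (U t w i) w).
Proof.
by move=> iK; rewrite /level_err noise_avgE//; apply/rowP => k; rewrite !mxE; ring.
Qed.

End level_errors.

Section level_constants.
Context {R : realType}.
Variable L : R.

(** The base is the squared diameter, since [xt] moves by [e] times a difference of two points of
    [X]. The successor case follows the three terms of [u_moveE]: one [2 * L ^+ 2 + 8 * L ^+ 2 * _]
    comes from the level error, the other from the noise. *)
Fixpoint move_cst i : R :=
  if i is i'.+1 then
    3 * (L ^+ 2 + 2 * (2 * L ^+ 2 + 8 * L ^+ 2 * move_cst i') + L ^+ 2 * move_cst i')
  else L ^+ 2.

(** Second moment of one noise term, divided by [e ^+ 2], when the points of level [i] move by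
    [move_cst i * e ^+ 2] in second moment. *)
Definition err_cst i : R := 2 * L ^+ 2 + 8 * L ^+ 2 * move_cst i.

Lemma move_cst_ge0 i : 0 <= move_cst i.
Proof.
elim: i => [|i IH] /=; first exact: sqr_ge0.
by have := sqr_ge0 L; have := mulr_ge0 (sqr_ge0 L) IH; lra.
Qed.

Lemma err_cst_ge0 i : 0 <= err_cst i.
Proof.
have := sqr_ge0 L; have := mulr_ge0 (sqr_ge0 L) (move_cst_ge0 i).
by rewrite /err_cst; lra.
Qed.

End level_constants.

Section level_bounds.
Context {R : realType} {K : nat} {d : nat -> nat} {dK : d K = 1%N}.
Context {X : set 'rV[R]_(d 0%N)} {f : @level_maps R d}.
Context {dS dO : measure_display} {S : measurableType dS} {Om : measurableType dO}.
Context {P : probability Om R} {o : @oracle R d dS S}.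
Context {lmo : 'cV[R]_(d 0%N) -> 'rV[R]_(d 0%N)} {x1 : 'rV[R]_(d 0%N)}.
Context {T B0 B1 : nat} {xi : nat -> nat -> nat -> {RV P >-> S}} {tau : {RV P >-> nat}}.
Context {L e : R}.
Hypothesis H : pmvr_setup dK X f o lmo x1 T B0 B1 xi tau L e.

Local Notation G := (sample_systems xi tau).
Local Notation drawn := (drawn T K B0 B1).
Local Notation indices := (indices T K B0 B1).
Local Notation below := (below T K B0 B1).
Local Notation mmxJ A := (@mmx R _ (jointT G A) _ _).
Local Notation mmxJ2 A B := (@mmx R _ (jointT G A * jointT G B)%type _ _).
Local Notation run := (run dK o lmo x1 B0 B1 xi e).
Local Notation U := (run_u dK o lmo x1 B0 B1 xi e).
Local Notation level_err := (level_err dK o lmo x1 B0 B1 xi e f).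

Let L0 : 0 <= L. Proof. exact: le_trans ler01 (su_L H). Qed.
Let e0 : 0 <= e. Proof. exact: ltW (su_e0 H). Qed.
Let e1 := su_e1 H.
Let Bp : 0 < B1%:R :> R. Proof. by rewrite ltr0n (su_B1 H). Qed.

Lemma x_in t w : X (xt (run t w)).
Proof.
elim: t => [|t IH]; first exact: (su_x1 H).
by apply: (su_step H) => //; exact: (su_lmoX H).
Qed.

(** Conditioning with a single fresh sample: [(t, i, j)] is not among the draws of [below t i], on
    which the points of level [i] depend. *)
Lemma bE_cur t i j (h : Om -> Om -> R) c r : drawn (t, i, j) ->
  measurable_fun [set: jointT G (below t i) *
      jointT G (indices (fun x => x == (t, i, j)))] (fun p => h p.1 p.2) ->
  (forall w w', 0 <= h w w') -> (forall w, bE P (h w) (c w)) -> bE P c r ->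
  bE P (fun w => h w w) r.
Proof.
move=> dr mh h0 hc bc; apply: (bE_freeze (su_indep H)) mh h0 _ bc.
- exact: indices_dom.
- exact: indices_dom.
- apply: indices_disj => x /orP[xt /eqP xE|/andP[_ xi' /eqP xE]].
    by move: xt; rewrite xE/= ltnn.
  by move: xi'; rewrite xE/= ltnn.
- by move=> w; have [] := hc w.
Qed.

Lemma xi_cur_measurable t i j : drawn (t, i, j) ->
  measurable_fun [set: jointT G (below t i) *
      jointT G (indices (fun x => x == (t, i, j)))] (fun p => xi t i j p.2).
Proof.
move=> dr; apply: (measurableT_comp (f := xi t i j : jointT G _ -> S)); last exact: measurable_snd.
by apply: xi_measurable; apply/andP; split; [exact: dr|exact: eqxx].
Qed.

Lemma u_cur_measurable t i j (y : Om -> 'rV[R]_(d i)) : mmxJ (below t i) y ->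
  mmxJ2 (below t i) (indices (fun x => x == (t, i, j))) (fun p => y p.1).
Proof. by move=> my; exact: (mmx_comp measurable_fst my). Qed.

(** The average is treated by convexity, without gain from [B0]. A bound O(1) is enough because the
    factor [1 - e] of later iterations forgets it. *)
Lemma level_err0_bound i : (0 < T)%N -> (i < K)%N ->
  bE P (fun w => fsq (level_err 0 w i)) (L ^+ 2).
Proof.
move=> T0 iK; have B0_gt0 := su_B0 H.
have B0p : 0 < B0%:R :> R by rewrite ltr0n.
have mU A : below 0 i `<=` A -> mmxJ A (fun w => U 0 w i).
  by move=> sA; apply: (u_measurable H) => //; exact: ltnW.
have b j : (j < B0)%N ->
    bE P (fun w => fsq (oval o (U 0 w i) (xi 0 i j w) - @f i (U 0 w i))) (L ^+ 2).
  move=> jB; have dr : drawn (0%N, i, j) by rewrite /= T0 iK jB.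
  apply: (bE_cur (h := fun w w' => fsq (oval o (U 0 w i) (xi 0 i j w') - @f i (U 0 w i)))
    (c := fun=> L ^+ 2) dr).
  - have m1 := @u_cur_measurable 0 i j _ (mU _ (@subset_refl _ _)).
    apply: measurable_fsq; apply: mmxB.
      by apply: mmx_oval => //; exact: xi_cur_measurable.
    by apply: (@mmx_continuous _ _ _ _ _ _ _ (@f i)) => //; exact: (su_cont H iK).
  - by move=> w w'; exact: fsq_ge0.
  - by move=> w; exact: (su_var H dr).
  - by apply: bE_cst; exact: sqr_ge0.
apply: bE_le (bEZ (_ : 0 <= B0%:R^-1) (bE_sum (fun j : 'I_B0 => b j (ltn_ord j)))) _.
- apply: (jointT_measurable_fun (su_indep H) (A := below 0 i.+1)); first exact: indices_dom.
  apply: measurable_fsq; apply: mmxB; first exact: (u_measurable H).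
  apply: (@mmx_continuous _ _ _ _ _ _ _ (@f i)); first exact: (su_cont H iK).
  by apply: mU; exact: below_mono.
- by move=> w; exact: fsq_ge0.
- move=> w; rewrite /level_err.
  rewrite (_ : U 0 w i.+1 - _ = batch_mean B0
    (fun j => oval o (U 0 w i) (xi 0 i j w) - @f i (U 0 w i))); first exact: fsq_mean.
  by rewrite batch_meanB batch_mean_cst.
- by rewrite invr_ge0 ltW.
- by rewrite sumr_const card_ord -[L ^+ 2 *+ B0]mulr_natl mulrA mulVf ?mul1r// gt_eqF.
Qed.

Lemma level_err_measurable t i A : (t < T)%N -> (i < K)%N -> below t i.+1 `<=` A ->
  mmxJ A (fun w => level_err t w i).
Proof.
move=> tT iK sA; apply: mmxB; first exact: (u_measurable H).
apply: (@mmx_continuous _ _ _ _ _ _ _ (@f i)); first exact: (su_cont H iK).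
apply: (u_measurable H) => //; first exact: ltnW.
exact: subset_trans (@below_mono _ _ _ _ t _ _ (leqnSn i)) sA.
Qed.

Lemma fsq_jointT_meas A m n (V : Om -> 'M[R]_(m, n)) :
  A `<=` [set k | oapp drawn true k] -> mmxJ A V -> measurable_fun [set: Om] (fun w => fsq (V w)).
Proof.
move=> AD mV; apply: (jointT_measurable_fun (su_indep H) AD).
exact: measurable_fsq.
Qed.

(** The noise adds at most [e * (e ^+ 2 * err_cst L i)], one factor [e] coming from [1 / B1]. The
    term [e ^+ 2 * err_cst L i] reproduces itself because [(1 - e) ^+ 2 + e <= 1]. *)
Lemma level_err_step i : (i < K)%N ->
  (forall t, (t.+1 < T)%N ->
     bE P (fun w => fsq (U t.+1 w i - U t w i)) (move_cst L i * e ^+ 2)) ->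
  forall t, (t < T)%N ->
     bE P (fun w => fsq (level_err t w i))
       ((1 - e) ^+ (2 * t) * L ^+ 2 + e ^+ 2 * err_cst L i).
Proof.
move=> iK mv; elim=> [|t IH] tT.
  apply: bE_ler (level_err0_bound tT iK) _.
  by rewrite muln0 expr0 mul1r lerDl mulr_ge0 ?sqr_ge0// err_cst_ge0.
have tT' := ltnW tT.
have iK' := ltnW iK.
under eq_fun do rewrite (level_errS H)//.
have bV := bEZ (sqr_ge0 (1 - e)) (IH tT').
apply: bE_ler (bE_noise_avg H tT iK _ _ _ _ (mv t tT)) _.
- exact: (u_measurable H).
- by apply: (u_measurable H) => //; exact: subset_trans (@below_past _ _ _ _ t i) (@past_below _ _ _ _ t.+1 i).
- apply: mmxZ; apply: level_err_measurable => //.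
  exact: subset_trans (@below_past _ _ _ _ t i.+1) (@past_below _ _ _ _ t.+1 i).
- by under eq_fun do rewrite fsqZ; exact: bV.
- have -> : (1 - e) ^+ 2 * ((1 - e) ^+ (2 * t) * L ^+ 2 + e ^+ 2 * err_cst L i) =
      (1 - e) ^+ (2 * t.+1) * L ^+ 2 + (1 - e) ^+ 2 * (e ^+ 2 * err_cst L i).
    by rewrite mulnS exprD; ring.
  rewrite -addrA lerD2l.
  have h : B1%:R^-1 * (2 * (e ^+ 2 * L ^+ 2) + 8 * L ^+ 2 * (move_cst L i * e ^+ 2))
      <= e * (e ^+ 2 * err_cst L i).
    apply: ler_pM; rewrite ?invr_ge0 ?(ltW Bp)//.
    - by rewrite !addr_ge0 ?mulr_ge0 ?sqr_ge0 ?move_cst_ge0.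
    - exact: su_B1e H.
    - by rewrite /err_cst; lra.
  apply: le_trans (lerD (lexx _) h) _.
  have k0 : 0 <= e ^+ 2 * err_cst L i by rewrite mulr_ge0 ?sqr_ge0// err_cst_ge0.
  rewrite -mulrDl ler_piMl//.
  have : e * e <= e * 1 by rewrite ler_wpM2l.
  by rewrite sqrrB expr1n mul1r mulr1 -expr2; lra.
Qed.

(** Induction on the level, alternating with [level_err_step]: a bound on the moves of level [i] for
    all iterations bounds the errors of level [i], and the two together bound the moves of level
    [i.+1]. *)
Lemma u_move_bound i : (i <= K)%N -> forall t, (t.+1 < T)%N ->
  bE P (fun w => fsq (U t.+1 w i - U t w i)) (move_cst L i * e ^+ 2).
Proof.
elim: i => [|i IH] iK t tT.
  have c0 : 0 <= move_cst L 0 * e ^+ 2 by rewrite mulr_ge0 ?sqr_ge0.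
  apply: bE_le (bE_cst P c0) _ => //.
  - apply: (@fsq_jointT_meas (below t.+1 0)); first exact: indices_dom.
    apply: mmxB; apply: (u_measurable H) => //; first exact: ltnW.
    exact: subset_trans (@below_past _ _ _ _ t 0) (@past_below _ _ _ _ t.+1 0).
  - by move=> w; exact: fsq_ge0.
  - move=> w; rewrite !u0E /= -/(run t w) addrAC subrr add0r fsqZ mulrC ler_wpM2r ?sqr_ge0//.
    by apply: (su_diam H); [exact: (su_lmoX H)|exact: x_in].
have mv := IH (ltnW iK) t tT.
have be := level_err_step iK (IH (ltnW iK)) (ltnW tT).
have iK' := ltnW iK.
have tT' := ltnW tT.
have sub n : below t n `<=` below t.+1 i.
  exact: subset_trans (@below_past _ _ _ _ t n) (@past_below _ _ _ _ t.+1 i).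
have mU : mmxJ (below t.+1 i) (fun w => U t.+1 w i) by exact: (u_measurable H).
have mU' : mmxJ (below t.+1 i) (fun w => U t w i) by exact: (u_measurable H).
have mf (y : Om -> 'rV[R]_(d i)) : mmxJ (below t.+1 i) y ->
    mmxJ (below t.+1 i) (fun w => @f i (y w)).
  by apply: mmx_continuous; exact: (su_cont H iK).
have bN := bE_noise_avg H tT iK mU mU' (@mmx_cst R _ (jointT G (below t.+1 i)) _ _ 0)
  (bE_cst P (fsq_ge0 (0 : 'rV[R]_(d i.+1)))) mv.
have bL := bEZ (sqr_ge0 L) mv.
have b1 := bEZ (sqr_ge0 e) be.
apply: bE_le (bED (bED (bEZ (ler0n _ 3) b1) (bEZ (ler0n _ 3) bL)) (bEZ (ler0n _ 3) bN)) _.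
- apply: (@fsq_jointT_meas (below t.+1 i.+1)); first exact: indices_dom.
  apply: mmxB; apply: (u_measurable H) => //.
  exact: subset_trans (@below_past _ _ _ _ t i.+1) (@past_below _ _ _ _ t.+1 i.+1).
- by move=> w; exact: fsq_ge0.
- move=> w; rewrite (u_moveE H)// add0r.
  apply: le_trans (fsqD_le3 _ _ _) _; rewrite fsqZ sqrrN lerD2r lerD2l ler_wpM2l//.
  exact: (su_lip H).
- rewrite fsq0 add0r /=; set mc := move_cst L i.
  have mc0 : 0 <= mc := move_cst_ge0 L i.
  have kc0 : 0 <= err_cst L i := err_cst_ge0 L i.
  have p1 : (1 - e) ^+ (2 * t) <= 1 by rewrite exprn_ile1// ?subr_ge0// lerBlDr lerDl.
  have q1 : e ^+ 2 * ((1 - e) ^+ (2 * t) * L ^+ 2 + e ^+ 2 * err_cst L i)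
      <= e ^+ 2 * (L ^+ 2 + err_cst L i).
    rewrite ler_wpM2l ?sqr_ge0// lerD// ?ler_piMl ?sqr_ge0//.
    by rewrite exprn_ile1.
  have q2 : B1%:R^-1 * (2 * (e ^+ 2 * L ^+ 2) + 8 * L ^+ 2 * (mc * e ^+ 2))
      <= 1 * (e ^+ 2 * err_cst L i).
    apply: ler_pM; rewrite ?invr_ge0 ?(ltW Bp)//.
    - by rewrite !addr_ge0 ?mulr_ge0 ?sqr_ge0.
    - exact: le_trans (su_B1e H) e1.
    - by rewrite /err_cst -/mc; lra.
  by move: q1 q2; rewrite /err_cst -/mc; lra.
Qed.

Lemma level_err_bound t i : (t < T)%N -> (i < K)%N ->
  bE P (fun w => fsq (level_err t w i))
    ((1 - e) ^+ (2 * t) * L ^+ 2 + e ^+ 2 * err_cst L i).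
Proof. by move=> tT iK; apply: level_err_step => // s sT; apply: u_move_bound => //; exact: ltnW. Qed.

End level_bounds.

(** * Distance between true and masked points *)

Section masked_constants.
Context {R : realType}.
Variable L : R.

(** The Lipschitz propagation from the level below, plus the averaged noise of this level. Both add
    up without a factor 2 because they are orthogonal. *)
Fixpoint all_mask_cst i : R :=
  if i is i'.+1 then L ^+ 2 * all_mask_cst i' + err_cst L i' else 0.

(** Here the propagated difference and the single noise term are separated by [fsqD_le2], hence the
    factors 2. *)
Fixpoint one_mask_cst i : R :=
  if i is i'.+1 then 2 * (L ^+ 2 * one_mask_cst i') + 2 * err_cst L i' else 0.

Lemma all_mask_cst_ge0 i : 0 <= all_mask_cst i.
Proof.
elim: i => //= i IH; have := mulr_ge0 (sqr_ge0 L) IH.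
by have := err_cst_ge0 L i; lra.
Qed.

Lemma one_mask_cst_ge0 i : 0 <= one_mask_cst i.
Proof.
elim: i => //= i IH; have := mulr_ge0 (sqr_ge0 L) IH.
by have := err_cst_ge0 L i; lra.
Qed.

End masked_constants.

Section masked_bounds.
Context {R : realType} {K : nat} {d : nat -> nat} {dK : d K = 1%N}.
Context {X : set 'rV[R]_(d 0%N)} {f : @level_maps R d}.
Context {dS dO : measure_display} {S : measurableType dS} {Om : measurableType dO}.
Context {P : probability Om R} {o : @oracle R d dS S}.
Context {lmo : 'cV[R]_(d 0%N) -> 'rV[R]_(d 0%N)} {x1 : 'rV[R]_(d 0%N)}.
Context {T B0 B1 : nat} {xi : nat -> nat -> nat -> {RV P >-> S}} {tau : {RV P >-> nat}}.
Context {L e : R}.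
Hypothesis H : pmvr_setup dK X f o lmo x1 T B0 B1 xi tau L e.

Local Notation G := (sample_systems xi tau).
Local Notation drawn := (drawn T K B0 B1).
Local Notation past := (past T K B0 B1).
Local Notation below := (below T K B0 B1).
Local Notation mmxJ A := (@mmx R _ (jointT G A) _ _).
Local Notation run := (run dK o lmo x1 B0 B1 xi e).
Local Notation U := (run_u dK o lmo x1 B0 B1 xi e).
Local Notation noise := (noise o xi e f).
Local Notation Um := (masked_u dK o lmo x1 B0 B1 xi e f).
Local Notation others := (others T K B0 B1).

Let e0 : 0 <= e. Proof. exact: ltW (su_e0 H). Qed.
Let e1 := su_e1 H.
Let Bp : 0 < B1%:R :> R. Proof. by rewrite ltr0n (su_B1 H). Qed.

Let noise_cst i : 2 * (e ^+ 2 * L ^+ 2) + 8 * L ^+ 2 * (move_cst L i * e ^+ 2)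
  = e ^+ 2 * err_cst L i.
Proof. by rewrite /err_cst; ring. Qed.

Lemma xt_next_measurable t A : (t.+1 < T)%N -> past t.+1 `<=` A ->
  mmxJ A (fun w => xt (run t.+1 w)).
Proof. by move=> tT sA; exact: (x_measurable H). Qed.

Lemma mask_measurable b t n A : (t.+1 < T)%N -> (n <= K)%N -> past t.+1 `<=` A ->
  (forall i j, (i < n)%N -> (j < B1)%N -> ~~ b j -> A (Some (t.+1, i, j))) ->
  mmxJ A (fun w => Um b t w n).
Proof.
move=> tT nK sA As; apply: (u_mask_measurable H) => //.
  move=> i iN; apply: (u_measurable H) => //; first exact: ltnW.
    exact: leq_trans iN nK.
  exact: subset_trans (@below_past _ _ _ _ t i) sA.
exact: xt_next_measurable.
Qed.

Lemma mask_below_measurable b t n : (t.+1 < T)%N -> (n <= K)%N ->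
  mmxJ (below t.+1 n) (fun w => Um b t w n).
Proof.
move=> tT nK; apply: mask_measurable => //; first exact: past_below.
by move=> i j iN jB _; rewrite /= tT (leq_trans iN nK) jB eqxx iN orbT.
Qed.

Lemma mask_all_measurable t n : (t.+1 < T)%N -> (n <= K)%N ->
  mmxJ (past t.+1) (fun w => Um (fun=> true) t w n).
Proof. by move=> tT nK; apply: mask_measurable. Qed.

Lemma mask_one_measurable t n j : (t.+1 < T)%N -> (n <= K)%N ->
  mmxJ (others t.+1 j) (fun w => Um (pred1 j) t w n).
Proof.
move=> tT nK; apply: mask_measurable => //; first by apply: indices_sub => x _ ->.
by move=> i l iN lB /= lj; rewrite /= tT (leq_trans iN nK) lB eqxx lj orbT.
Qed.

Lemma mask_allE t w i : Um (fun=> true) t w i.+1 =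
  (1 - e) *: U t w i.+1 + @f i (Um (fun=> true) t w i) - (1 - e) *: @f i (U t w i).
Proof.
have E s (y : 'rV[R]_(d i)) : batch_mean B1 (masked_val f o (fun=> true) s y) = @f i y.
  exact: (batch_mean_cst _ (su_B1 H)).
by rewrite {1}/masked_u /= !E.
Qed.

(** At each level the two points differ by a Lipschitz image of the difference below and by the mean
    of the noise, of second moment [e ^+ 2 / B1] up to a constant, that is [e ^+ 3]. *)
Lemma all_mask_bound t i : (t.+1 < T)%N -> (i <= K)%N ->
  bE P (fun w => fsq (U t.+1 w i - Um (fun=> true) t w i)) (all_mask_cst L i * e ^+ 3).
Proof.
move=> tT; elim: i => [|i IH] iK.
  rewrite mul0r; under eq_fun do rewrite u0E /= subrr fsq0; exact: bE_cst.
have bi := IH (ltnW iK).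
have mV : mmxJ (below t.+1 i) (fun w => @f i (U t.+1 w i) - @f i (Um (fun=> true) t w i)).
  apply: mmxB.
    apply: (@mmx_continuous _ _ _ _ _ _ _ (@f i)); first exact: (su_cont H iK).
    by apply: (u_measurable H) => //; exact: ltnW.
  apply: (@mmx_continuous _ _ _ _ _ _ _ (@f i)); first exact: (su_cont H iK).
  by apply: mask_below_measurable => //; exact: ltnW.
have bV : bE P (fun w => fsq (@f i (U t.+1 w i) - @f i (Um (fun=> true) t w i)))
    (L ^+ 2 * (all_mask_cst L i * e ^+ 3)).
  apply: bE_le (bEZ (sqr_ge0 L) bi) _ => //.
  - by apply: (fsq_jointT_meas H) mV; exact: indices_dom.
  - by move=> w; exact: fsq_ge0.
  - by move=> w; exact: (su_lip H).
have -> : (fun w => fsq (U t.+1 w i.+1 - Um (fun=> true) t w i.+1)) = (fun w => fsq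
   (@f i (U t.+1 w i) - @f i (Um (fun=> true) t w i)
     + batch_mean B1 (fun j => noise t.+1 j (U t.+1 w i) (U t w i) w))).
  apply/funext => w; rewrite mask_allE (noise_avgE H)//; congr fsq.
  by apply/rowP => k; rewrite !mxE; ring.
apply: bE_ler (bE_noise_avg H tT iK _ _ mV bV (u_move_bound H (ltnW iK) tT)) _.
- by apply: (u_measurable H) => //; exact: ltnW.
- apply: (u_measurable H) => //; [exact: ltnW|exact: ltnW|].
  exact: subset_trans (@below_past _ _ _ _ t i) (@past_below _ _ _ _ t.+1 i).
- rewrite noise_cst /=.
  have k0 : 0 <= e ^+ 2 * err_cst L i by rewrite mulr_ge0 ?sqr_ge0// err_cst_ge0.
  by have := ler_wpM2r k0 (su_B1e H); lra.
Qed.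

(** Samples other than [j] are used on both sides and leave increments between the two points.
    Sample [j] leaves an increment of [f] and its own noise, with weight [1 / B1]. *)
Lemma one_maskE t w i j : (j < B1)%N -> U t.+1 w i.+1 - Um (pred1 j) t w i.+1 =
  batch_mean B1 (fun l => if l == j then @f i (U t.+1 w i) - @f i (Um (pred1 j) t w i)
    else oval o (U t.+1 w i) (xi t.+1 i l w) - oval o (Um (pred1 j) t w i) (xi t.+1 i l w))
  + B1%:R^-1 *: noise t.+1 j (U t.+1 w i) (U t w i) w.
Proof.
move=> jB; set y := Um _ _ _ i.
pose g l := if l == j then noise t.+1 j (U t.+1 w i) (U t w i) w else 0.
have -> : B1%:R^-1 *: noise t.+1 j (U t.+1 w i) (U t w i) w = batch_mean B1 g.
  rewrite /batch_mean (bigD1 (Ordinal jB))//= /g eqxx big1 ?addr0// => l.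
  by rewrite -val_eqE/= => /negbTE ->.
have alg (c a b a' b' : 'rV[R]_(d i.+1)) :
    c + a - b - (c + a' - b') = a - a' - (b - b').
  by apply/rowP => k; rewrite !mxE; ring.
rewrite -batch_meanD.
rewrite -[U t.+1 w i.+1]/((1 - e) *: U t w i.+1
  + batch_mean B1 (fun l => oval o (U t.+1 w i) (xi t.+1 i l w))
  - (1 - e) *: batch_mean B1 (fun l => oval o (U t w i) (xi t.+1 i l w))).
rewrite -[Um _ _ _ i.+1]/((1 - e) *: U t w i.+1
  + batch_mean B1 (masked_val f o (pred1 j) (fun i j => xi t.+1 i j w) y)
  - (1 - e) *: batch_mean B1 (masked_val f o (pred1 j) (fun i j => xi t.+1 i j w) (U t w i))).
rewrite alg -(scalerBr (1 - e)) -!batch_meanB -batch_meanZ -batch_meanB.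
rewrite /batch_mean; congr (_ *: _); apply: eq_bigr => l _.
rewrite /masked_val /g /=; case: eqP => [->|_].
  by rewrite /noise; apply/rowP => k; rewrite !mxE; ring.
by rewrite subrr scaler0 subr0 addr0.
Qed.

(** No cancellation is sought among the increments, which are bounded by convexity. The rate comes
    from the single noise term, whose squared weight [B1 ^- 2 <= e ^+ 2] multiplies a second moment
    O(e^2). *)
Lemma one_mask_bound t i j : (t.+1 < T)%N -> (i <= K)%N -> (j < B1)%N ->
  bE P (fun w => fsq (U t.+1 w i - Um (pred1 j) t w i)) (one_mask_cst L i * e ^+ 4).
Proof.
move=> tT + jB; elim: i => [|i IH] iK.
  rewrite mul0r; under eq_fun do rewrite u0E /= subrr fsq0; exact: bE_cst.
have bi := IH (ltnW iK).
set y := fun w => Um (pred1 j) t w i in bi *.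
have iK' := ltnW iK.
have tT' := ltnW tT.
have mU : mmxJ (below t.+1 i) (fun w => U t.+1 w i) by apply: (u_measurable H).
have mU' : mmxJ (below t.+1 i) (fun w => U t w i).
  apply: (u_measurable H) => //.
  exact: subset_trans (@below_past _ _ _ _ t i) (@past_below _ _ _ _ t.+1 i).
have my : mmxJ (below t.+1 i) y by apply: mask_below_measurable.
have dr l : (l < B1)%N -> drawn (t.+1, i, l) by move=> lB; rewrite /= tT iK lB.
have bL := bEZ (sqr_ge0 L) bi.
pose D (l : nat) w : 'rV[R]_(d i.+1) := if l == j then @f i (U t.+1 w i) - @f i (y w)
  else oval o (U t.+1 w i) (xi t.+1 i l w) - oval o (y w) (xi t.+1 i l w).
have bD l : (l < B1)%N -> bE P (fun w => fsq (D l w)) (L ^+ 2 * (one_mask_cst L i * e ^+ 4)).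
  move=> lB; rewrite /D; case: eqP => _.
    apply: bE_le bL _ => //.
    + apply: (fsq_jointT_meas H (A := below t.+1 i)).
        exact: indices_dom.
      apply: mmxB; apply: (@mmx_continuous _ _ _ _ _ _ _ (@f i)) => //; exact: (su_cont H iK).
    + by move=> w; exact: fsq_ge0.
    + by move=> w; exact: (su_lip H).
  apply: (bE_cur H (h := fun w w' => fsq (oval o (U t.+1 w i) (xi t.+1 i l w')
      - oval o (y w) (xi t.+1 i l w')))
    (c := fun w => L ^+ 2 * fsq (U t.+1 w i - y w)) (dr l lB)) => //.
  + apply: measurable_fsq; apply: mmxB; apply: mmx_oval;
      first [exact: (u_cur_measurable (j := l) mU)|exact: (u_cur_measurable (j := l) mU')|exact: (u_cur_measurable (j := l) my)|exact: (xi_cur_measurable (dr l lB))].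
  + by move=> w w'; exact: fsq_ge0.
  + by move=> w; exact: (su_oval_lip H (dr l lB)).
have bN : bE P (fun w => fsq (noise t.+1 j (U t.+1 w i) (U t w i) w)) (e ^+ 2 * err_cst L i).
  rewrite -noise_cst.
  apply: (bE_cur H (h := fun w w' => fsq (noise t.+1 j (U t.+1 w i) (U t w i) w'))
    (c := fun w => 2 * (e ^+ 2 * L ^+ 2) + 8 * L ^+ 2 * fsq (U t.+1 w i - U t w i))
    (dr j jB)).
  + apply: measurable_fsq; apply: (noise_measurable H) => //;
      first [exact: (u_cur_measurable (j := j) mU)|exact: (u_cur_measurable (j := j) mU')|exact: (u_cur_measurable (j := j) my)|exact: (xi_cur_measurable (dr j jB))].
  + by move=> w w'; exact: fsq_ge0.
  + by move=> w; apply: (noise_fsq H); exact: dr.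
  + apply: bED; first by apply: bE_cst; rewrite mulr_ge0// mulr_ge0 ?sqr_ge0.
    by apply: bEZ; [rewrite mulr_ge0 ?sqr_ge0|exact: (u_move_bound H)].
have bm := bEZ (_ : 0 <= 2 * B1%:R^-1) (bE_sum (fun l : 'I_B1 => bD l (ltn_ord l))).
have b2 := bEZ (_ : 0 <= 2 * B1%:R^-1 ^+ 2) bN.
have i0 : 0 <= B1%:R^-1 :> R by rewrite invr_ge0 ltW.
apply: bE_le (bED (bm (mulr_ge0 (ler0n _ 2) i0))
  (b2 (mulr_ge0 (ler0n _ 2) (sqr_ge0 _)))) _.
- apply: (fsq_jointT_meas H (A := below t.+1 i.+1)).
    exact: indices_dom.
  by apply: mmxB; [exact: (u_measurable H)|exact: mask_below_measurable].
- by move=> w; exact: fsq_ge0.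
- move=> w; rewrite one_maskE//; apply: le_trans (fsqD_le2 _ _) _.
  rewrite -/(batch_mean B1 (D^~ w)) (fsqZ _ (noise _ _ _ _ _)).
  have := fsq_mean (D^~ w) (su_B1 H); lra.
- set q := L ^+ 2 * (one_mask_cst L i * e ^+ 4).
  rewrite sumr_const card_ord -[q *+ B1]mulr_natl.
  have -> : 2 / B1%:R * (B1%:R * q) = 2 * q.
    by field; rewrite gt_eqF.
  rewrite /q /=.
  have h : B1%:R^-1 ^+ 2 <= e ^+ 2 by rewrite ler_pXn2r ?nnegrE// (su_B1e H).
  have k0 : 0 <= 2 * (e ^+ 2 * err_cst L i) by rewrite !mulr_ge0 ?sqr_ge0 ?err_cst_ge0.
  have := ler_wpM2r k0 h.
  by rewrite (_ : e ^+ 4 = e ^+ 2 * e ^+ 2) -?exprD//; lra.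
Qed.

Lemma all_mask_move_bound t i : (t.+1 < T)%N -> (i <= K)%N ->
  bE P (fun w => fsq (Um (fun=> true) t w i - U t w i))
    (2 * (all_mask_cst L i + move_cst L i) * e ^+ 2).
Proof.
move=> tT iK.
apply: bE_le (bED (bEZ (ler0n _ 2) (all_mask_bound tT iK))
  (bEZ (ler0n _ 2) (u_move_bound H iK tT))) _.
- apply: (fsq_jointT_meas H (A := past t.+1)).
    exact: indices_dom.
  apply: mmxB; first exact: mask_all_measurable.
  by apply: (u_measurable H) => //; [exact: ltnW|exact: below_past].
- by move=> w; exact: fsq_ge0.
- move=> w; rewrite (fsqBC (U _ _ _)); set y := Um _ _ _ _.
  have -> : y - U t w i = (y - U t.+1 w i) + (U t.+1 w i - U t w i) by rewrite addrA subrK.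
  exact: fsqD_le2.
- have : e * e ^+ 2 <= 1 * e ^+ 2 by rewrite ler_wpM2r ?sqr_ge0.
  have := all_mask_cst_ge0 L i; rewrite exprS mul1r => a0 h.
  by have := ler_wpM2l a0 h; lra.
Qed.

Lemma one_all_mask_bound t i j : (t.+1 < T)%N -> (i <= K)%N -> (j < B1)%N ->
  bE P (fun w => fsq (Um (pred1 j) t w i - Um (fun=> true) t w i))
    (2 * (one_mask_cst L i + all_mask_cst L i) * e ^+ 3).
Proof.
move=> tT iK jB.
apply: bE_le (bED (bEZ (ler0n _ 2) (one_mask_bound tT iK jB))
  (bEZ (ler0n _ 2) (all_mask_bound tT iK))) _.
- apply: (fsq_jointT_meas H (A := below t.+1 i)).
    exact: indices_dom.
  by apply: mmxB; exact: mask_below_measurable.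
- by move=> w; exact: fsq_ge0.
- move=> w; rewrite (fsqBC (U _ _ _)); set y := Um _ _ _ _; set z := Um _ _ _ _.
  have -> : y - z = (y - U t.+1 w i) + (U t.+1 w i - z) by rewrite addrA subrK.
  exact: fsqD_le2.
- have : e * e ^+ 3 <= 1 * e ^+ 3 by rewrite ler_wpM2r// exprn_ge0.
  have := one_mask_cst_ge0 L i; rewrite exprS mul1r => a0 h.
  by have := ler_wpM2l a0 h; lra.
Qed.

End masked_bounds.

(** * Products of sampled Jacobians *)

Section chain_products.
Context {R : realType}.

Lemma opnormD_sqr m n (A B : 'M[R]_(m, n)) :
  opnorm (A + B) ^+ 2 <= 2 * opnorm A ^+ 2 + 2 * opnorm B ^+ 2.
Proof.
have h : opnorm (A + B) ^+ 2 <= (opnorm A + opnorm B) ^+ 2.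
  by rewrite ler_pXn2r ?nnegrE ?addr_ge0 ?opnorm_ge0// opnormD.
by have := sqr_ge0 (opnorm A - opnorm B); lra.
Qed.

Lemma opnormM_sqr m n p (A : 'M[R]_(m, n)) (B : 'M[R]_(n, p)) :
  opnorm (A *m B) ^+ 2 <= opnorm A ^+ 2 * opnorm B ^+ 2.
Proof.
by rewrite -exprMn ler_pXn2r ?nnegrE ?mulr_ge0 ?opnorm_ge0// opnormM.
Qed.

Lemma opnormZ_sqr m n c (A : 'M[R]_(m, n)) :
  opnorm (c *: A) ^+ 2 <= c ^+ 2 * opnorm A ^+ 2.
Proof.
rewrite -[c ^+ 2](real_normK (num_real c)) -exprMn.
by rewrite ler_pXn2r ?nnegrE ?mulr_ge0 ?opnorm_ge0// opnormZ_le.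
Qed.

(** Telescoping in the last factor. The weight [b] is kept because the update subtracts [1 - e]
    times the product at the old points. *)
Lemma chain_step (m n p : nat) (X X' : 'M[R]_(m, n)) (A A' : 'M[R]_(n, p)) b :
  0 <= b <= 1 -> opnorm (X *m A - b *: (X' *m A')) ^+ 2 <=
    2 * (opnorm (X - b *: X') ^+ 2 * opnorm A ^+ 2)
    + 2 * (opnorm X' ^+ 2 * opnorm (A - A') ^+ 2).
Proof.
move=> /andP[b0 b1].
have -> : X *m A - b *: (X' *m A') = (X - b *: X') *m A + b *: (X' *m (A - A')).
  by rewrite mulmxBl mulmxBr scalerBr -!scalemxAl addrA subrK.
apply: le_trans (opnormD_sqr _ _) _; rewrite lerD ?ler_wpM2l ?opnormM_sqr//.
apply: le_trans (opnormZ_sqr _ _) _.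
rewrite -[leRHS]mul1r ler_pM ?sqr_ge0 ?opnormM_sqr// exprn_ile1//.
Qed.

Context {d : nat -> nat}.
Implicit Types A : forall i, 'M[R]_(d i, d i.+1).

Lemma chain_prod_bound A n L : 0 <= L -> (forall i, (i < n)%N -> opnorm (A i) <= L) ->
  opnorm (chain_prod A n) <= L ^+ n.
Proof.
move=> L0; elim: n => [|n IH] hA /=; first by rewrite expr0 opnorm1_le.
apply: le_trans (opnormM _ _) _; rewrite exprSr ler_pM ?opnorm_ge0//; last exact: hA.
by apply: IH => i /ltnW; exact: hA.
Qed.

Lemma chain_prod_lip A A' n L b (D : nat -> R) : 1 <= L -> 0 <= b <= 1 ->
  (forall i, (i < n)%N -> opnorm (A i) <= L) ->
  (forall i, (i < n)%N -> opnorm (A' i) <= L) ->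
  (forall i, (i < n)%N -> opnorm (A i - A' i) ^+ 2 <= L ^+ 2 * D i) ->
  (forall i, (i < n)%N -> 0 <= D i) ->
  opnorm (chain_prod A n - b *: chain_prod A' n) ^+ 2 <=
    (8 * L ^+ 2) ^+ n * ((1 - b) ^+ 2 + \sum_(i < n) D i).
Proof.
move=> L1 b01; have L0 := le_trans ler01 L1.
elim: n => [|n IH] hA hA' hD D0 /=.
  rewrite big_ord0 addr0 expr0 mul1r -{1}[1%:M]scale1r -scalerBl.
  apply: le_trans (opnormZ_sqr _ _) _; rewrite ler_piMr ?sqr_ge0//.
  by rewrite exprn_ile1 ?opnorm_ge0// opnorm1_le.
rewrite big_ord_recr/= addrA.
have {IH} := IH (fun i h => hA i (ltnW h)) (fun i h => hA' i (ltnW h))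
  (fun i h => hD i (ltnW h)) (fun i h => D0 i (ltnW h)).
set s := (1 - b) ^+ 2 + _ => IH.
apply: le_trans (chain_step _ _ _ _ b01) _.
have s0 : 0 <= s.
  by rewrite addr_ge0 ?sqr_ge0// sumr_ge0// => i _; exact: (D0 i (ltnW (ltn_ord i))).
have h1 : opnorm (chain_prod A n - b *: chain_prod A' n) ^+ 2 * opnorm (A n) ^+ 2
    <= (8 * L ^+ 2) ^+ n * s * L ^+ 2.
  by rewrite ler_pM ?sqr_ge0// ler_pXn2r ?nnegrE ?opnorm_ge0// hA.
have h2 : opnorm (chain_prod A' n) ^+ 2 * opnorm (A n - A' n) ^+ 2
    <= (8 * L ^+ 2) ^+ n * (L ^+ 2 * D n).
  apply: ler_pM; rewrite ?sqr_ge0//; last exact: hD.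
  apply: (@le_trans _ _ ((L ^+ n) ^+ 2)).
    rewrite ler_pXn2r ?nnegrE ?opnorm_ge0 ?exprn_ge0//.
    by apply: chain_prod_bound => // i h; apply: hA'; exact: ltnW.
  rewrite -exprM mulnC exprM lerXn2r ?nnegrE ?mulr_ge0 ?sqr_ge0//.
  by rewrite ler_peMl ?sqr_ge0// ler1n.
have p0 : 0 <= (8 * L ^+ 2) ^+ n * s * L ^+ 2 by rewrite !mulr_ge0 ?exprn_ge0 ?mulr_ge0 ?sqr_ge0.
have q0 : 0 <= (8 * L ^+ 2) ^+ n * (L ^+ 2 * D n).
  by rewrite !mulr_ge0 ?exprn_ge0 ?mulr_ge0 ?sqr_ge0 ?D0.
rewrite [(8 * L ^+ 2) ^+ n.+1]exprSr; lra.
Qed.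

Lemma castmx_lin m n n' (E : n = n') (A B : 'M[R]_(m, n)) c :
  castmx (erefl, E) A - c *: castmx (erefl, E) B = castmx (erefl, E) (A - c *: B).
Proof. by case: n' / E; rewrite !castmx_id. Qed.

(** With a single column the dimension factor of [fsq_opnorm] is 1; this keeps the constants
    independent of the dimensions. *)
Lemma fsq_cast_le m n n' (E : n = n') (A : 'M[R]_(m, n)) : n' = 1%N ->
  fsq (castmx (erefl, E) A) <= opnorm A ^+ 2.
Proof. by move=> n1; rewrite fsq_castmx (le_trans (fsq_opnorm _))// (_ : n%:R = 1 :> R) ?mul1r// E n1. Qed.

End chain_products.

Definition jac_exact (R : realType) (d : nat -> nat) (f : @level_maps R d) K (dK : d K = 1%N)
    (y : forall i, 'rV[R]_(d i)) : 'cV[R]_(d 0) :=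
  castmx (erefl, dK) (chain_prod (fun i => 'J (@f i) (y i)) K).

Section jacobian_products.
Context {R : realType} {K : nat} {d : nat -> nat} {dK : d K = 1%N}.
Context {X : set 'rV[R]_(d 0%N)} {f : @level_maps R d}.
Context {dS dO : measure_display} {S : measurableType dS} {Om : measurableType dO}.
Context {P : probability Om R} {o : @oracle R d dS S}.
Context {lmo : 'cV[R]_(d 0%N) -> 'rV[R]_(d 0%N)} {x1 : 'rV[R]_(d 0%N)}.
Context {T B0 B1 : nat} {xi : nat -> nat -> nat -> {RV P >-> S}} {tau : {RV P >-> nat}}.
Context {L e : R}.
Hypothesis H : pmvr_setup dK X f o lmo x1 T B0 B1 xi tau L e.

Local Notation G := (sample_systems xi tau).
Local Notation drawn := (drawn T K B0 B1).
Local Notation indices := (indices T K B0 B1).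
Local Notation below := (below T K B0 B1).
Local Notation mmxJ A := (@mmx R _ (jointT G A) _ _).
Local Notation mmxJ2 A B := (@mmx R _ (jointT G A * jointT G B)%type _ _).

Let L0 : 0 <= L. Proof. exact: le_trans ler01 (su_L H). Qed.
Let L2 : 0 <= 4 * L ^+ 2. Proof. by rewrite mulr_ge0 ?sqr_ge0. Qed.

Local Notation chain y t j w n := (chain_prod (fun i => ojac o (y i) (xi t i j w)) n).

Lemma ojac_moment t i j (x : 'rV[R]_(d i)) : drawn (t, i, j) ->
  bE P (fun w => opnorm (ojac o x (xi t i j w)) ^+ 2) (4 * L ^+ 2).
Proof.
move=> dr; have iK : (i < K)%N by case/and3P: dr.
apply: bE_le (bED (bEZ (ler0n _ 2) (su_jvar H dr x))
  (bE_cst P (mulr_ge0 (ler0n _ 2) (sqr_ge0 L)))) _.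
- apply: measurable_funX; apply: measurable_opnorm; apply: mmx_ojac; first exact: mmx_cst.
  exact: measurable_funPT.
- by move=> w; exact: sqr_ge0.
- move=> w; rewrite -{1}(subrK ('J (@f i) x) (ojac o x _)).
  apply: le_trans (opnormD_sqr _ _) _; rewrite lerD2l ler_wpM2l//.
  by rewrite ler_pXn2r ?nnegrE ?opnorm_ge0// (su_jbound H).
- lra.
Qed.

Lemma chain_measurable t j n (y : Om -> forall i, 'rV[R]_(d i)) A :
  (n <= K)%N -> (forall i, (i < K)%N -> drawn (t, i, j)) ->
  (forall i, (i < n)%N -> mmxJ A (fun w => y w i)) ->
  (forall i, (i < n)%N -> A (Some (t, i, j))) ->
  mmxJ A (fun w => chain (y w) t j w n).
Proof.
move=> nK dr my As; apply: mmx_chain_prod => i iN.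
by apply: mmx_ojac; [exact: my|apply: xi_measurable; exact: As].
Qed.

Lemma below_in t i j n : drawn (t, i, j) -> (i < n)%N -> below t n (Some (t, i, j)).
Proof. by move=> dr iN; apply/andP; split => //=; rewrite eqxx iN orbT. Qed.

Section below_points.
Variables (t j : nat) (y : Om -> forall i, 'rV[R]_(d i)).
Hypothesis dr : forall i, (i < K)%N -> drawn (t, i, j).
Hypothesis my : forall i, (i < K)%N -> mmxJ (below t i) (fun w => y w i).

Lemma below_pt i n : (i < K)%N -> (i <= n)%N -> mmxJ (below t n) (fun w => y w i).
Proof.
by move=> iK iN; exact: (mmx_comp (joint_id_sub (G := G) (below_mono (t := t) iN)) (my iK)).
Qed.

Lemma chain_below_measurable n : (n <= K)%N -> mmxJ (below t n) (fun w => chain (y w) t j w n).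
Proof.
move=> nK; apply: chain_measurable => // i iN.
  by apply: below_pt; [exact: leq_trans iN nK|exact: ltnW].
by apply: below_in => //; apply: dr; exact: leq_trans iN nK.
Qed.

Lemma ojac_cur_measurable i : (i < K)%N ->
  mmxJ2 (below t i) (indices (fun x => x == (t, i, j))) (fun p => ojac o (y p.1 i) (xi t i j p.2)).
Proof.
move=> iK; apply: mmx_ojac; last exact: (xi_cur_measurable (dr iK)).
exact: (u_cur_measurable (j := j) (my iK)).
Qed.

Lemma chain_cur_measurable n : (n <= K)%N ->
  mmxJ2 (below t n) (indices (fun x => x == (t, n, j))) (fun p => chain (y p.1) t j p.1 n).
Proof. by move=> nK; exact: (mmx_comp measurable_fst (chain_below_measurable nK)). Qed.

Lemma below_measurable_fun n (h : Om -> R) :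
  measurable_fun [set: jointT G (below t n)] h -> measurable_fun [set: Om] h.
Proof. by apply: (jointT_measurable_fun (su_indep H)); exact: indices_dom. Qed.

(** The last factor uses a sample of level [n], fresh for [below t n], where its point and the
    preceding product live. The points may thus depend on the j-th samples of lower levels, as those
    of the algorithm do. *)
Lemma chain_moment n : (n <= K)%N ->
  bE P (fun w => opnorm (chain (y w) t j w n) ^+ 2) ((4 * L ^+ 2) ^+ n).
Proof.
elim: n => [|n IH] nK /=.
  rewrite expr0; apply: bE_le (bE_cst P ler01) _ => //.
    by move=> w; exact: sqr_ge0.
  by move=> w; rewrite exprn_ile1 ?opnorm_ge0// opnorm1_le.
have bn := IH (ltnW nK).
have dn := dr nK.
have b : bE P (fun w => opnorm (chain (y w) t j w n) ^+ 2
    * opnorm (ojac o (y w n) (xi t n j w)) ^+ 2) ((4 * L ^+ 2) ^+ n.+1).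
  rewrite [(4 * L ^+ 2) ^+ n.+1]exprS.
  apply: (bE_cur H (h := fun w w' => opnorm (chain (y w) t j w n) ^+ 2
     * opnorm (ojac o (y w n) (xi t n j w')) ^+ 2)
     (c := fun w => 4 * L ^+ 2 * opnorm (chain (y w) t j w n) ^+ 2) dn).
  - apply: measurable_funM; apply: measurable_funX; apply: measurable_opnorm.
      exact: chain_cur_measurable (ltnW nK).
    exact: ojac_cur_measurable.
  - by move=> w w'; rewrite mulr_ge0 ?sqr_ge0.
  - move=> w; rewrite mulrC; apply: bEZ; first exact: sqr_ge0.
    exact: ojac_moment.
  - exact: bEZ.
apply: bE_le b _ => //.
- apply: (@below_measurable_fun n.+1); apply: measurable_funX; apply: measurable_opnorm.
  exact: (chain_below_measurable nK).
- by move=> w; exact: sqr_ge0.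
- by move=> w; exact: opnormM_sqr.
Qed.

End below_points.

(* At deterministic points the factors are independent. *)
Section fixed_points.
Variables (t j : nat).
Hypothesis dr : forall i, (i < K)%N -> drawn (t, i, j).
Implicit Types y : forall i, 'rV[R]_(d i).

Let cst_below y i : (i < K)%N -> mmxJ (below t i) (fun=> y i).
Proof. by move=> _; exact: mmx_cst. Qed.

Lemma chain_fixed_mean y n : (n <= K)%N ->
  has_mean P (fun w => chain y t j w n) (chain_prod (fun i => 'J (@f i) (y i)) n).
Proof.
elim: n => [|n IH] nK /=; first exact: has_mean_cst.
have dn := dr nK.
(* Only finiteness of second moments is wanted here, so a dimension factor does no harm. *)
have fsqb m' n' (M : Om -> 'M[R]_(m', n')) r : mmx M ->
    bE P (fun w => opnorm (M w) ^+ 2) r -> bE P (fun w => fsq (M w)) (n'%:R * r).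
  move=> mM b; apply: bE_le (bEZ (ler0n _ n') b) _ => //; first exact: measurable_fsq.
    by move=> w; exact: fsq_ge0.
  by move=> w; exact: fsq_opnorm.
have mX := chain_below_measurable (y := fun=> y) dr (cst_below y) (ltnW nK).
have mY : mmxJ (indices (fun x => x == (t, n, j))) (fun w => ojac o (y n) (xi t n j w)).
  apply: mmx_ojac; first exact: mmx_cst.
  by apply: xi_measurable; apply/andP; split => //; exact: eqxx.
apply: (has_mean_indepM (su_indep H) (A := below t n) (B := indices (fun x => x == (t, n, j)))
  _ _ _ mX mY (IH (ltnW nK)) (su_jmean H dn (y n))).
- exact: indices_dom.
- exact: indices_dom.
- apply: indices_disj => x /orP[xt /eqP xE|/andP[_ xi' /eqP xE]].
    by move: xt; rewrite xE/= ltnn.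
  by move: xi'; rewrite xE/= ltnn.
- apply: fsqb (chain_moment (y := fun=> y) dr (cst_below y) (ltnW nK)) => i k.
  exact: (below_measurable_fun (mX i k)).
- apply: fsqb (ojac_moment (y n) dn) => i k.
  exact: (jointT_measurable_fun (su_indep H) (@indices_dom _ _ _ _ _) (mY i k)).
Qed.

(** Telescoping as in [chain_prod_lip], each last factor being averaged first; [8] is twice the [4]
    of [ojac_moment]. At random points the distance [fsq (y n - y' n)] would be correlated with the
    preceding product, so the bound is proved at fixed points and applied after freezing. *)
Lemma chain_fixed_diff y y' b n : (n <= K)%N -> 0 <= b <= 1 ->
  bE P (fun w => opnorm (chain y t j w n - b *: chain y' t j w n) ^+ 2)
    ((8 * L ^+ 2) ^+ n * ((1 - b) ^+ 2 + \sum_(i < n) fsq (y i - y' i))).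
Proof.
move=> + b01; elim: n => [|n IH] nK /=.
  rewrite big_ord0 addr0 expr0 mul1r.
  apply: bE_le (bE_cst P (sqr_ge0 (1 - b))) _ => // w; first exact: sqr_ge0.
  rewrite -{1}[1%:M]scale1r -scalerBl.
  apply: le_trans (opnormZ_sqr _ _) _; rewrite ler_piMr ?sqr_ge0//.
  by rewrite exprn_ile1 ?opnorm_ge0// opnorm1_le.
have nK' := ltnW nK; have dn := dr nK; have {}IH := IH nK'.
rewrite big_ord_recr/= addrA.
set s := (1 - b) ^+ 2 + _ in IH *.
have mX z := chain_cur_measurable (y := fun=> z) dr (cst_below z) nK'.
have mA z := ojac_cur_measurable (y := fun=> z) dr (cst_below z) nK.
have b1 : bE P (fun w => opnorm (chain y t j w n - b *: chain y' t j w n) ^+ 2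
    * opnorm (ojac o (y n) (xi t n j w)) ^+ 2) (4 * L ^+ 2 * ((8 * L ^+ 2) ^+ n * s)).
  apply: (bE_cur H (h := fun w w' => opnorm (chain y t j w n - b *: chain y' t j w n) ^+ 2
     * opnorm (ojac o (y n) (xi t n j w')) ^+ 2) (c := fun w => 4 * L ^+ 2
      * opnorm (chain y t j w n - b *: chain y' t j w n) ^+ 2) dn).
  - apply: measurable_funM; apply: measurable_funX; apply: measurable_opnorm.
      by apply: mmxB; [exact: mX|apply: mmxZ; exact: mX].
    exact: mA.
  - by move=> w w'; rewrite mulr_ge0 ?sqr_ge0.
  - by move=> w; rewrite mulrC; apply: bEZ; [exact: sqr_ge0|exact: ojac_moment].
  - exact: bEZ.
have b2 : bE P (fun w => opnorm (chain y' t j w n) ^+ 2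
    * opnorm (ojac o (y n) (xi t n j w) - ojac o (y' n) (xi t n j w)) ^+ 2)
    (L ^+ 2 * fsq (y n - y' n) * (4 * L ^+ 2) ^+ n).
  apply: (bE_cur H (h := fun w w' => opnorm (chain y' t j w n) ^+ 2
    * opnorm (ojac o (y n) (xi t n j w') - ojac o (y' n) (xi t n j w')) ^+ 2)
    (c := fun w => L ^+ 2 * fsq (y n - y' n) * opnorm (chain y' t j w n) ^+ 2) dn).
  - apply: measurable_funM; apply: measurable_funX; apply: measurable_opnorm.
      exact: mX.
    by apply: mmxB; exact: mA.
  - by move=> w w'; rewrite mulr_ge0 ?sqr_ge0.
  - by move=> w; rewrite mulrC; apply: bEZ; [exact: sqr_ge0|exact: (su_ojac_lip H dn)].
  - apply: bEZ; first by rewrite mulr_ge0 ?sqr_ge0 ?fsq_ge0.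
    exact: (chain_moment (y := fun=> y') dr (cst_below y') nK').
apply: bE_le (bED (bEZ (ler0n _ 2) b1) (bEZ (ler0n _ 2) b2)) _.
- apply: (@below_measurable_fun t n.+1); apply: measurable_funX; apply: measurable_opnorm.
  have m z := chain_below_measurable (y := fun=> z) dr (cst_below z) nK.
  by apply: mmxB; [exact: (m y)|apply: mmxZ; exact: (m y')].
- by move=> w; exact: sqr_ge0.
- by move=> w; exact: chain_step.
- have h : (4 * L ^+ 2) ^+ n <= (8 * L ^+ 2) ^+ n.
    by rewrite lerXn2r ?nnegrE ?mulr_ge0 ?sqr_ge0// ler_wpM2r ?sqr_ge0// ler_nat.
  have F0 : 0 <= L ^+ 2 * fsq (y n - y' n) by rewrite mulr_ge0 ?sqr_ge0 ?fsq_ge0.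
  have := ler_wpM2l F0 h.
  have : 0 <= L ^+ 2 * fsq (y n - y' n) * (8 * L ^+ 2) ^+ n.
    by rewrite mulr_ge0// exprn_ge0// mulr_ge0 ?sqr_ge0.
  by rewrite [(8 * L ^+ 2) ^+ n.+1]exprS; lra.
Qed.

End fixed_points.

End jacobian_products.

Section frobenius_norm.
Context {R : realType}.

Definition fnorm m n (A : 'M[R]_(m, n)) : R := Num.sqrt (fsq A).

Lemma fnorm_ge0 m n (A : 'M[R]_(m, n)) : 0 <= fnorm A.
Proof. exact: sqrtr_ge0. Qed.

Lemma fnorm_sqr m n (A : 'M[R]_(m, n)) : fnorm A ^+ 2 = fsq A.
Proof. by rewrite sqr_sqrtr ?fsq_ge0. Qed.

Lemma fnorm_mxvec m n (A : 'M[R]_(m, n)) : fnorm A = enorm (mxvec A).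
Proof.
rewrite enormE /fnorm /fsq big_ord1; congr Num.sqrt.
rewrite pair_bigA/= (reindex _ (curry_mxvec_bij m n))/=.
by apply: eq_bigr => -[i j] _ /=; rewrite mxvecE.
Qed.

Lemma fnormD m n (A B : 'M[R]_(m, n)) : fnorm (A + B) <= fnorm A + fnorm B.
Proof. by rewrite !fnorm_mxvec linearD enormD. Qed.

Lemma fnormN m n (A : 'M[R]_(m, n)) : fnorm (- A) = fnorm A.
Proof. by rewrite /fnorm fsqN. Qed.

Lemma fnormZ m n c (A : 'M[R]_(m, n)) : fnorm (c *: A) = `|c| * fnorm A.
Proof. by rewrite /fnorm fsqZ sqrtrM ?sqr_ge0// sqrtr_sqr. Qed.

Lemma fnorm_batch_mean m n B (g : nat -> 'M[R]_(m, n)) :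
  fnorm (batch_mean B g) <= B%:R^-1 * \sum_(j < B) fnorm (g j).
Proof.
rewrite /batch_mean fnormZ ger0_norm ?invr_ge0// ler_wpM2l ?invr_ge0//.
elim: B => [|B IH]; first by rewrite !big_ord0 /fnorm fsq0 sqrtr0.
by rewrite !big_ord_recr/= (le_trans (fnormD _ _))// lerD2r.
Qed.

Lemma measurable_fnorm dT (T : measurableType dT) m n (f : T -> 'M[R]_(m, n)) :
  mmx f -> measurable_fun setT (fun t => fnorm (f t)).
Proof.
move=> mf; apply: (measurableT_comp (f := @Num.sqrt R)); last exact: measurable_fsq.
by apply: continuous_measurable_fun; exact: sqrt_continuous.
Qed.

End frobenius_norm.

Section product_constants.
Context {R : realType}.
Variables (L : R) (K : nat).

(** The half sum comes from the weighted arithmetic-geometric inequality applied to a product of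
    moment [(4 * L ^+ 2) ^+ n'] and a last increment; [2 * L] is the square root of the second
    moment of one sampled Jacobian. *)
Fixpoint remainder_cst (h : nat -> R) n : R :=
  if n is n'.+1 then
    ((4 * L ^+ 2) ^+ n' + L ^+ 2 * h n') / 2 + 2 * L * remainder_cst h n'
  else 0.

Definition prod_cst : R := (8 * L ^+ 2) ^+ K.

(** Half of [16 * prod_cst] times [1] plus the first sum, and half of [16 * prod_cst] times the
    second: the two halves of [mart_incr_pyth]. The [16] is [2 ^+ 2] times the [4] of
    [centered_fsq]. *)
Definition mart_cst : R := 8 * prod_cst *
  (1 + \sum_(i < K) 2 * (all_mask_cst L i + move_cst L i)
     + \sum_(i < K) 2 * (one_mask_cst L i + all_mask_cst L i)).

(** The first summand serves the sampled products, the second the exact ones; its [1] only provides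
    a positive bound for [bE_sqrt]. *)
Definition bias_cst : R := remainder_cst (one_mask_cst L) K
  + (1 + prod_cst * \sum_(i < K) one_mask_cst L i).

(** Twice the moment of the sampled product plus twice the same bound for the exact one. *)
Definition init_cst : R := 4 * (4 * L ^+ 2) ^+ K.

Definition grad_err_cst : R := 1 + init_cst + mart_cst + bias_cst.

Lemma prod_cst_ge0 : 0 <= prod_cst.
Proof. by rewrite exprn_ge0// mulr_ge0 ?sqr_ge0. Qed.

Lemma init_cst_ge0 : 0 <= init_cst.
Proof. by rewrite mulr_ge0// exprn_ge0// mulr_ge0 ?sqr_ge0. Qed.

Lemma mart_cst_ge0 : 0 <= mart_cst.
Proof.
have p0 := prod_cst_ge0.
rewrite /mart_cst mulr_ge0 ?mulr_ge0// addr_ge0 ?addr_ge0// sumr_ge0// => i _.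
  by rewrite mulr_ge0// addr_ge0 ?all_mask_cst_ge0 ?move_cst_ge0.
by rewrite mulr_ge0// addr_ge0 ?all_mask_cst_ge0 ?one_mask_cst_ge0.
Qed.

Hypothesis L0 : 0 <= L.

Lemma bias_cst_ge0 : 0 <= bias_cst.
Proof.
have p0 := prod_cst_ge0.
have h n : 0 <= remainder_cst (one_mask_cst L) n.
  elim: n => //= n IH; rewrite addr_ge0 ?mulr_ge0//.
  rewrite addr_ge0 ?mulr_ge0 ?sqr_ge0 ?exprn_ge0 ?mulr_ge0 ?sqr_ge0//.
  exact: one_mask_cst_ge0.
rewrite addr_ge0 ?addr_ge0 ?mulr_ge0// sumr_ge0// => i _; exact: one_mask_cst_ge0.
Qed.

Lemma grad_err_cst_ge0 : 0 <= grad_err_cst.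
Proof.
have := init_cst_ge0; have := mart_cst_ge0; have := bias_cst_ge0.
by rewrite /grad_err_cst; lra.
Qed.

End product_constants.

(** The analogue of [noise] for products of Jacobians: what one column of samples adds to [vt],
    minus its mean when the points are fixed. *)
Definition centered {R : realType} {K : nat} {d : nat -> nat} (dK : d K = 1%N)
    {dS dO : measure_display} {S : measurableType dS} {Om : measurableType dO}
    {P : probability Om R} (o : @oracle R d dS S) (xi : nat -> nat -> nat -> {RV P >-> S})
    (f : @level_maps R d) t j (y y' : forall i, 'rV[R]_(d i)) b w : 'cV[R]_(d 0%N) :=
  (jac_prod o dK y (fun i j => xi t i j w) j - jac_exact f dK y)
  - b *: (jac_prod o dK y' (fun i j => xi t i j w) j - jac_exact f dK y').

Section gradient_error.
Context {R : realType} {K : nat} {d : nat -> nat} {dK : d K = 1%N}.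
Context {X : set 'rV[R]_(d 0%N)} {f : @level_maps R d}.
Context {dS dO : measure_display} {S : measurableType dS} {Om : measurableType dO}.
Context {P : probability Om R} {o : @oracle R d dS S}.
Context {lmo : 'cV[R]_(d 0%N) -> 'rV[R]_(d 0%N)} {x1 : 'rV[R]_(d 0%N)}.
Context {T B0 B1 : nat} {xi : nat -> nat -> nat -> {RV P >-> S}} {tau : {RV P >-> nat}}.
Context {L e : R}.
Hypothesis H : pmvr_setup dK X f o lmo x1 T B0 B1 xi tau L e.

Local Notation G := (sample_systems xi tau).
Local Notation drawn := (drawn T K B0 B1).
Local Notation below := (below T K B0 B1).
Local Notation mmxJ A := (@mmx R _ (jointT G A) _ _).
Local Notation jp y t j w := (jac_prod o dK y (fun i j => xi t i j w) j).
Local Notation gp y := (jac_exact f dK y).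
Local Notation centered := (centered dK o xi f).

Let L0 : 0 <= L. Proof. exact: le_trans ler01 (su_L H). Qed.
Let e0 : 0 <= e. Proof. exact: ltW (su_e0 H). Qed.

Local Notation chain y t j w n := (chain_prod (fun i => ojac o (y i) (xi t i j w)) n).

(** The increment of the last factor has a size governed by the distance of the points at level [n],
    which is correlated with the preceding product, so only L^1 is available. The inequality
    [x a <= e^2 x^2 / 2 + a^2 / (2 e^2)] balances [x^2] of order 1 against [a^2] of order [e^4]. *)
Lemma chain_diff_L1 t j (y y' : Om -> forall i, 'rV[R]_(d i)) (h : nat -> R) :
  (forall i, (i < K)%N -> drawn (t, i, j)) ->
  (forall i, (i < K)%N -> mmxJ (below t i) (fun w => y w i)) ->
  (forall i, (i < K)%N -> mmxJ (below t i) (fun w => y' w i)) ->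
  (forall i, (i < K)%N -> bE P (fun w => fsq (y w i - y' w i)) (h i * e ^+ 4)) ->
  forall n, (n <= K)%N -> bE P (fun w => opnorm (chain (y w) t j w n - chain (y' w) t j w n))
    (remainder_cst L h n * e ^+ 2).
Proof.
move=> dr my my' bh; elim=> [|n IH] nK.
  rewrite mul0r; apply: bE_le (bE_cst P (lexx 0)) _ => //.
  - by rewrite /=.
  - by move=> w; exact: opnorm_ge0.
  - by move=> w; rewrite /= subrr -(scale0r 0) (le_trans (opnormZ_le _ _))// normr0 mul0r.
have nK' := ltnW nK; have dn := dr _ nK; have {}IH := IH nK'.
have en0 : e != 0 by rewrite gt_eqF// (su_e0 H).
have mX := chain_cur_measurable dr my nK'.
have mX' := chain_cur_measurable dr my' nK'.
have mA := ojac_cur_measurable dr my nK.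
have mA' := ojac_cur_measurable dr my' nK.
have bA : bE P (fun w => opnorm (ojac o (y w n) (xi t n j w) - ojac o (y' w n) (xi t n j w)) ^+ 2)
    (L ^+ 2 * (h n * e ^+ 4)).
  apply: (bE_cur H (h := fun w w' => opnorm (ojac o (y w n) (xi t n j w')
    - ojac o (y' w n) (xi t n j w')) ^+ 2)
    (c := fun w => L ^+ 2 * fsq (y w n - y' w n)) dn).
  - by apply: measurable_funX; apply: measurable_opnorm; apply: mmxB.
  - by move=> w w'; exact: sqr_ge0.
  - by move=> w; exact: (su_ojac_lip H dn).
  - by apply: bEZ; [exact: sqr_ge0|exact: bh].
have bY : bE P (fun w => opnorm (chain (y w) t j w n - chain (y' w) t j w n)
    * opnorm (ojac o (y' w n) (xi t n j w))) (2 * L * (remainder_cst L h n * e ^+ 2)).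
  apply: (bE_cur H (h := fun w w' => opnorm (chain (y w) t j w n - chain (y' w) t j w n)
    * opnorm (ojac o (y' w n) (xi t n j w')))
    (c := fun w => 2 * L * opnorm (chain (y w) t j w n - chain (y' w) t j w n)) dn).
  - by apply: measurable_funM; apply: measurable_opnorm; [apply: mmxB|].
  - by move=> w w'; rewrite mulr_ge0 ?opnorm_ge0.
  - move=> w; rewrite [2 * L * _]mulrC; apply: bEZ; first exact: opnorm_ge0.
    apply: bE_sqrt.
    + apply: measurable_opnorm; apply: mmx_ojac; first exact: mmx_cst.
      exact: measurable_funPT.
    + by move=> w'; exact: opnorm_ge0.
    + by rewrite mulr_gt0// (lt_le_trans ltr01 (su_L H)).
    + rewrite (_ : (2 * L) ^+ 2 = 4 * L ^+ 2); last by ring.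
      exact: (ojac_moment H).
  - by apply: bEZ => //; rewrite mulr_ge0.
have bX := bEZ (_ : 0 <= e ^+ 2 / 2) (chain_moment H dr my nK').
have bA' := bEZ (_ : 0 <= (2 * e ^+ 2)^-1) bA.
apply: bE_le (bED (bED (bX (divr_ge0 (sqr_ge0 e) (ler0n _ 2)))
  (bA' _)) bY) _.
- apply: (below_measurable_fun H (t := t) (n := n.+1)); apply: measurable_opnorm.
  by apply: mmxB; exact: (chain_below_measurable dr).
- by move=> w; exact: opnorm_ge0.
- move=> w /=; set x := chain_prod _ n; set x' := chain_prod _ n.
  set a := ojac o (y w n) _; set a' := ojac o (y' w n) _.
  have -> : x *m a - x' *m a' = x *m (a - a') + (x - x') *m a'.
    by rewrite mulmxBr mulmxBl addrA subrK.
  apply: le_trans (opnormD _ _) _; rewrite lerD ?opnormM//.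
  apply: le_trans (opnormM _ _) _; rewrite -subr_ge0.
  have -> : e ^+ 2 / 2 * opnorm x ^+ 2 + (2 * e ^+ 2)^-1 * opnorm (a - a') ^+ 2
     - opnorm x * opnorm (a - a') = (e ^+ 2 * opnorm x - opnorm (a - a')) ^+ 2 / (2 * e ^+ 2).
    by field; rewrite en0.
  by rewrite divr_ge0 ?sqr_ge0// mulr_ge0 ?sqr_ge0.
- by rewrite invr_ge0 mulr_ge0 ?sqr_ge0.
- rewrite /=; rewrite le_eqVlt; apply/orP; left; apply/eqP; field; exact: en0.
Qed.

Lemma jp_fixed_diff t j (y y' : forall i, 'rV[R]_(d i)) b :
  (forall i, (i < K)%N -> drawn (t, i, j)) -> 0 <= b <= 1 ->
  bE P (fun w => fsq (jp y t j w - b *: jp y' t j w))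
    (prod_cst L K * ((1 - b) ^+ 2 + \sum_(i < K) fsq (y i - y' i))).
Proof.
move=> dr b01; apply: bE_le (chain_fixed_diff H dr y y' (leqnn K) b01) _ => //.
- have m z : mmx (fun w => jp z t j w).
    by apply: jac_prod_measurable => i iK; [exact: mmx_cst|exact: measurable_funPT].
  by apply: measurable_fsq; apply: mmxB => //; exact: mmxZ.
- by move=> w; exact: fsq_ge0.
- by move=> w; rewrite /jac_prod castmx_lin; exact: fsq_cast_le.
Qed.

Lemma jp_mean t j (y : forall i, 'rV[R]_(d i)) :
  (forall i, (i < K)%N -> drawn (t, i, j)) -> has_mean P (fun w => jp y t j w) (gp y).
Proof.
move=> dr k l; rewrite castmxE; under eq_fun do rewrite castmxE.
exact: (chain_fixed_mean H dr y (leqnn K)).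
Qed.

Lemma gp_diff (y y' : forall i, 'rV[R]_(d i)) b : 0 <= b <= 1 ->
  fsq (gp y - b *: gp y') <=
    prod_cst L K * ((1 - b) ^+ 2 + \sum_(i < K) fsq (y i - y' i)).
Proof.
move=> b01; rewrite /jac_exact castmx_lin.
set A := _ - _; apply: (@le_trans _ _ (opnorm A ^+ 2)); first exact: fsq_cast_le.
apply: (chain_prod_lip (D := fun i => fsq (y i - y' i)) (su_L H) b01) => i iK.
- exact: (su_jbound H).
- exact: (su_jbound H).
- exact: (su_jlip H).
- exact: fsq_ge0.
Qed.

Lemma gp_measurable dT (T0 : measurableType dT) (y : T0 -> forall i, 'rV[R]_(d i)) :
  (forall i, (i < K)%N -> mmx (fun p => y p i)) -> mmx (fun p => gp (y p)).
Proof.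
move=> my; apply: mmx_castmx; apply: mmx_chain_prod => i iK.
apply: (@mmx_continuous _ _ _ _ _ _ _ (fun x => 'J (@f i) x)); last exact: my.
exact: (su_jcont H iK).
Qed.

Lemma centeredE t j y y' b w : centered t j y y' b w =
  (jp y t j w - b *: jp y' t j w) - (gp y - b *: gp y').
Proof.
have alg (a a' c c' : 'cV[R]_(d 0%N)) : (a - a') - b *: (c - c') = (a - b *: c) - (a' - b *: c').
  by apply/colP => k; rewrite !mxE; ring.
exact: alg.
Qed.

Lemma centered_mean t j y y' b : (forall i, (i < K)%N -> drawn (t, i, j)) ->
  has_mean P (centered t j y y' b) 0.
Proof.
move=> dr; have h z := has_meanB (jp_mean z dr) (has_mean_cst P (gp z)).
have alg (a c : 'cV[R]_(d 0%N)) : (a - a) - b *: (c - c) = 0.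
  by rewrite !subrr scaler0 subr0.
rewrite -(alg (gp y) (gp y')); exact: has_meanB (h y) (has_meanZ b (h y')).
Qed.

Lemma centered_measurable dT (T0 : measurableType dT) t j b
    (y y' : T0 -> forall i, 'rV[R]_(d i)) (g : T0 -> Om) :
  (forall i, (i < K)%N -> mmx (fun p => y p i)) ->
  (forall i, (i < K)%N -> mmx (fun p => y' p i)) ->
  (forall i, (i < K)%N -> measurable_fun setT (fun p => xi t i j (g p))) ->
  mmx (fun p => centered t j (y p) (y' p) b (g p)).
Proof.
move=> my my' mg; apply: mmxB; [|apply: mmxZ]; apply: mmxB.
- exact: jac_prod_measurable.
- exact: gp_measurable.
- exact: jac_prod_measurable.
- exact: gp_measurable.
Qed.

Lemma centered_fsq t j y y' b : (forall i, (i < K)%N -> drawn (t, i, j)) -> 0 <= b <= 1 ->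
  bE P (fun w => fsq (centered t j y y' b w))
    (4 * prod_cst L K * ((1 - b) ^+ 2 + \sum_(i < K) fsq (y i - y' i))).
Proof.
move=> dr b01.
apply: bE_le (bED (bEZ (ler0n _ 2) (jp_fixed_diff y y' dr b01))
  (bE_cst P (mulr_ge0 (ler0n _ 2) (fsq_ge0 (gp y - b *: gp y'))))) _.
- apply: measurable_fsq; apply: centered_measurable => i iK;
    by [exact: mmx_cst|exact: measurable_funPT].
- by move=> w; exact: fsq_ge0.
- by move=> w; rewrite centeredE (le_trans (fsqD_le2 _ _))// fsqN.
- by have := gp_diff y y' b01; lra.
Qed.

End gradient_error.

(** * Error of the gradient estimator *)

Section martingale_part.
Context {R : realType} {K : nat} {d : nat -> nat} (dK : d K = 1%N).
Context {dS dO : measure_display} {S : measurableType dS} {Om : measurableType dO}.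
Context {P : probability Om R} (o : @oracle R d dS S).
Context (lmo : 'cV[R]_(d 0%N) -> 'rV[R]_(d 0%N)) (x1 : 'rV[R]_(d 0%N)).
Context (B0 B1 : nat) (xi : nat -> nat -> nat -> {RV P >-> S}) (e : R).
Context (f : @level_maps R d).

Local Notation U := (run_u dK o lmo x1 B0 B1 xi e).
Local Notation Um := (masked_u dK o lmo x1 B0 B1 xi e f).

Definition v_err t w : 'cV[R]_(d 0%N) :=
  vt (run dK o lmo x1 B0 B1 xi e t w) - jac_exact f dK (U t w).

(* Um (pred1 j) does not involve the j-th samples, so each summand has
   conditional mean 0; the remainder collects what the replacement changes. *)
Definition mart_incr t w : 'cV[R]_(d 0%N) :=
  batch_mean B1 (fun j => centered dK o xi f t.+1 j (Um (pred1 j) t w) (U t w) (1 - e) w).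

Definition remainder t w : 'cV[R]_(d 0%N) :=
  batch_mean B1 (fun j =>
    (jac_prod o dK (U t.+1 w) (fun i j => xi t.+1 i j w) j
     - jac_prod o dK (Um (pred1 j) t w) (fun i j => xi t.+1 i j w) j)
    - (jac_exact f dK (U t.+1 w) - jac_exact f dK (Um (pred1 j) t w))).

(** Follows the recursion of [v_err] without [remainder]. Starting at the initial error, it leaves a
    bias that starts at 0. *)
Fixpoint mart_err t w : 'cV[R]_(d 0%N) :=
  if t is t'.+1 then (1 - e) *: mart_err t' w + mart_incr t' w else v_err 0 w.

Lemma v_errS t w : (0 < B1)%N ->
  v_err t.+1 w = (1 - e) *: v_err t w + mart_incr t w + remainder t w.
Proof.
move=> B1_gt0; have alg (v g g' : 'cV[R]_(d 0%N)) (a a' c h : nat -> 'cV[R]_(d 0%N)) :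
    (1 - e) *: v + batch_mean B1 a - (1 - e) *: batch_mean B1 a' - g =
    (1 - e) *: (v - g') + batch_mean B1 (fun j => (c j - h j) - (1 - e) *: (a' j - g'))
    + batch_mean B1 (fun j => (a j - c j) - (g - h j)).
  rewrite !(batch_meanB, batch_meanZ) !batch_mean_cst//.
  by apply/colP => k; rewrite !mxE; ring.
exact: alg.
Qed.

End martingale_part.

Section gradient_recursion.
Context {R : realType} {K : nat} {d : nat -> nat} {dK : d K = 1%N}.
Context {X : set 'rV[R]_(d 0%N)} {f : @level_maps R d}.
Context {dS dO : measure_display} {S : measurableType dS} {Om : measurableType dO}.
Context {P : probability Om R} {o : @oracle R d dS S}.
Context {lmo : 'cV[R]_(d 0%N) -> 'rV[R]_(d 0%N)} {x1 : 'rV[R]_(d 0%N)}.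
Context {T B0 B1 : nat} {xi : nat -> nat -> nat -> {RV P >-> S}} {tau : {RV P >-> nat}}.
Context {L e : R}.
Hypothesis H : pmvr_setup dK X f o lmo x1 T B0 B1 xi tau L e.

Local Notation G := (sample_systems xi tau).
Local Notation drawn := (drawn T K B0 B1).
Local Notation past := (past T K B0 B1).
Local Notation mmxJ A := (@mmx R _ (jointT G A) _ _).
Local Notation mmxJ2 A B := (@mmx R _ (jointT G A * jointT G B)%type _ _).
Local Notation U := (run_u dK o lmo x1 B0 B1 xi e).
Local Notation Um := (masked_u dK o lmo x1 B0 B1 xi e f).
Local Notation others := (others T K B0 B1).
Local Notation centered := (centered dK o xi f).
Local Notation v_err := (v_err dK o lmo x1 B0 B1 xi e f).
Local Notation mart_incr := (mart_incr dK o lmo x1 B0 B1 xi e f).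
Local Notation remainder := (remainder dK o lmo x1 B0 B1 xi e f).
Local Notation mart_err := (mart_err dK o lmo x1 B0 B1 xi e f).
Local Notation Ut := (Um (fun=> true)).
Local Notation Uh j := (Um (pred1 j)).
Local Notation column := (column T K B0 B1).

Let e0 : 0 <= e. Proof. exact: ltW (su_e0 H). Qed.
Let e1 := su_e1 H.
Let Bp : 0 < B1%:R :> R. Proof. by rewrite ltr0n (su_B1 H). Qed.
Let be : 0 <= 1 - e <= 1.
Proof. by rewrite subr_ge0 e1 lerBlDr lerDl. Qed.
Let pc0 : 0 <= prod_cst L K. Proof. by rewrite exprn_ge0// mulr_ge0 ?sqr_ge0. Qed.

Let drawn_next t j : (t.+1 < T)%N -> (j < B1)%N ->
  forall i, (i < K)%N -> drawn (t.+1, i, j).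
Proof. by move=> tT jB i iK; rewrite /= tT iK jB. Qed.

Lemma xi_column_measurable t i j : drawn (t, i, j) ->
  measurable_fun [set: jointT G (column t j K)] (xi t i j).
Proof.
move=> dr; apply: xi_measurable; apply/andP; split=> //=.
by rewrite !eqxx; case/and3P: dr.
Qed.

Lemma centered_column_measurable A t j b (y y' : Om -> forall i, 'rV[R]_(d i)) :
  (forall i, (i < K)%N -> drawn (t, i, j)) ->
  (forall i, (i < K)%N -> mmxJ A (fun w => y w i)) ->
  (forall i, (i < K)%N -> mmxJ A (fun w => y' w i)) ->
  mmxJ2 A (column t j K) (fun p => centered t j (y p.1) (y' p.1) b p.2).
Proof.
move=> dr my my'; apply: (centered_measurable H) => i iK.
- exact: (mmx_comp measurable_fst (my i iK)).
- exact: (mmx_comp measurable_fst (my' i iK)).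
- apply: (measurableT_comp (f := xi t i j : jointT G _ -> S)); last exact: measurable_snd.
  exact: (xi_column_measurable (dr i iK)).
Qed.

Lemma past_u_measurable t i A : (t.+1 < T)%N -> (i < K)%N -> past t.+1 `<=` A ->
  mmxJ A (fun w => U t w i).
Proof.
move=> tT iK sA; apply: (u_measurable H); [exact: ltnW|exact: ltnW|].
exact: subset_trans (@below_past _ _ _ _ t i) sA.
Qed.

(* mart_incr is the mean over j of c_j + d_j, c_j being centered at the
   masked point Ut, which is past-measurable, so that the c_j are conditionally
   independent. The d_j are dependent, but of second moment O(e^3) each:
     V + mean (c + d) = 1/2 (V + 2 mean c) + 1/2 mean (V + 2 d)
   leaves the cross terms with V, which vanish, and no cross term of the d_j. *)
Lemma mart_incr_pyth t (V : Om -> 'cV[R]_(d 0%N)) r : (t.+1 < T)%N ->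
  mmxJ (past t.+1) V -> bE P (fun w => fsq (V w)) r ->
  measurable_fun [set: Om] (fun w => fsq (V w + mart_incr t w)) ->
  bE P (fun w => fsq (V w + mart_incr t w)) (r + mart_cst L K * e ^+ 3).
Proof.
move=> tT mV bV mM.
set S1 := \sum_(i < K) 2 * (all_mask_cst L i + move_cst L i).
set S2 := \sum_(i < K) 2 * (one_mask_cst L i + all_mask_cst L i).
have mUt A i : (i < K)%N -> past t.+1 `<=` A -> mmxJ A (fun w => Ut t w i).
  move=> iK sA; have m := mask_all_measurable H tT (ltnW iK).
  exact: (mmx_comp (joint_id_sub (G := G) sA) m).
have S10 : 0 <= S1.
  by rewrite sumr_ge0// => i _; rewrite mulr_ge0// addr_ge0 ?all_mask_cst_ge0 ?move_cst_ge0.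
have S20 : 0 <= S2.
  by rewrite sumr_ge0// => i _; rewrite mulr_ge0// addr_ge0 ?all_mask_cst_ge0 ?one_mask_cst_ge0.
(* At the fully masked points everything but the columns is known from the past, and distinct
   columns are independent. The batch mean therefore gains [1 / B1 <= e] over the single second
   moment O(e^2). *)
have bA : bE P (fun w => fsq (V w + \sum_(j < B1) (2 * B1%:R^-1) *:
    centered t.+1 j (Ut t w) (U t w) (1 - e) w))
    (r + 16 * prod_cst L K * (1 + S1) * e ^+ 3).
  apply: bE_ler (bE_pyth_sum (su_indep H) (N := B1) (A := past t.+1)
    (B := fun j => column t.+1 j K)
    (Z := fun j w w' => (2 * B1%:R^-1) *: centered t.+1 j (Ut t w) (U t w) (1 - e) w')
    (c := fun _ w => (2 * B1%:R^-1) ^+ 2 * (4 * prod_cst L K * (e ^+ 2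
       + \sum_(i < K) fsq (Ut t w i - U t w i))))
    (r2 := fun=> (2 * B1%:R^-1) ^+ 2 * (4 * prod_cst L K * (e ^+ 2
       + \sum_(i < K) 2 * (all_mask_cst L i + move_cst L i) * e ^+ 2)))
    _ _ _ _ mV _ _ _ bV _) _.
  - exact: indices_dom.
  - by move=> j _; exact: indices_dom.
  - by move=> j _; apply: indices_disj => x xt /andP[/andP[/eqP xE _] _]; move: xt; rewrite xE ltnn.
  - move=> j l /andP[jl _]; apply: indices_disj => x /andP[/andP[_ /eqP xj] _].
    by move=> /andP[/andP[_ /eqP xl] _]; move: jl; rewrite -xj -xl ltnn.
  - move=> j jB; apply: mmxZ; apply: centered_column_measurable; first exact: drawn_next.
      by move=> i iK; exact: mUt.
    by move=> i iK; exact: past_u_measurable.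
  - move=> j w jB; rewrite -(scaler0 _ (2 * B1%:R^-1)); apply: has_meanZ.
    by apply: (centered_mean H); exact: drawn_next.
  - move=> j w jB; under eq_fun do rewrite fsqZ.
    apply: bEZ; first exact: sqr_ge0.
    rewrite (_ : e ^+ 2 = (1 - (1 - e)) ^+ 2); last by ring.
    by apply: (centered_fsq H) => //; exact: drawn_next.
  - move=> j _; apply: bEZ; first exact: sqr_ge0.
    apply: bEZ; first by rewrite mulr_ge0.
    apply: bED; first by apply: bE_cst; exact: sqr_ge0.
    apply: (bE_sum (h := fun i w => fsq (Ut t w i - U t w i))) => i.
    by apply: (all_mask_move_bound H) => //; exact: ltnW.
  - rewrite lerD2l sumr_const card_ord -mulr_suml -/S1.
    set q := 4 * prod_cst L K * (e ^+ 2 + S1 * e ^+ 2).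
    rewrite -[_ *+ B1]mulr_natl.
    have -> : B1%:R * ((2 * B1%:R^-1) ^+ 2 * q) = B1%:R^-1 * (4 * q).
      by field; rewrite gt_eqF.
    have q0 : 0 <= 4 * q.
      by rewrite /q !mulr_ge0// addr_ge0 ?mulr_ge0 ?sqr_ge0.
    by have := ler_wpM2r q0 (su_B1e H); rewrite /q; lra.
(* Given [others t.+1 j] both masked points are known and column [j] is fresh. The weight [b = 1]
   removes the term [(1 - b) ^+ 2], so only the squared distance of the two points remains, already
   O(e^3) without averaging. *)
have bD j : (j < B1)%N -> bE P (fun w => fsq (V w + 2 *: centered t.+1 j (Uh j t w) (Ut t w) 1 w))
    (r + 16 * prod_cst L K * S2 * e ^+ 3).
  move=> jB; have past_others : past t.+1 `<=` others t.+1 j.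
    by apply: indices_sub => x _ ->.
  apply: bE_ler (bE_pyth (su_indep H) (A := others t.+1 j) (B := column t.+1 j K)
    (V := V) (Z := fun w w' => 2 *: centered t.+1 j (Uh j t w) (Ut t w) 1 w')
    (c := fun w => 2 ^+ 2 * (4 * prod_cst L K * ((1 - 1) ^+ 2
       + \sum_(i < K) fsq (Uh j t w i - Ut t w i))))
    (r2 := 2 ^+ 2 * (4 * prod_cst L K * ((1 - 1) ^+ 2
       + \sum_(i < K) 2 * (one_mask_cst L i + all_mask_cst L i) * e ^+ 3)))
    _ _ _ _ _ _ _ bV _) _.
  - exact: indices_dom.
  - exact: indices_dom.
  - apply: indices_disj => x /orP[xt /andP[/andP[/eqP xE _] _]|].
      by move: xt; rewrite xE ltnn.
    by move=> /andP[_ xj] /andP[/andP[_ xE] _]; rewrite xE in xj.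
  - exact: (mmx_comp (joint_id_sub (G := G) past_others) mV).
  - apply: mmxZ; apply: centered_column_measurable; first exact: drawn_next.
      by move=> i iK; apply: (mask_one_measurable H) => //; exact: ltnW.
    by move=> i iK; exact: mUt.
  - move=> w; rewrite -(scaler0 _ 2); apply: has_meanZ.
    by apply: (centered_mean H); exact: drawn_next.
  - move=> w; under eq_fun do rewrite fsqZ.
    apply: bEZ; first exact: sqr_ge0.
    by apply: (centered_fsq H); [exact: drawn_next|rewrite ler01 lexx].
  - apply: bEZ; first exact: sqr_ge0.
    apply: bEZ; first by rewrite mulr_ge0.
    apply: bED; first by apply: bE_cst; exact: sqr_ge0.
    apply: (bE_sum (h := fun i w => fsq (Uh j t w i - Ut t w i))) => i.
    by apply: (one_all_mask_bound H) => //; exact: ltnW.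
  - by rewrite -mulr_suml -/S2 subrr expr0n add0r; lra.
have bm := bEZ (_ : 0 <= 2^-1 * B1%:R^-1) (bE_sum (fun j : 'I_B1 => bD j (ltn_ord j))).
have i0 : 0 <= B1%:R^-1 :> R by rewrite invr_ge0 ltW.
have h0 : 0 <= 2^-1 :> R by rewrite invr_ge0.
apply: bE_le (bED (bEZ h0 bA) (bm (mulr_ge0 h0 i0))) _ => //.
- by move=> w; exact: fsq_ge0.
- move=> w.
  pose a := V w + \sum_(j < B1) (2 * B1%:R^-1) *: centered t.+1 j (Ut t w) (U t w) (1 - e) w.
  pose b := batch_mean B1 (fun j => V w + 2 *: centered t.+1 j (Uh j t w) (Ut t w) 1 w).
  have -> : V w + mart_incr t w = 2^-1 *: a + 2^-1 *: b.
    rewrite /a /b batch_meanD (batch_mean_cst _ (su_B1 H)) batch_meanZ.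
    rewrite -scaler_sumr -scalerA -/(batch_mean B1 (fun j => centered t.+1 j (Ut t w) (U t w) (1 - e) w)).
    (* The fully masked product is added and subtracted inside each summand. *)
    have -> : mart_incr t w = batch_mean B1 (fun j => centered t.+1 j (Ut t w) (U t w) (1 - e) w)
       + batch_mean B1 (fun j => centered t.+1 j (Uh j t w) (Ut t w) 1 w).
      rewrite -batch_meanD /mart_incr /batch_mean; congr (_ *: _).
      apply: eq_bigr => j _; rewrite /centered scale1r.
      have alg (p p' q q' g : 'cV[R]_(d 0%N)) : p - p' - g = (q - q' - g) + (p - p' - (q - q')).
        by apply/colP => k; rewrite !mxE; ring.
      exact: alg.
    have alg (v a' b' : 'cV[R]_(d 0%N)) : v + (a' + b') =
        2^-1 *: (v + 2 *: a') + 2^-1 *: (v + 2 *: b').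
      by apply/colP => k; rewrite !mxE; field.
    exact: alg.
  apply: le_trans (fsqD_le2 _ _) _; rewrite (fsqZ _ a) (fsqZ _ b).
  have : fsq b <= _ := fsq_mean _ (su_B1 H).
  rewrite -/a; lra.
- rewrite sumr_const card_ord.
  set q := r + 16 * prod_cst L K * S2 * e ^+ 3.
  rewrite -[q *+ B1]mulr_natl.
  have -> : 2^-1 * B1%:R^-1 * (B1%:R * q) = 2^-1 * q by field; rewrite gt_eqF.
  by rewrite /q /mart_cst -/S1 -/S2; lra.
Qed.

End gradient_recursion.

Section gradient_error_bound.
Context {R : realType} {K : nat} {d : nat -> nat} {dK : d K = 1%N}.
Context {X : set 'rV[R]_(d 0%N)} {f : @level_maps R d}.
Context {dS dO : measure_display} {S : measurableType dS} {Om : measurableType dO}.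
Context {P : probability Om R} {o : @oracle R d dS S}.
Context {lmo : 'cV[R]_(d 0%N) -> 'rV[R]_(d 0%N)} {x1 : 'rV[R]_(d 0%N)}.
Context {T B0 B1 : nat} {xi : nat -> nat -> nat -> {RV P >-> S}} {tau : {RV P >-> nat}}.
Context {L e : R}.
Hypothesis H : pmvr_setup dK X f o lmo x1 T B0 B1 xi tau L e.

Local Notation G := (sample_systems xi tau).
Local Notation drawn := (drawn T K B0 B1).
Local Notation past := (past T K B0 B1).
Local Notation below := (below T K B0 B1).
Local Notation mmxJ A := (@mmx R _ (jointT G A) _ _).
Local Notation U := (run_u dK o lmo x1 B0 B1 xi e).
Local Notation Um := (masked_u dK o lmo x1 B0 B1 xi e f).
Local Notation jp y t j w := (jac_prod o dK y (fun i j => xi t i j w) j).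
Local Notation gp y := (jac_exact f dK y).
Local Notation v_err := (v_err dK o lmo x1 B0 B1 xi e f).
Local Notation mart_incr := (mart_incr dK o lmo x1 B0 B1 xi e f).
Local Notation remainder := (remainder dK o lmo x1 B0 B1 xi e f).
Local Notation mart_err := (mart_err dK o lmo x1 B0 B1 xi e f).
Local Notation Uh j := (Um (pred1 j)).
Local Notation chain y t j w n := (chain_prod (fun i => ojac o (y i) (xi t i j w)) n).

Let L0 : 0 <= L. Proof. exact: le_trans ler01 (su_L H). Qed.
Let e0 : 0 <= e. Proof. exact: ltW (su_e0 H). Qed.
Let e1 := su_e1 H.
Let Bp : 0 < B1%:R :> R. Proof. by rewrite ltr0n (su_B1 H). Qed.
Let be : 0 <= 1 - e <= 1.
Proof. by rewrite subr_ge0 e1 lerBlDr lerDl. Qed.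
Let pc0 : 0 <= prod_cst L K. Proof. exact: prod_cst_ge0. Qed.

Lemma jp_past_measurable t j (y : Om -> forall i, 'rV[R]_(d i)) A : (t < T)%N ->
  (forall i, (i < K)%N -> drawn (t, i, j)) -> past t.+1 `<=` A ->
  (forall i, (i < K)%N -> mmxJ A (fun w => y w i)) ->
  mmxJ A (fun w => jp (y w) t j w).
Proof.
move=> tT dr sA my; apply: jac_prod_measurable => // i iK.
apply: xi_measurable; apply: sA; apply/andP; split; last exact: ltnSn.
exact: dr.
Qed.

Lemma u_past_measurable t i A : (t < T)%N -> (i < K)%N -> past t.+1 `<=` A ->
  mmxJ A (fun w => U t w i).
Proof.
move=> tT iK sA; apply: (u_measurable H) => //; first exact: ltnW.
exact: subset_trans (@below_past _ _ _ _ t i) sA.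
Qed.

Lemma hat_past_measurable t i j A : (t.+1 < T)%N -> (i < K)%N -> past t.+2 `<=` A ->
  mmxJ A (fun w => Uh j t w i).
Proof.
move=> tT iK sA; have m := mask_below_measurable H (pred1 j) tT (ltnW iK).
exact: (mmx_comp (joint_id_sub (G := G)
  (subset_trans (@below_past _ _ _ _ t.+1 i) sA)) m).
Qed.

Lemma v_err_measurable t A : (t < T)%N -> past t.+1 `<=` A -> mmxJ A (v_err t).
Proof.
move=> tT sA; apply: mmxB; first exact: (v_measurable H).
by apply: (gp_measurable H) => i iK; exact: u_past_measurable.
Qed.

Let dr_next t j : (t.+1 < T)%N -> (j < B1)%N -> forall i, (i < K)%N -> drawn (t.+1, i, j).
Proof. by move=> tT jB i iK; rewrite /= tT iK jB. Qed.

Let past_next t : past t.+1 `<=` past t.+2.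
Proof. exact: past_mono. Qed.

Lemma mart_incr_measurable t A : (t.+1 < T)%N -> past t.+2 `<=` A -> mmxJ A (mart_incr t).
Proof.
move=> tT sA; apply: mmx_batch_mean => j jB; apply: (centered_measurable H) => i iK.
- exact: hat_past_measurable.
- by apply: u_past_measurable => //; [exact: ltnW|exact: subset_trans (@past_next t) sA].
- apply: xi_measurable; apply: sA; apply/andP; split; last exact: ltnSn.
  exact: dr_next.
Qed.

Lemma remainder_measurable t A : (t.+1 < T)%N -> past t.+2 `<=` A -> mmxJ A (remainder t).
Proof.
move=> tT sA; apply: mmx_batch_mean => j jB.
apply: mmxB; apply: mmxB.
- by apply: jp_past_measurable => //; [exact: dr_next|move=> i iK; exact: u_past_measurable].
- by apply: jp_past_measurable => //; [exact: dr_next|move=> i iK; exact: hat_past_measurable].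
- by apply: (gp_measurable H) => i iK; exact: u_past_measurable.
- by apply: (gp_measurable H) => i iK; exact: hat_past_measurable.
Qed.

Lemma mart_err_measurable t A : (t < T)%N -> past t.+1 `<=` A -> mmxJ A (mart_err t).
Proof.
elim: t A => [|t IH] A tT sA; first exact: v_err_measurable.
apply: mmxD; last exact: mart_incr_measurable.
by apply: mmxZ; apply: IH; [exact: ltnW|exact: subset_trans (@past_next t) sA].
Qed.

Lemma past_measurable_fun t (h : Om -> R) :
  measurable_fun [set: jointT G (past t)] h -> measurable_fun [set: Om] h.
Proof. by apply: (jointT_measurable_fun (su_indep H)); exact: indices_dom. Qed.

(** The triangle inequality over the batch, then one term for sampled products and one for exact
    products. Both are O(e^2) in mean norm, as the points differ by O(e^4) in second moment. *)
Lemma remainder_bound t : (t.+1 < T)%N ->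
  bE P (fun w => fnorm (remainder t w)) (bias_cst L K * e ^+ 2).
Proof.
move=> tT; have tT' := ltnW tT.
set S3 := \sum_(i < K) one_mask_cst L i.
have S30 : 0 <= S3 by rewrite sumr_ge0// => i _; exact: one_mask_cst_ge0.
have mg j : mmxJ (past t.+2) (fun w => gp (U t.+1 w) - gp (Uh j t w)).
  by apply: mmxB; apply: (gp_measurable H) => i iK; [exact: u_past_measurable|exact: hat_past_measurable].
have mj j : (j < B1)%N -> mmxJ (past t.+2) (fun w => jp (U t.+1 w) t.+1 j w - jp (Uh j t w) t.+1 j w).
  move=> jB; apply: mmxB; (apply: jp_past_measurable => //; first exact: dr_next) => i iK.
    exact: u_past_measurable.
  exact: hat_past_measurable.
have bj j : (j < B1)%N ->
    bE P (fun w => fnorm (jp (U t.+1 w) t.+1 j w - jp (Uh j t w) t.+1 j w))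
      (remainder_cst L (one_mask_cst L) K * e ^+ 2).
  move=> jB; apply: bE_le (chain_diff_L1 H (t := t.+1) (j := j)
    (y := fun w => U t.+1 w) (y' := fun w => Uh j t w) (h := one_mask_cst L)
    _ _ _ _ (leqnn K)) _ => //.
  - exact: (past_measurable_fun (measurable_fnorm (mj j jB))).
  - by move=> w; exact: fnorm_ge0.
  - move=> w; rewrite -(scale1r (jp (Uh j t w) _ _ _)) /jac_prod castmx_lin scale1r.
    rewrite -(ger0_norm (opnorm_ge0 _)) -sqrtr_sqr ler_wsqrtr//; exact: fsq_cast_le.
  - exact: dr_next.
  - by move=> i iK; apply: (u_measurable H) => //; exact: ltnW.
  - by move=> i iK; apply: (mask_below_measurable H) => //; exact: ltnW.
  - by move=> i iK; apply: (one_mask_bound H) => //; exact: ltnW.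
have bg j : (j < B1)%N -> bE P (fun w => fnorm (gp (U t.+1 w) - gp (Uh j t w)))
    ((1 + prod_cst L K * S3) * e ^+ 2).
  (* A constant at least 1 is positive, as [bE_sqrt] requires, and bounded by its own square. *)
  move=> jB; have c1 : 1 <= 1 + prod_cst L K * S3 by rewrite lerDl mulr_ge0.
  have bs := bEZ pc0 (bE_sum (h := fun i w => fsq (U t.+1 w (val i) - Uh j t w (val i)))
    (fun i : 'I_K => one_mask_bound H tT (ltnW (ltn_ord i)) jB)).
  have e20 : 0 < e ^+ 2 by rewrite exprn_gt0// (su_e0 H).
  apply: bE_sqrt.
  - exact: (past_measurable_fun (measurable_fnorm (mg j))).
  - by move=> w; exact: fnorm_ge0.
  - by rewrite mulr_gt0// (lt_le_trans ltr01 c1).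
  - apply: bE_le bs _ => //.
    + apply: measurable_funX; exact: (past_measurable_fun (measurable_fnorm (mg j))).
    + by move=> w; exact: sqr_ge0.
    + move=> w; rewrite fnorm_sqr -(scale1r (gp (Uh j t w))).
      apply: le_trans (gp_diff H _ _ (_ : 0 <= 1 <= 1)) _; first by rewrite ler01 lexx.
      by rewrite subrr expr0n add0r.
    + rewrite -mulr_suml -/S3 exprMn -exprM mulrA ler_wpM2r ?exprn_ge0//.
      rewrite expr2 (le_trans _ (ler_peMl _ c1))//; last exact: le_trans ler01 c1.
      by rewrite lerDr.
have bm := bEZ (_ : 0 <= B1%:R^-1) (bE_sum (fun j : 'I_B1 => bED (bj j (ltn_ord j)) (bg j (ltn_ord j)))).
have i0 : 0 <= B1%:R^-1 :> R by rewrite invr_ge0 ltW.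
apply: bE_le (bm i0) _ => //.
- exact: (past_measurable_fun (measurable_fnorm (remainder_measurable tT (@subset_refl _ _)))).
- by move=> w; exact: fnorm_ge0.
- move=> w; apply: le_trans (fnorm_batch_mean _ _) _.
  rewrite ler_wpM2l// ler_sum// => j _.
  by apply: le_trans (fnormD _ _) _; rewrite fnormN.
- rewrite sumr_const card_ord /bias_cst -/S3.
  set q := _ + _ * e ^+ 2; rewrite -[q *+ B1]mulr_natl mulrA mulVf ?gt_eqF// mul1r.
  by rewrite /q -mulrDl.
Qed.

Lemma v_err0_bound : (0 < T)%N -> bE P (fun w => fsq (v_err 0 w)) (init_cst L K).
Proof.
move=> T0; have B0_gt0 := su_B0 H; have B0p : 0 < B0%:R :> R by rewrite ltr0n.
have dr j : (j < B0)%N -> forall i, (i < K)%N -> drawn (0%N, i, j).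
  by move=> jB i iK; rewrite /= T0 iK jB.
have mU i : (i < K)%N -> mmxJ (below 0 i) (fun w => U 0 w i).
  by move=> iK; apply: (u_measurable H) => //; exact: ltnW.
have bj j : (j < B0)%N -> bE P (fun w => fsq (jp (U 0 w) 0%N j w)) ((4 * L ^+ 2) ^+ K).
  move=> jB; apply: bE_le (chain_moment H (dr j jB) mU (leqnn K)) _ => //.
  - apply: (@past_measurable_fun 1%N); apply: measurable_fsq.
    by apply: jp_past_measurable => //; [exact: dr|move=> i iK; exact: u_past_measurable].
  - by move=> w; exact: fsq_ge0.
  - by move=> w; exact: fsq_cast_le.
have i0 : 0 <= B0%:R^-1 :> R by rewrite invr_ge0 ltW.
have bm := bEZ i0 (bE_sum (fun j : 'I_B0 => bj j (ltn_ord j))).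
have q0 : 0 <= (4 * L ^+ 2) ^+ K by rewrite exprn_ge0// mulr_ge0 ?sqr_ge0.
apply: bE_le (bED (bEZ (ler0n _ 2) bm) (bE_cst P (mulr_ge0 (ler0n _ 2) q0))) _.
- apply: (@past_measurable_fun 1%N); apply: measurable_fsq; exact: v_err_measurable.
- by move=> w; exact: fsq_ge0.
- move=> w; apply: le_trans (fsqD_le2 _ _) _; rewrite fsqN lerD// ler_wpM2l//.
    exact: (fsq_mean (fun j => jp (U 0 w) 0%N j w) B0_gt0).
  set A := chain_prod (fun i => 'J (@f i) (U 0 w i)) K.
  apply: (@le_trans _ _ (opnorm A ^+ 2)); first exact: fsq_cast_le.
  apply: (@le_trans _ _ ((L ^+ K) ^+ 2)).
    rewrite ler_pXn2r ?nnegrE ?opnorm_ge0 ?exprn_ge0//.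
    by apply: chain_prod_bound => // i iK; exact: (su_jbound H).
  rewrite -exprM mulnC exprM lerXn2r ?nnegrE ?mulr_ge0 ?sqr_ge0//.
  by rewrite ler_peMl ?sqr_ge0// ler1n.
- rewrite sumr_const card_ord /init_cst; set q := (4 * L ^+ 2) ^+ K.
  by rewrite -[q *+ B0]mulr_natl (mulrA B0%:R^-1) mulVf ?gt_eqF// mul1r; lra.
Qed.

(** The increment adds [mart_cst L K * e ^+ 3], and [(1 - e) ^+ 2 + e <= 1] closes the induction as
    for the level errors. *)
Lemma mart_err_bound t : (t < T)%N ->
  bE P (fun w => fsq (mart_err t w)) ((1 - e) ^+ (2 * t) * init_cst L K + mart_cst L K * e ^+ 2).
Proof.
elim: t => [|t IH] tT.
  apply: bE_ler (v_err0_bound tT) _.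
  by rewrite muln0 expr0 mul1r lerDl mulr_ge0 ?sqr_ge0// mart_cst_ge0.
have tT' := ltnW tT.
have mV := mmxZ (1 - e) (mart_err_measurable tT' (@subset_refl _ (past t.+1))).
have bV : bE P (fun w => fsq ((1 - e) *: mart_err t w)) ((1 - e) ^+ 2
    * ((1 - e) ^+ (2 * t) * init_cst L K + mart_cst L K * e ^+ 2)).
  under eq_fun do rewrite (fsqZ _ (mart_err _ _)).
  by apply: bEZ; [exact: sqr_ge0|exact: IH].
apply: bE_ler (mart_incr_pyth H tT mV bV _) _.
- apply: (@past_measurable_fun t.+2); apply: measurable_fsq.
  exact: (mart_err_measurable tT (@subset_refl _ (past t.+2))).
- have -> : (1 - e) ^+ 2 * ((1 - e) ^+ (2 * t) * init_cst L K + mart_cst L K * e ^+ 2) =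
      (1 - e) ^+ (2 * t.+1) * init_cst L K + (1 - e) ^+ 2 * (mart_cst L K * e ^+ 2).
    by rewrite mulnS exprD; ring.
  rewrite -addrA lerD2l.
  have m0 : 0 <= mart_cst L K * e ^+ 2 by rewrite mulr_ge0 ?sqr_ge0// mart_cst_ge0.
  rewrite (_ : mart_cst L K * e ^+ 3 = e * (mart_cst L K * e ^+ 2)); last by ring.
  rewrite -mulrDl ler_piMl//.
  have : e * e <= e * 1 by rewrite ler_wpM2l.
  by rewrite sqrrB expr1n mul1r mulr1 -expr2; lra.
Qed.

(** The value [bias_cst L K * e] is the fixed point of the recursion: multiplying it by [1 - e] and
    adding the new remainder [bias_cst L K * e ^+ 2] gives it back. *)
Lemma bias_bound t : (t < T)%N ->
  bE P (fun w => fnorm (v_err t w - mart_err t w)) (bias_cst L K * e).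
Proof.
have m s : (s < T)%N -> measurable_fun [set: Om] (fun w => fnorm (v_err s w - mart_err s w)).
  move=> sT; apply: (@past_measurable_fun s.+1); apply: measurable_fnorm.
  by apply: mmxB; [exact: v_err_measurable|exact: mart_err_measurable].
elim: t => [|t IH] tT.
  apply: bE_le (bE_cst P (_ : 0 <= bias_cst L K * e)) _ => //.
  - exact: m.
  - by move=> w; exact: fnorm_ge0.
  - move=> w; rewrite /= (_ : v_err 0 w - v_err 0 w = 0) ?addrN//.
    by rewrite /fnorm fsq0 sqrtr0 mulr_ge0// bias_cst_ge0.
  - by rewrite mulr_ge0// bias_cst_ge0.
have tT' := ltnW tT.
case/andP: be => be0 _.
apply: bE_le (bED (bEZ be0 (IH tT')) (remainder_bound tT)) _.
- exact: m.
- by move=> w; exact: fnorm_ge0.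
- move=> w; rewrite v_errS; last exact: (su_B1 H).
  rewrite [mart_err t.+1 w]/=.
  have alg (a b c g : 'cV[R]_(d 0%N)) :
      (1 - e) *: a + c + g - ((1 - e) *: b + c) = (1 - e) *: (a - b) + g.
    by apply/colP => k; rewrite !mxE; ring.
  rewrite alg; apply: le_trans (fnormD _ _) _.
  by rewrite (fnormZ _ (_ - _)) ger0_norm.
- have := bias_cst_ge0 K L0; lra.
Qed.

Lemma v_err_bound t : (t < T)%N ->
  bE P (fun w => fnorm (v_err t w)) (grad_err_cst L K * ((1 - e) ^+ t + e)).
Proof.
move=> tT; set p := (1 - e) ^+ t; case/andP: be => be0 be1.
have p0 : 0 <= p by exact: exprn_ge0.
have i0 := init_cst_ge0 L K.
have m0 := mart_cst_ge0 L K; have b0 := bias_cst_ge0 K L0.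
set c := 1 + init_cst L K + mart_cst L K.
have c1 : 1 <= c by rewrite /c; lra.
have ep := su_e0 H.
have bM : bE P (fun w => fnorm (mart_err t w)) (c * (p + e)).
  apply: bE_sqrt.
  - apply: (@past_measurable_fun t.+1); apply: measurable_fnorm.
    exact: mart_err_measurable.
  - by move=> w; exact: fnorm_ge0.
  - by rewrite mulr_gt0 ?(lt_le_trans ltr01 c1)// ltr_wpDl.
  - under eq_fun do rewrite fnorm_sqr.
    apply: bE_ler (mart_err_bound tT) _; rewrite mulnC exprM -/p.
    have h1 : p ^+ 2 * init_cst L K <= p ^+ 2 * c by rewrite ler_wpM2l ?sqr_ge0// /c; lra.
    have h2 : mart_cst L K * e ^+ 2 <= c * e ^+ 2 by rewrite ler_wpM2r ?sqr_ge0// /c; lra.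
    have h3 : c * (p ^+ 2 + e ^+ 2) <= c ^+ 2 * (p + e) ^+ 2.
      have c0 := le_trans ler01 c1; apply: ler_pM => //.
      - by rewrite addr_ge0 ?sqr_ge0.
      - by rewrite expr2 ler_peMl.
      by have := mulr_ge0 p0 e0; lra.
    by rewrite exprMn; lra.
apply: bE_le (bED bM (bias_bound tT)) _.
- apply: (@past_measurable_fun t.+1); apply: measurable_fnorm; exact: v_err_measurable.
- by move=> w; exact: fnorm_ge0.
- move=> w; have alg (a b : 'cV[R]_(d 0%N)) : fnorm a <= fnorm b + fnorm (a - b).
    by rewrite -{1}(subrK b a) addrC fnormD.
  exact: alg.
- by rewrite /grad_err_cst -/c; have := mulr_ge0 b0 p0; lra.
Qed.

End gradient_error_bound.

(** * Frank-Wolfe descent *)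

Section jacobians.
Context {R : realType}.

Lemma enorm_continuous n : continuous (fun z : 'rV[R]_n => enorm z).
Proof.
have c : continuous (fun z : 'rV[R]_n => (enorm z)%:M : 'M[R]_1).
  apply: (@lipschitz_mx_continuous _ _ _ _ _ _ 1) => x y.
  rewrite mul1r -[leRHS]enormE /fsq !big_ord1 !mxE !mulr1n sqrtr_sqr.
  have h (a b : 'rV[R]_n) : enorm a - enorm b <= enorm (a - b).
    by rewrite lerBlDr -{1}(subrK b a) enormD.
  by rewrite ler_norml h andbT lerNl opprB (le_trans (h _ _))// enormBC.
move=> z.
have -> : (fun z : 'rV[R]_n => enorm z) = (fun M : 'M[R]_1 => M 0 0) \o
    (fun z : 'rV[R]_n => (enorm z)%:M : 'M[R]_1).
  by apply/funext => x /=; rewrite mxE mulr1n.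
by apply: continuous_comp; [exact: c|exact: coord_continuous].
Qed.

Lemma jacobianE m n (f : 'rV[R]_m -> 'rV[R]_n) x v : v *m 'J f x = 'd f x v.
Proof. by rewrite /jacobian mul_rV_lin1. Qed.

(** [v *m 'J f x] is a limit of difference quotients, all of which have norm at most [c * enorm v],
    a closed condition. *)
Lemma opnorm_jacobian m n (f : 'rV[R]_m -> 'rV[R]_n) x c : 0 <= c ->
  differentiable f x -> (forall x y, enorm (f x - f y) <= c * enorm (x - y)) ->
  opnorm ('J f x) <= c.
Proof.
move=> c0 df lip; apply: opnorm_le => // v; rewrite jacobianE -deriveE//.
have cv := @diff_derivable _ _ _ f x v df.
apply: (@closed_cvg _ _ (0 : R)^' _ (fun h : R => h^-1 *: ((f \o shift x) (h *: v) - f x))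
  (fun z : 'rV[R]_n => enorm z <= c * enorm v) _ _ _ cv).
- change (closed ((fun z : 'rV[R]_n => enorm z) @^-1` [set r | r <= c * enorm v])).
  by apply: preimage_closed; [move=> z _; exact: enorm_continuous|exact: closed_le].
- near=> h; rewrite /= enormZ.
  have h0 : h != 0 by near: h; exact: nbhs_dnbhs_neq.
  rewrite normfV mulrC ler_pdivrMr ?normr_gt0//.
  by rewrite (le_trans (lip _ _))// addrK enormZ -mulrA [enorm v * _]mulrC.
Unshelve. all: by end_near. Qed.

Context {d : nat -> nat}.
Variables (f : @level_maps R d) (K : nat).
Hypothesis df : forall i, (i < K)%N -> forall x, differentiable (@f i) x.

Lemma compose_diff n x : (n <= K)%N -> differentiable (compose f n) x /\
  forall v, 'd (compose f n) x v = v *m chain_prod (fun i => 'J (@f i) (compose f i x)) n.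
Proof.
elim: n => [|n IH] nK.
  have -> : compose f 0 = id by [].
  have [did eid] := is_diff_id x; split; first exact: did.
  by move=> v; rewrite eid mulmx1.
have [dn en] := IH (ltnW nK).
have -> : compose f n.+1 = @f n \o compose f n by [].
split; first by apply: differentiable_comp => //; exact: df.
move=> v; rewrite diff_comp//=; last exact: df.
by rewrite en -jacobianE mulmxA.
Qed.

Lemma jacobian_cast n (E : n = 1%N) (g : 'rV[R]_(d 0) -> 'rV[R]_n) x :
  'J (fun y => (castmx (erefl, E) (g y) 0 0)%:M : 'rV[R]_1) x = castmx (erefl, E) ('J g x).
Proof.
subst n; rewrite castmx_id; congr ('J _ x); apply/funext => y.
by apply/rowP => k; rewrite castmx_id ord1 mxE mulr1n.
Qed.

Lemma differentiable_cast n (E : n = 1%N) (g : 'rV[R]_(d 0) -> 'rV[R]_n) x :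
  differentiable g x -> differentiable (fun y => castmx (erefl, E) (g y) 0 0) x.
Proof.
subst n => dg; under eq_fun do rewrite castmx_id.
by apply: (@differentiable_comp _ _ _ _ g (fun M : 'rV[R]_1 => M 0 0)) => //; exact: differentiable_coord.
Qed.

Lemma grad_objective (dK : d K = 1%N) x :
  grad (objective dK f) x = jac_exact f dK (fun i => compose f i x).
Proof.
rewrite /grad /objective jacobian_cast /jac_exact; congr castmx.
have [_ e] := compose_diff x (leqnn K).
apply/row_matrixP => i; rewrite !rowE jacobianE; exact: e.
Qed.

Lemma objective_differentiable (dK : d K = 1%N) x : differentiable (objective dK f) x.
Proof. by apply: differentiable_cast; have [] := compose_diff x (leqnn K). Qed.

End jacobians.

Lemma inner_grad (R : realType) n (F : 'rV[R]_n -> R) x v :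
  differentiable F x -> 'd F x v = inner v (grad F x).
Proof.
move=> dF; rewrite /inner /grad jacobianE.
have -> : (fun y => (F y)%:M : 'rV[R]_1) = (fun y => F y *: (1%:M : 'rV[R]_1)).
  by apply/funext => y; rewrite scalemx1.
by rewrite diffZl// !mxE mulr1.
Qed.

(** The one-variable mean value theorem along the segment. Compared with integrating the gradient,
    it loses a factor 1/2 in the descent inequality and needs only differentiability. *)
Lemma mean_value_grad (R : realType) n (F : 'rV[R]_n -> R) x y :
  (forall z, differentiable F z) ->
  exists2 c : R, 0 <= c <= 1 & F y - F x = inner (y - x) (grad F (x + c *: (y - x))).
Proof.
move=> dF; set v := y - x.
pose l (s : R) := x + s *: v.
pose phi (s : R) : R := F (l s).
have dphi s : is_derive s (1 : R) phi (inner v (grad F (l s))).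
  have E : (fun h : R => h^-1 *: ((phi \o shift s) (h *: (1 : R)) - phi s)) =
      (fun h : R => h^-1 *: ((F \o shift (l s)) (h *: v) - F (l s))).
    apply/funext => h; rewrite /phi /l /=; congr (_ *: (F _ - _)).
    by rewrite [h *: 1]mulr1 scalerDl addrCA.
  have dv := @diff_derivable _ _ _ F (l s) v (dF _).
  apply: DeriveDef; first by rewrite /derivable E.
  by rewrite /derive E -/(derive F (l s) v) deriveE// inner_grad.
have cphi : {within `[0, 1], continuous phi}.
  apply: continuous_subspaceT => s; apply: differentiable_continuous.
  by apply/derivable1_diffP; have [] := dphi s.
have [c] := MVT ltr01 (fun s _ => dphi s) cphi.
rewrite in_itv/= => /andP[c0 c1]; rewrite subr0 mulr1 /= => e.
exists c; first by rewrite !ltW.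
move: e; rewrite /phi /l scale1r scale0r addr0 => <-.
by rewrite /v addrCA subrr addr0.
Qed.

Section inner_product.
Context {R : realType} {n : nat}.

Lemma innerBl (x y : 'rV[R]_n) g : inner (x - y) g = inner x g - inner y g.
Proof. by rewrite /inner mulmxBl !mxE. Qed.

Lemma innerDr (x : 'rV[R]_n) g h : inner x (g + h) = inner x g + inner x h.
Proof. by rewrite /inner mulmxDr mxE. Qed.

Lemma innerNr (x : 'rV[R]_n) g : inner x (- g) = - inner x g.
Proof. by rewrite /inner mulmxN mxE. Qed.

Lemma innerZl c (x : 'rV[R]_n) g : inner (c *: x) g = c * inner x g.
Proof. by rewrite /inner -scalemxAl mxE. Qed.

Lemma inner_le (x : 'rV[R]_n) (g : 'cV[R]_n) : inner x g <= enorm x * fnorm g.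
Proof. exact: le_trans (ler_norm _) (abs_inner_le _ _). Qed.

Lemma fw_gapE (X : set 'rV[R]_n) (F : 'rV[R]_n -> R) x z :
  X z -> (forall y, X y -> inner z (grad F x) <= inner y (grad F x)) ->
  fw_gap X F x = inner (x - z) (grad F x).
Proof.
move=> Xz zmin; have up : ubound [set inner (y - x) (- grad F x) | y in X]
    (inner (x - z) (grad F x)).
  move=> _ [y Xy <-]; rewrite innerNr !innerBl opprB lerD2l lerN2; exact: zmin.
apply/eqP; rewrite eq_le; apply/andP; split.
  by apply: ge_sup => //; exists (inner (z - x) (- grad F x)), z.
apply: ub_le_sup; first by exists (inner (x - z) (grad F x)).
by exists z => //; rewrite innerNr !innerBl opprB.
Qed.

Lemma sqrt_sum_sqr_le m (a : 'I_m -> R) c : 0 <= c -> (forall i, 0 <= a i) ->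
  Num.sqrt (c * \sum_i a i ^+ 2) <= (1 + c) * \sum_i a i.
Proof.
move=> c0 a0; have s0 : 0 <= \sum_i a i by exact: sumr_ge0.
have h : \sum_i a i ^+ 2 <= (\sum_i a i) ^+ 2.
  rewrite expr2 mulr_suml; apply: ler_sum => i _; rewrite expr2 ler_wpM2l//.
  by rewrite (bigD1 i)//= lerDl sumr_ge0.
rewrite -[leRHS]ger0_norm ?mulr_ge0 ?addr_ge0// -sqrtr_sqr ler_wsqrtr// exprMn.
apply: ler_pM => //; first by apply: sumr_ge0 => i _; exact: sqr_ge0.
by have := sqr_ge0 c; rewrite sqrrD expr1n mul1r; lra.
Qed.

End inner_product.

Lemma descent_alg (R : realFieldType) (s l a a' q r i1 i2 c : R) : 0 <= s ->
  i1 <= - q + l * r -> i2 <= l * (c * (s * l)) -> a' - a = s * (i1 + i2) ->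
  s * q <= a - a' + s * l * r + s ^+ 2 * (c * l ^+ 2).
Proof. by move=> s0 l1 l2 E; have := ler_wpM2l s0 (lerD l1 l2); lra. Qed.

(** The Frank-Wolfe gap with its supremum replaced by the minimiser that attains it; in this form it
    is measurable as a composite. *)
Definition lmo_gap (R : realType) n (lmo : 'cV[R]_n -> 'rV[R]_n) (F : 'rV[R]_n -> R) x : R :=
  inner (x - lmo (grad F x)) (grad F x).

Section frank_wolfe_constants.
Context {R : realType}.
Variables (L : R) (K : nat).

(** A Lipschitz constant of the gradient: [(L ^+ 2) ^+ i] is the squared Lipschitz constant of
    [compose f i], and adding 1 makes the bound on the square a bound on its root. *)
Definition smooth_cst : R := 1 + prod_cst L K * \sum_(i < K) (L ^+ 2) ^+ i.

(** [1 + prod_cst L K] stands for a square root, [K%:R * L ^+ K] for the propagation of the level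
    errors through [K] levels, and the summands are the constants of [level_err_L1]. *)
Definition track_cst : R :=
  (1 + prod_cst L K) * (K%:R * L ^+ K * \sum_(k < K) (1 + L ^+ 2 + err_cst L k)).

Definition dir_cst : R := grad_err_cst L K + track_cst.

Lemma smooth_cst_ge1 : 1 <= smooth_cst.
Proof.
rewrite lerDl; apply: mulr_ge0; first exact: prod_cst_ge0.
by apply: sumr_ge0 => i _; rewrite exprn_ge0// sqr_ge0.
Qed.

Lemma dir_cst_ge0 : 0 <= L -> 0 <= dir_cst.
Proof.
move=> L0; apply: addr_ge0; first exact: grad_err_cst_ge0.
apply: mulr_ge0; first by rewrite addr_ge0// prod_cst_ge0.
apply: mulr_ge0; first by rewrite mulr_ge0// exprn_ge0.
by apply: sumr_ge0 => k _; have := err_cst_ge0 L k; have := sqr_ge0 L; lra.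
Qed.

End frank_wolfe_constants.

Section frank_wolfe.
Context {R : realType} {K : nat} {d : nat -> nat} {dK : d K = 1%N}.
Context {X : set 'rV[R]_(d 0%N)} {f : @level_maps R d}.
Context {dS dO : measure_display} {S : measurableType dS} {Om : measurableType dO}.
Context {P : probability Om R} {o : @oracle R d dS S}.
Context {lmo : 'cV[R]_(d 0%N) -> 'rV[R]_(d 0%N)} {x1 : 'rV[R]_(d 0%N)}.
Context {T B0 B1 : nat} {xi : nat -> nat -> nat -> {RV P >-> S}} {tau : {RV P >-> nat}}.
Context {L e : R}.
Hypothesis H : pmvr_setup dK X f o lmo x1 T B0 B1 xi tau L e.

Local Notation G := (sample_systems xi tau).
Local Notation past := (past T K B0 B1).
Local Notation mmxJ A := (@mmx R _ (jointT G A) _ _).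
Local Notation run := (run dK o lmo x1 B0 B1 xi e).
Local Notation U := (run_u dK o lmo x1 B0 B1 xi e).
Local Notation level_err := (level_err dK o lmo x1 B0 B1 xi e f).
Local Notation gp y := (jac_exact f dK y).
Local Notation F := (objective dK f).
Local Notation gap := (lmo_gap lmo F).

Let L0 : 0 <= L. Proof. exact: le_trans ler01 (su_L H). Qed.
Let e0 : 0 <= e. Proof. exact: ltW (su_e0 H). Qed.
Let e1 := su_e1 H.
Let pc0 : 0 <= prod_cst L K. Proof. exact: prod_cst_ge0. Qed.

Lemma gradE x : grad F x = gp (fun i => compose f i x).
Proof. exact: (grad_objective (su_diff H)). Qed.

Lemma fnorm_gp_diff (y y' : forall i, 'rV[R]_(d i)) :
  fsq (gp y - gp y') <= prod_cst L K * \sum_(i < K) fsq (y i - y' i).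
Proof.
have b1 : 0 <= (1 : R) <= 1 by rewrite ler01 lexx.
have alg (a b : 'cV[R]_(d 0%N)) q s :
    fsq (a - 1 *: b) <= q * ((1 - 1) ^+ 2 + s) -> fsq (a - b) <= q * s.
  by rewrite scale1r subrr expr0n add0r.
exact: alg (gp_diff H y y' b1).
Qed.

Lemma compose_lip i x z : (i <= K)%N ->
  fsq (compose f i x - compose f i z) <= (L ^+ 2) ^+ i * fsq (x - z).
Proof.
elim: i => [|i IH] iK; first by rewrite expr0 mul1r.
apply: le_trans (su_lip H iK _ _) _; rewrite [_ ^+ i.+1]exprS -mulrA ler_wpM2l ?sqr_ge0//.
by apply: IH; exact: ltnW.
Qed.

Lemma grad_lip x z : fnorm (grad F x - grad F z) <= smooth_cst L K * enorm (x - z).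
Proof.
have s1 := smooth_cst_ge1 L K.
rewrite -[leRHS]ger0_norm ?mulr_ge0 ?enorm_ge0 ?(le_trans ler01 s1)//.
rewrite -sqrtr_sqr ler_wsqrtr// exprMn enorm_sqr !gradE.
apply: le_trans (fnorm_gp_diff _ _) _.
apply: (@le_trans _ _ (prod_cst L K * \sum_(i < K) ((L ^+ 2) ^+ i * fsq (x - z)))).
  by rewrite ler_wpM2l// ler_sum// => i _; apply: compose_lip; exact: ltnW.
rewrite -mulr_suml mulrA ler_wpM2r ?fsq_ge0//.
apply: (@le_trans _ _ (smooth_cst L K)); first by rewrite lerDr.
by rewrite expr2 ler_peMl// (le_trans ler01 s1).
Qed.

(** The error made at each level below [i] is amplified by the Lipschitz maps above it, at most
    [L ^+ i] times since [1 <= L]. *)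
Lemma track_le t w i : (i <= K)%N ->
  enorm (U t w i - compose f i (xt (run t w))) <= L ^+ i * \sum_(k < i) enorm (level_err t w k).
Proof.
elim: i => [|i IH] iK; first by rewrite u0E subrr enorm0 big_ord0 mulr0.
have -> : U t w i.+1 - compose f i.+1 (xt (run t w)) = level_err t w i
   + (@f i (U t w i) - @f i (compose f i (xt (run t w)))).
  by rewrite /(level_err _ _ _) addrA subrK.
apply: le_trans (enormD _ _) _.
have h : enorm (@f i (U t w i) - @f i (compose f i (xt (run t w)))) <=
    L * (L ^+ i * \sum_(k < i) enorm (level_err t w k)).
  apply: (@le_trans _ _ (L * enorm (U t w i - compose f i (xt (run t w))))).
    rewrite -[leRHS]ger0_norm ?mulr_ge0 ?enorm_ge0// -sqrtr_sqr enormE ler_wsqrtr//.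
    by rewrite exprMn enorm_sqr; exact: (su_lip H iK).
  by rewrite ler_wpM2l// IH// ltnW.
apply: le_trans (lerD (lexx _) h) _.
rewrite big_ord_recr/= mulrDr addrC mulrA -exprS lerD2l.
by rewrite ler_peMl ?enorm_ge0// exprn_ege1// (su_L H).
Qed.

Lemma track_grad_le t w : fnorm (gp (U t w) - grad F (xt (run t w))) <=
  (1 + prod_cst L K) * (K%:R * L ^+ K * \sum_(k < K) enorm (level_err t w k)).
Proof.
rewrite gradE.
set Z := \sum_(k < K) _; set y := fun i => compose f i _.
have Z0 : 0 <= Z by apply: sumr_ge0 => k _; exact: enorm_ge0.
apply: (@le_trans _ _ (Num.sqrt (prod_cst L K * \sum_(i < K) enorm (U t w i - y i) ^+ 2))).
  rewrite ler_wsqrtr//; apply: le_trans (fnorm_gp_diff _ _) _.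
  by rewrite ler_wpM2l// ler_sum// => i _; rewrite enorm_sqr.
apply: le_trans (sqrt_sum_sqr_le pc0 (fun i => enorm_ge0 _)) _.
rewrite ler_wpM2l ?addr_ge0//.
apply: (@le_trans _ _ (\sum_(i < K) L ^+ K * Z)); last first.
  by rewrite sumr_const card_ord -[leLHS]mulr_natl mulrA.
apply: ler_sum => i _; apply: le_trans (track_le t w (ltnW (ltn_ord i))) _.
apply: ler_pM; rewrite ?exprn_ge0//.
- by apply: sumr_ge0 => k _; exact: enorm_ge0.
- by apply: ler_weXn2l; [exact: su_L H|exact: ltnW].
- rewrite /Z -!(big_mkord xpredT (fun k => enorm (level_err t w k))).
  rewrite [leRHS](@big_cat_nat _ _ _ i)//=; last exact: ltnW.
  by rewrite lerDl sumr_ge0// => k _; exact: enorm_ge0.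
Qed.

Lemma level_err_L1 t i : (t < T)%N -> (i < K)%N ->
  bE P (fun w => enorm (level_err t w i)) ((1 + L ^+ 2 + err_cst L i) * ((1 - e) ^+ t + e)).
Proof.
move=> tT iK; set c := 1 + L ^+ 2 + err_cst L i; set p := (1 - e) ^+ t.
have k0 := err_cst_ge0 L i; have l0 := sqr_ge0 L.
have p0 : 0 <= p by rewrite exprn_ge0// subr_ge0.
have c1 : 1 <= c by rewrite /c; lra.
apply: bE_sqrt.
- apply: (past_measurable_fun H (t := t.+1)); apply: measurable_enorm.
  by apply: (level_err_measurable H) => //; exact: below_past.
- by move=> w; exact: enorm_ge0.
- by rewrite mulr_gt0 ?(lt_le_trans ltr01 c1)// ltr_wpDl// (su_e0 H).
- under eq_fun do rewrite enorm_sqr.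
  apply: bE_ler (level_err_bound H tT iK) _; rewrite mulnC exprM -/p.
  have h1 : p ^+ 2 * L ^+ 2 <= p ^+ 2 * c by rewrite ler_wpM2l ?sqr_ge0// /c; lra.
  have h2 : e ^+ 2 * err_cst L i <= e ^+ 2 * c by rewrite ler_wpM2l ?sqr_ge0// /c; lra.
  have h3 : c * (p ^+ 2 + e ^+ 2) <= c ^+ 2 * (p + e) ^+ 2.
    have c0 := le_trans ler01 c1; apply: ler_pM => //.
    - by rewrite addr_ge0 ?sqr_ge0.
    - by rewrite expr2 ler_peMl.
    - by have := mulr_ge0 p0 e0; lra.
  by rewrite exprMn; lra.
Qed.

Lemma x_past_measurable t A : (t < T)%N -> past t.+1 `<=` A ->
  mmxJ A (fun w => xt (run t w)).
Proof.
move=> tT sA; apply: (x_measurable H) => //.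
exact: subset_trans (@past_mono _ _ _ _ _ _ (leqnSn t)) sA.
Qed.

Lemma grad_measurable t A : (t < T)%N -> past t.+1 `<=` A ->
  mmxJ A (fun w => grad F (xt (run t w))).
Proof.
move=> tT sA; apply: (@mmx_continuous _ _ _ _ _ _ _ (grad F)); last exact: x_past_measurable.
by apply: lipschitz_mx_continuous => x z; rewrite -[Num.sqrt (fsq (x - z))]enormE; exact: grad_lip.
Qed.

Lemma dir_bound t : (t < T)%N ->
  bE P (fun w => fnorm (vt (run t w) - grad F (xt (run t w)))) (dir_cst L K * ((1 - e) ^+ t + e)).
Proof.
move=> tT.
have bt := bE_sum (fun k : 'I_K => level_err_L1 tT (ltn_ord k)).
have k0 : 0 <= K%:R * L ^+ K by rewrite mulr_ge0// exprn_ge0.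
have bt' := bEZ (_ : 0 <= 1 + prod_cst L K) (bEZ k0 bt).
apply: bE_le (bED (v_err_bound H tT) (bt' (addr_ge0 ler01 pc0))) _.
- apply: (past_measurable_fun H (t := t.+1)); apply: measurable_fnorm.
  by apply: mmxB; [exact: (v_measurable H)|exact: grad_measurable].
- by move=> w; exact: fnorm_ge0.
- move=> w; have alg (a b c : 'cV[R]_(d 0%N)) : fnorm (a - c) <= fnorm (a - b) + fnorm (b - c).
    have -> : a - c = (a - b) + (b - c) by rewrite addrA subrK.
    exact: fnormD.
  apply: le_trans (alg _ (gp (U t w)) _) _; rewrite lerD2l; exact: track_grad_le.
- by rewrite -mulr_suml /dir_cst /track_cst; lra.
Qed.

(** [inf] is a lower bound only for a set bounded below; this holds because [objective] is Lipschitz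
    and [X] is bounded. *)
Lemma objective_gap Delta : F x1 - inf [set F x | x in X] <= Delta ->
  forall y, X y -> F x1 - F y <= Delta.
Proof.
move=> hD y Xy; apply: le_trans hD; rewrite lerD2l lerN2.
apply: ge_inf; last by exists y.
exists (F x1 - L ^+ K * L) => _ [z Xz <-].
rewrite lerBlDr -lerBlDl.
apply: le_trans (ler_norm _) _.
rewrite -(ler_pXn2r (isT : (0 < 2)%N)) ?nnegrE ?mulr_ge0 ?exprn_ge0// real_normK ?num_real//.
rewrite /objective !castmxE/= exprMn.
set a := cast_ord _ _; set b := cast_ord _ _.
have := fsq_le_entry (compose f K x1 - compose f K z) a b.
rewrite 2!mxE => h; apply: le_trans h _.
apply: le_trans (compose_lip x1 z (leqnn K)) _.
rewrite -exprM mulnC exprM ler_wpM2l ?exprn_ge0 ?sqr_ge0//.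
exact: (su_diam H) (su_x1 H) Xz.
Qed.

Hypothesis lmo_min : forall v x, X x -> inner (lmo v) v <= inner x v.

Lemma gapE x : fw_gap X F x = gap x.
Proof. by apply: fw_gapE => [|y Xy]; [exact: (su_lmoX H)|exact: lmo_min]. Qed.

Lemma gap_ge0 x : X x -> 0 <= gap x.
Proof. by move=> Xx; rewrite /lmo_gap innerBl subr_ge0; exact: lmo_min. Qed.

Lemma diam_enorm x y : X x -> X y -> enorm (x - y) <= L.
Proof.
move=> Xx Xy; rewrite -(ger0_norm L0) -sqrtr_sqr enormE ler_wsqrtr//.
exact: (su_diam H).
Qed.

Lemma descent t w : e * gap (xt (run t w)) <=
  F (xt (run t w)) - F (xt (run t.+1 w))
  + e * L * fnorm (vt (run t w) - grad F (xt (run t w)))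
  + e ^+ 2 * (smooth_cst L K * L ^+ 2).
Proof.
set x := xt (run t w); set v := vt (run t w); set g := grad F x.
set z := lmo v; set y := lmo g.
have xE : xt (run t.+1 w) = x + e *: (z - x) by [].
have Xx : X x by exact: (x_in H).
have Xz : X z by exact: (su_lmoX H).
have Xy : X y by exact: (su_lmoX H).
have [c /andP[c0 c1] FE] := mean_value_grad x (xt (run t.+1 w))
  (objective_differentiable (su_diff H) dK).
set x' := xt (run t.+1 w) in FE *.
have dx : x' - x = e *: (z - x) by rewrite /x' xE addrAC subrr add0r.
rewrite dx in FE.
have nzx : enorm (z - x) <= L by exact: diam_enorm.
have nyz : enorm (y - z) <= L by exact: diam_enorm.
set g' := grad F _ in FE.
have s0 := le_trans ler01 (smooth_cst_ge1 L K).
have h1 : inner (z - x) (g' - g) <= L * (smooth_cst L K * (e * L)).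
  apply: le_trans (inner_le _ _) _; apply: ler_pM; rewrite ?enorm_ge0 ?fnorm_ge0//.
  apply: le_trans (grad_lip _ _) _; rewrite ler_wpM2l//.
  rewrite addrAC subrr add0r enormZ ger0_norm// enormZ ger0_norm// mulrA.
  by apply: ler_pM; rewrite ?mulr_ge0 ?enorm_ge0// ler_piMl.
have h2 : inner (z - x) g <= - gap x + L * fnorm (v - g).
  (* The last difference is nonpositive since [z] minimises against [v]; the middle term is the
     price of having used [v] in place of [g]. *)
  have -> : inner (z - x) g = - gap x + (inner (y - z) (v - g) + (inner z v - inner y v)).
    by rewrite /lmo_gap -/g -/y !innerBl !innerDr !innerNr; ring.
  rewrite lerD2l; apply: (@le_trans _ _ (enorm (y - z) * fnorm (v - g) + 0)).
    by apply: lerD; [exact: inner_le|rewrite subr_le0; exact: lmo_min].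
  by rewrite addr0 ler_wpM2r ?fnorm_ge0.
have FE' : F x' - F x = e * (inner (z - x) g + inner (z - x) (g' - g)).
  rewrite FE innerZl -innerDr; congr (_ * inner _ _).
  have alg (a b : 'cV[R]_(d 0%N)) : a = b + (a - b) by rewrite addrCA subrr addr0.
  exact: alg.
exact: descent_alg e0 h2 h1 FE'.
Qed.

End frank_wolfe.

(** * Averaging over the iterations and the random index *)

Section random_iterate.
Context {R : realType} {K : nat} {d : nat -> nat} {dK : d K = 1%N}.
Context {X : set 'rV[R]_(d 0%N)} {f : @level_maps R d}.
Context {dS dO : measure_display} {S : measurableType dS} {Om : measurableType dO}.
Context {P : probability Om R} {o : @oracle R d dS S}.
Context {lmo : 'cV[R]_(d 0%N) -> 'rV[R]_(d 0%N)} {x1 : 'rV[R]_(d 0%N)}.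
Context {T B0 B1 : nat} {xi : nat -> nat -> nat -> {RV P >-> S}} {tau : {RV P >-> nat}}.
Context {L e : R}.
Hypothesis H : pmvr_setup dK X f o lmo x1 T B0 B1 xi tau L e.

Local Notation G := (sample_systems xi tau).
Local Notation past := (past T K B0 B1).
Local Notation mmxJ A := (@mmx R _ (jointT G A) _ _).
Local Notation run := (run dK o lmo x1 B0 B1 xi e).
Local Notation F := (objective dK f).
Local Notation gap := (lmo_gap lmo F).

Hypothesis lmo_min : forall v x, X x -> inner (lmo v) v <= inner x v.
Variable Delta : R.
Hypothesis Delta_ge0 : 0 <= Delta.
Hypothesis F_gap : forall y, X y -> F x1 - F y <= Delta.
Hypothesis T_large : 1 <= e ^+ 2 * T%:R.
Hypothesis tau_unif : forall t, (t < T)%N -> P (tau @^-1` [set t]) = (T%:R^-1)%:E.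

Let L0 : 0 <= L. Proof. exact: le_trans ler01 (su_L H). Qed.
Let e0 : 0 <= e. Proof. exact: ltW (su_e0 H). Qed.
Let ep := su_e0 H.
Let e1 := su_e1 H.

Let Tp : 0 < T%:R :> R.
Proof.
rewrite ltr0n lt0n; apply/negP => /eqP T0.
by move: T_large; rewrite T0 mulr0 ler10.
Qed.

Let sm0 : 0 <= smooth_cst L K * L ^+ 2.
Proof. by rewrite mulr_ge0 ?sqr_ge0// (le_trans ler01 (smooth_cst_ge1 L K)). Qed.

Let dir0 : 0 <= dir_cst L K.
Proof. exact: dir_cst_ge0. Qed.

Lemma gap_measurable t A : (t < T)%N -> past t.+1 `<=` A ->
  measurable_fun [set: jointT G A] (fun w => gap (xt (run t w))).
Proof.
move=> tT sA.
have mg := grad_measurable H tT sA.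
have mx := x_past_measurable H tT sA.
have ml : mmxJ A (fun w => lmo (grad F (xt (run t w)))).
  by move=> i k; rewrite ord1; exact: (measurableT_comp (su_lmo_meas H k) (mmx_borel mg)).
exact: (mmxM (mmxB mx ml) mg 0 0).
Qed.

Lemma gap_sum_le n w : e * \sum_(t < n) gap (xt (run t w)) <=
  F x1 - F (xt (run n w))
  + e * L * \sum_(t < n) fnorm (vt (run t w) - grad F (xt (run t w)))
  + n%:R * (e ^+ 2 * (smooth_cst L K * L ^+ 2)).
Proof.
elim: n => [|n IH].
  by rewrite !big_ord0 !mulr0 mul0r !addr0 subrr.
rewrite !big_ord_recr/=.
have := descent H lmo_min n w.
have alg (q Q a a' b r s c : R) : q <= a' - b + s * r + c ->
    e * Q <= F x1 - a' + s * \sum_(t < n) fnorm (vt (run t w) - grad F (xt (run t w))) + n%:R * c ->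
    e * Q + q <= F x1 - b + s * (\sum_(t < n) fnorm (vt (run t w) - grad F (xt (run t w))) + r)
      + n.+1%:R * c.
  by move=> h1 h2; rewrite -natr1; lra.
by move=> h; rewrite mulrDr; exact: alg h IH.
Qed.

Let geometric_sum : \sum_(t < T) (1 - e) ^+ t <= e^-1.
Proof.
rewrite -[leRHS]mul1r ler_pdivlMr//.
have : (1 - (1 - e)) * \sum_(t < T) (1 - e) ^+ t = 1 - (1 - e) ^+ T.
  by rewrite -[RHS]opprB subrX1 -mulNr; congr (_ * _); ring.
rewrite opprB addrC subrK => E.
by rewrite mulrC E lerBlDr lerDl exprn_ge0// subr_ge0.
Qed.

(** [T_large] turns each [1/e] into at most [T%:R * e]: the one in front of [Delta] after
    telescoping, and the one bounding the geometric sum of the initial errors. The latter joins the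
    stationary [T%:R * e], hence the factor 2 of [dir_cst]. *)
Lemma gap_sum_bound : bE P (fun w => \sum_(t < T) gap (xt (run t w)))
  (T%:R * ((Delta + 2 * L * dir_cst L K + smooth_cst L K * L ^+ 2) * e)).
Proof.
have bd := bEZ L0 (bE_sum (fun t : 'I_T => dir_bound H (ltn_ord t))).
have c0 : 0 <= e^-1 * Delta + T%:R * (e * (smooth_cst L K * L ^+ 2)).
  by apply: addr_ge0; apply: mulr_ge0 => //; [rewrite invr_ge0|apply: mulr_ge0].
apply: bE_le (bED bd (bE_cst P c0)) _.
- apply: measurable_sum => t; apply: (past_measurable_fun H (t := t.+1)).
  exact: gap_measurable.
- move=> w; apply: sumr_ge0 => t _; apply: (gap_ge0 lmo_min); exact: (x_in H).
- move=> w; have := gap_sum_le T w; have := F_gap (x_in H T w).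
  set a := \sum_(t < T) gap _; set b := \sum_(t < T) fnorm _; set c := smooth_cst L K * L ^+ 2.
  have alg (A B C Fx Fy : R) : Fx - Fy <= Delta ->
      e * A <= Fx - Fy + e * L * B + T%:R * (e ^+ 2 * C) ->
      A <= L * B + (e^-1 * Delta + T%:R * (e * C)).
    move=> h1 h2; rewrite -(ler_pM2l ep).
    have -> : e * (L * B + (e^-1 * Delta + T%:R * (e * C))) =
        Delta + e * L * B + T%:R * (e ^+ 2 * C) by field; rewrite gt_eqF.
    lra.
  exact: alg.
- have E : \sum_(t < T) dir_cst L K * ((1 - e) ^+ t + e) <= dir_cst L K * (e^-1 + T%:R * e).
    rewrite -mulr_sumr ler_wpM2l// big_split/= sumr_const card_ord -[e *+ T]mulr_natl.
    by rewrite lerD2r.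
  have einv : e^-1 <= T%:R * e.
    by rewrite -[e^-1]mul1r ler_pdivrMr// -mulrA -expr2 mulrC.
  have h1 : L * \sum_(t < T) dir_cst L K * ((1 - e) ^+ t + e) <=
      L * (dir_cst L K * (2 * (T%:R * e))).
    rewrite ler_wpM2l//; apply: le_trans E _; rewrite ler_wpM2l//; lra.
  have h2 : e^-1 * Delta <= T%:R * e * Delta by rewrite ler_wpM2r.
  by move: (L * \sum_(_ < T) _) h1 => q h1; lra.
Qed.

Let gapt t w := gap (xt (run t w)).

Let gapt_ge0 t w : 0 <= gapt t w.
Proof. by apply: (gap_ge0 lmo_min); exact: (x_in H). Qed.

Let tau_set t : measurable (tau @^-1` [set t]).
Proof. by rewrite -[X in measurable X]setTI; exact: measurable_funPT. Qed.

Lemma tau_integral t : (t < T)%N -> hasE P (\1_(tau @^-1` [set t])) T%:R^-1.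
Proof.
move=> tT; split; last first.
  by rewrite integral_indic// setIT; exact: tau_unif.
by apply: integrable_indic => //; rewrite ltey_eq fin_num_measure.
Qed.

(** Freezing with [None] as the fresh index: [tau] is independent of all the samples on which the
    gap at iteration [t] depends. *)
Lemma tau_gap_bound t m : (t < T)%N -> bE P (gapt t) m ->
  bE P (fun w => \1_(tau @^-1` [set t]) w * gapt t w) (T%:R^-1 * m).
Proof.
move=> tT bg.
apply: (bE_freeze (su_indep H) (A := past t.+1) (B := [set None])
  (h := fun w w' => \1_(tau @^-1` [set t]) w' * gapt t w) (c := fun w => T%:R^-1 * gapt t w)).
- exact: indices_dom.
- by move=> k ->.
- by move=> [x|] [].
- apply: measurable_funM; last first.
    exact: (measurableT_comp (gap_measurable tT (@subset_refl _ _)) measurable_fst).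
  apply: (measurableT_comp (f := \1_(tau @^-1` [set t]) : jointT G [set None] -> R)); last exact: measurable_snd.
  apply: measurable_indic; apply: sub_sigma_algebra.
  by exists None => //; exists [set t] => //; rewrite setTI.
- by move=> w w'; rewrite mulr_ge0.
- move=> w; have [] := hasEZ (gapt t w) (tau_integral tT).
  move=> _; under eq_integral do rewrite mulrC.
  by move=> ->; rewrite mulrC.
- by apply: bEZ => //; rewrite invr_ge0.
Qed.

Let tau_in w : R := \sum_(t < T) \1_(tau @^-1` [set (t : nat)]) w.

Let tau_inE w : tau_in w = (tau w < T)%N%:R.
Proof.
rewrite /tau_in; case: ltnP => tT.
  rewrite (bigD1 (Ordinal tT))//= big1 ?addr0 ?indicE ?mem_set//.
  move=> j jt; rewrite indicE memNset//= => E.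
  by move/eqP: jt; apply; apply/val_inj.
rewrite big1// => j _; rewrite indicE memNset//= => E.
by move: tT; rewrite E leqNgt ltn_ord.
Qed.

(** The [T] probabilities add up to 1, so the event [T <= tau], where the run would go on with
    samples under no hypothesis, is null. *)
Let tau_out : bE P (fun w => 1 - tau_in w) 0.
Proof.
apply: (@hasE_bE _ _ _ _ _ 0) => //.
  by move=> w; rewrite tau_inE; case: ltnP => _; rewrite ?subrr// subr0.
have := hasED (hasE_cst P 1) (hasEZ (-1) (hasE_sum (fun t : 'I_T => tau_integral (ltn_ord t)))).
rewrite sumr_const card_ord -[_ *+ T]mulr_natl mulfV ?gt_eqF// mulN1r subrr.
by under eq_fun do rewrite mulN1r.
Qed.

(** The integral of a nonnegative function is a supremum over simple functions below it, so
    monotonicity holds without measurability. This spares the measurability of the gap at the random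
    index. *)
Let integral_mono (h1 h2 : Om -> R) : (forall w, 0 <= h1 w) -> (forall w, h1 w <= h2 w) ->
  (\int[P]_w (h1 w)%:E <= \int[P]_w (h2 w)%:E)%E.
Proof.
move=> h10 h12; have h20 w : 0 <= h2 w by exact: le_trans (h10 w) (h12 w).
rewrite !ge0_integralTE; try by move=> w; rewrite lee_fin.
apply: ereal_sup_le => _ [g gh <-]; exists g => // w.
by apply: le_trans (gh w) _; rewrite lee_fin.
Qed.

(** A uniform bound on [X], to be multiplied by the null event that [tau] lies outside the range. *)
Lemma gap_le x : X x -> gap x <= L * L ^+ K.
Proof.
move=> Xx; apply: le_trans (inner_le _ _) _.
apply: ler_pM; rewrite ?enorm_ge0 ?fnorm_ge0//.
  by apply: (diam_enorm H) => //; exact: (su_lmoX H).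
rewrite (gradE H); set A := chain_prod (fun i => 'J (@f i) (compose f i x)) K.
apply: (@le_trans _ _ (opnorm A)).
  rewrite -(ger0_norm (opnorm_ge0 _)) -sqrtr_sqr ler_wsqrtr//; exact: fsq_cast_le.
by apply: chain_prod_bound => // i iK; exact: (su_jbound H).
Qed.

Lemma expected_gap_bound :
  ('E_P[fun w => fw_gap X F (xt (run (tau w) w))]
     <= ((Delta + 2 * L * dir_cst L K + smooth_cst L K * L ^+ 2) * e)%:E)%E.
Proof.
set r := (_ + _) * e.
have bs := gap_sum_bound.
(* Only the sum of the gaps has a useful bound, so the exact mean [m t] of each is carried; the
   bound [T%:R * r] on a single gap serves for integrability. *)
have bt (t : 'I_T) : exists m, hasE P (gapt t) m /\ bE P (gapt t) m.
  have b : bE P (gapt t) (T%:R * r).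
    apply: bE_le bs _ => //.
    - apply: (past_measurable_fun H (t := t.+1)); exact: gap_measurable.
    - move=> w; rewrite (bigD1 t)//= lerDl; apply: sumr_ge0 => j _; exact: gapt_ge0.
  have [m hm _] := bE_hasE b; exists m; split=> //.
  exact: hasE_bE hm (lexx m).
have [m hbm] := choice bt.
have bm (t : 'I_T) : bE P (gapt t) (m t) by have [] := hbm t.
have sm : \sum_t m t <= T%:R * r.
  have [_ es] := hasE_sum (fun t => (hbm t).1); have [_ _ le] := bs.
  by rewrite -lee_fin -es.
have b1 := bE_sum (fun t : 'I_T => tau_gap_bound (ltn_ord t) (bm t)).
have c0 : 0 <= L * L ^+ K by rewrite mulr_ge0// exprn_ge0.
have [_ _ le] := bED b1 (bEZ c0 tau_out).
rewrite unlock; apply: le_trans (le_trans (integral_mono _ _) le) _.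
- by move=> w; rewrite (gapE H lmo_min); exact: gapt_ge0.
- move=> w; rewrite (gapE H lmo_min) tau_inE; case: ltnP => tT.
    rewrite subrr mulr0 addr0 (bigD1 (Ordinal tT))//= indicE mem_set// mul1r lerDl.
    by apply: sumr_ge0 => t _; rewrite mulr_ge0.
  rewrite subr0 mulr1 (le_trans (gap_le (x_in H (tau w) w)))// lerDr.
  by apply: sumr_ge0 => t _; rewrite mulr_ge0.
- rewrite lee_fin mulr0 addr0 -mulr_sumr -[leRHS](mulKf (x := T%:R)) ?gt_eqF//.
  by rewrite ler_wpM2l// invr_ge0.
Qed.

End random_iterate.

(** * Choice of the parameters *)

Section parameters.
Context {R : realType}.
Variable C : R.
Hypothesis C1 : 1 <= C.

(** Dividing by [C] absorbs the constant in front of [e]; the minimum keeps the step at most 1 when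
    [eps] is large. *)
Definition step_size (eps : R) : R := Num.min 1 eps / C.

Let C0 : 0 < C. Proof. exact: lt_le_trans ltr01 C1. Qed.

Lemma step_size_gt0 eps : 0 < eps -> 0 < step_size eps.
Proof. by move=> e0; rewrite divr_gt0// lt_min ltr01. Qed.

Lemma step_size_le1 eps : step_size eps <= 1.
Proof. by rewrite ler_pdivrMr// mul1r (le_trans _ C1)// ge_min lexx. Qed.

Lemma step_size_le eps : C * step_size eps <= eps.
Proof. by rewrite mulrC divfK ?gt_eqF// ge_min lexx orbT. Qed.

Lemma near0E (Q : R -> Prop) : (forall eps, 0 < eps < 1 -> Q eps) -> \forall x \near 0^'+, Q x.
Proof.
move=> h; near=> x; apply: h; apply/andP; split; first by near: x; exact: nbhs_right_gt.
by near: x; exact: nbhs_right_lt.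
Unshelve. all: by end_near.
Qed.

Lemma step_sizeE eps : eps < 1 -> step_size eps = eps / C.
Proof. by move=> e1; rewrite /step_size minElt ltNge ltW. Qed.

Lemma step_size_bigO : step_size =O_ (0^'+) (fun eps : R => eps).
Proof.
apply/eqO_exP; exists C^-1; first by rewrite invr_gt0.
apply: near0E => eps /andP[e0 e1].
by rewrite step_sizeE// normrM mulrC (@gtr0_norm _ C^-1) ?invr_gt0.
Qed.

(** Used with [n = 1] for the batch size and [n = 2] for the number of iterations. [C ^+ n] comes
    from the scaling, and the extra 1 from rounding up, since [1 <= eps ^- n] for [eps < 1]. *)
Lemma inv_step_bigO n :
  (fun eps : R => (Num.truncn ((step_size eps) ^- n)).+1%:R : R) =O_ (0^'+)
  (fun eps : R => eps ^- n).
Proof.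
apply/eqO_exP; exists (C ^+ n + 1); first by rewrite ltr_wpDl// exprn_ge0 ?ltW.
apply: near0E => eps /andP[e0 e1].
rewrite !ger0_norm ?invr_ge0 ?exprn_ge0 ?(ltW e0)// step_sizeE//.
have h1 : 1 <= eps ^- n by rewrite invf_ge1 ?exprn_gt0// exprn_ile1// ltW.
rewrite -natr1 mulrDl mul1r lerD// -exprVn invf_div exprMn exprVn.
by rewrite truncn_le mulr_ge0 ?exprn_ge0 ?(ltW C0)// (le_trans ler01 h1).
Qed.

End parameters.

(** * From the assumptions to the setting with common constants *)

Lemma RV_independent_systems (R : realType) (dS dO : measure_display) (S : measurableType dS)
    (Om : measurableType dO) (P : probability Om R) (D : set (option (nat * nat * nat)))
    (xi : nat -> nat -> nat -> {RV P >-> S}) (tau : {RV P >-> nat}) :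
  mutually_independent P D (sample_systems xi tau) ->
  independent_systems P D (sample_systems xi tau).
Proof.
have pre dT (T : measurableType dT) (s : {RV P >-> T}) :
    [/\ preimage_set_system setT s measurable `<=` measurable,
        setI_closed (preimage_set_system setT s measurable) &
        preimage_set_system setT s measurable setT].
  split.
  - move=> _ [A mA <-]; exact: measurable_funP.
  - move=> _ _ [A mA <-] [B mB <-]; exists (A `&` B); first exact: measurableI.
    by rewrite !setTI preimage_setI.
  - by exists setT => //; rewrite preimage_setT setTI.
move=> ind; split => // -[[[t i] j]|] /=.
- by move=> _; have [] := pre _ _ (xi t i j).
- by move=> _; have [] := pre _ _ tau.
- by have [] := pre _ _ (xi t i j).
- by have [] := pre _ _ tau.
- by have [] := pre _ _ (xi t i j).
- by have [] := pre _ _ tau.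
Qed.

Lemma convex_step (R : realType) n (X : set 'rV[R]_n) e : @convex_set R 'rV[R]_n X ->
  0 <= e -> e <= 1 -> forall x y, X x -> X y -> X (x + e *: (y - x)).
Proof.
move=> cX e0 e1 x y Xx Xy.
have := cX y x (Itv01 e0 e1) (mem_set Xy) (mem_set Xx); rewrite inE.
congr (X _); by rewrite /conv/= /unstable.onem scalerBl scale1r scalerBr addrCA.
Qed.

Lemma bE_sqr_enorm (R : realType) (dO : measure_display) (Om : measurableType dO)
    (P : probability Om R) n (Z : Om -> 'rV[R]_n) c r : mmx Z ->
  ('E_P[fun w => (enorm (Z w) ^+ 2)%R] <= c%:E)%E -> c <= r -> bE P (fun w => fsq (Z w)) r.
Proof.
move=> mZ h cr; apply: bE_ler cr; split; [exact: measurable_fsq|by move=> w; exact: fsq_ge0|].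
by move: h; rewrite unlock; under eq_integral do rewrite enorm_sqr.
Qed.

Lemma bE_sqr_opnorm (R : realType) (dO : measure_display) (Om : measurableType dO)
    (P : probability Om R) m n (Z : Om -> 'M[R]_(m, n)) c r : mmx Z ->
  ('E_P[fun w => (opnorm (Z w) ^+ 2)%R] <= c%:E)%E -> c <= r ->
  bE P (fun w => opnorm (Z w) ^+ 2) r.
Proof.
move=> mZ h cr; apply: bE_ler cr; split; last by move: h; rewrite unlock.
  by apply: measurable_funX; exact: measurable_opnorm.
by move=> w; exact: sqr_ge0.
Qed.

(** An equation on ['E_P] alone does not give integrability, which [has_mean] includes; the variance
    bound supplies it. *)
Lemma has_mean_centered (R : realType) (dO : measure_display) (Om : measurableType dO)
    (P : probability Om R) m n (Z : Om -> 'M[R]_(m, n)) (M : 'M[R]_(m, n)) r : mmx Z ->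
  bE P (fun w => fsq (Z w - M)) r ->
  (forall i j, ('E_P[fun w => Z w i j] = (M i j)%:E)%E) -> has_mean P Z M.
Proof.
move=> mZ b h; apply: (has_mean_L2 mZ _ h (r := 2 * r + 2 * fsq M)).
apply: bE_le (bED (bEZ (ler0n _ 2) b) (bE_cst P (mulr_ge0 (ler0n _ 2) (fsq_ge0 M)))) _ => //.
- exact: measurable_fsq.
- by move=> w; exact: fsq_ge0.
- by move=> w; rewrite -{1}[Z w](subrK M); exact: fsqD_le2.
Qed.

Lemma enorm_lip_fsq (R : realType) m n (x : 'rV[R]_m) (y : 'rV[R]_n) c r : 0 <= c -> c <= r ->
  enorm x <= c * enorm y -> fsq x <= r ^+ 2 * fsq y.
Proof.
move=> c0 cr h; rewrite -!enorm_sqr -exprMn ler_pXn2r// ?nnegrE ?mulr_ge0 ?enorm_ge0//.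
  by apply: le_trans h _; rewrite ler_wpM2r ?enorm_ge0.
exact: le_trans cr.
Qed.

(** All constants are dominated by [L]. The bound on the exact Jacobians is not assumed but derived
    from the Lipschitz continuity of the levels. *)
Lemma assumptions_setup (R : realType) (K : nat) (d : nat -> nat) (dK : d K = 1%N)
    (X : set 'rV[R]_(d 0%N)) (f : @level_maps R d)
    (dS dO : measure_display) (S : measurableType dS)
    (Om : measurableType dO) (P : probability Om R)
    (o : @oracle R d dS S) (lmo : 'cV[R]_(d 0%N) -> 'rV[R]_(d 0%N))
    (x1 : 'rV[R]_(d 0%N)) (T B0 B1 : nat)
    (xi : nat -> nat -> nat -> {RV P >-> S}) (tau : {RV P >-> nat})
    (Lf LJ cLf cLJ sigma sigmaJ D L e : R) :
  1 <= L -> 0 < e -> e <= 1 -> (0 < B0)%N -> (0 < B1)%N -> B1%:R^-1 <= e ->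
  0 <= Lf <= L -> 0 <= LJ <= L -> 0 <= cLf <= L -> 0 <= cLJ <= L ->
  0 <= sigma <= L -> 0 <= sigmaJ <= L -> 0 <= D <= L ->
  is_lmo X lmo -> pmvr_randomness T K B0 B1 xi tau -> assumption1 X D ->
  assumption2 K f Lf LJ ->
  (forall t i j, drawn T K B0 B1 (t, i, j) ->
     assumption3 f o sigma sigmaJ i (xi t i j) /\ assumption4 o cLf cLJ i (xi t i j)) ->
  X x1 -> pmvr_setup dK X f o lmo x1 T B0 B1 xi tau L e.
Proof.
move=> L1 e0 e1 B0p B1p B1e /andP[Lf0 LfL] /andP[LJ0 LJL] /andP[cLf0 cLfL] /andP[cLJ0 cLJL].
move=> /andP[s0 sL] /andP[sJ0 sJL] /andP[D0 DL] [lmoX lmo_meas] [_ ind] [_ cX dX] A2 A34 Xx1.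
have L0 : 0 <= L := le_trans ler01 L1.
have sqr_le (a : R) : 0 <= a -> a <= L -> a ^+ 2 <= L ^+ 2.
  by move=> a0 aL; rewrite ler_pXn2r// ?nnegrE.
have mo t i j x : mmx (fun w => oval o (x : 'rV[R]_(d i)) (xi t i j w)).
  by apply: mmx_oval; [exact: mmx_cst|exact: measurable_funPT].
have mj t i j x : mmx (fun w => ojac o (x : 'rV[R]_(d i)) (xi t i j w)).
  by apply: mmx_ojac; [exact: mmx_cst|exact: measurable_funPT].
have var t i j : drawn T K B0 B1 (t, i, j) -> forall x : 'rV[R]_(d i),
    bE P (fun w => fsq (oval o x (xi t i j w) - @f i x)) (L ^+ 2).
  move=> /A34[A3 _] x; have [_ _ h _] := A3 x.
  by apply: bE_sqr_enorm h (sqr_le _ s0 sL); apply: mmxB => //; exact: mmx_cst.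
have jvar t i j : drawn T K B0 B1 (t, i, j) -> forall x : 'rV[R]_(d i),
    bE P (fun w => opnorm (ojac o x (xi t i j w) - 'J (@f i) x) ^+ 2) (L ^+ 2).
  move=> /A34[A3 _] x; have [_ _ _ h] := A3 x.
  by apply: bE_sqr_opnorm h (sqr_le _ sJ0 sJL); apply: mmxB => //; exact: mmx_cst.
split => //.
- exact: RV_independent_systems.
- by move=> v; have [] := lmoX v.
- by apply: convex_step => //; exact: ltW.
- move=> x y Xx Xy; rewrite -enorm_sqr ler_pXn2r// ?nnegrE ?enorm_ge0//.
  exact: le_trans (dX _ _ Xx Xy) DL.
- by move=> i iK; have [_ + _] := A2 i iK.
- move=> i iK x y; have [h _ _] := A2 i iK.
  exact: enorm_lip_fsq Lf0 LfL (h x y).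
- move=> i iK x; have [h df _] := A2 i iK.
  apply: opnorm_jacobian => // y z; apply: le_trans (h y z) _.
  by rewrite ler_wpM2r ?enorm_ge0.
- move=> i iK x y; have [_ _ h] := A2 i iK.
  rewrite -enorm_sqr -exprMn ler_pXn2r// ?nnegrE ?opnorm_ge0 ?mulr_ge0 ?enorm_ge0//.
  by apply: le_trans (h x y) _; rewrite ler_wpM2r ?enorm_ge0.
- move=> t i j dr x; have [A3 _] := A34 _ _ _ dr; have [h _ _ _] := A3 x.
  by apply: has_mean_centered (var _ _ _ dr x) _ => // k l; rewrite ord1; exact: h.
- move=> t i j dr x; have [A3 _] := A34 _ _ _ dr; have [_ h _ _] := A3 x.
  (* The dimension enters a bound used for integrability only and is then forgotten. *)
  apply: (@has_mean_centered _ _ _ _ _ _ _ _ ((d i.+1)%:R * L ^+ 2)) h => //.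
  apply: bE_le (bEZ (ler0n R (d i.+1)) (jvar _ _ _ dr x)) (lexx _).
  + by apply: measurable_fsq; apply: mmxB => //; exact: mmx_cst.
  + by move=> w; exact: fsq_ge0.
  + by move=> w; exact: fsq_opnorm.
- move=> t i j dr x y; have [_ A4] := A34 _ _ _ dr; have [h _] := A4 x y.
  apply: bE_sqr_enorm h _; first exact: mmxB.
  by rewrite enorm_sqr ler_wpM2r ?fsq_ge0// sqr_le.
- move=> t i j dr x y; have [_ A4] := A34 _ _ _ dr; have [_ h] := A4 x y.
  apply: bE_sqr_opnorm h _; first exact: mmxB.
  by rewrite enorm_sqr ler_wpM2r ?fsq_ge0// sqr_le.
Qed.

Theorem theorem2 (R : realType) (K : nat)
    (Lf LJ cLf cLJ sigma sigmaJ D DeltaF : R) :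
  (0 < K)%N ->
  0 <= Lf -> 0 <= LJ -> 0 <= cLf -> 0 <= cLJ ->
  0 <= sigma -> 0 <= sigmaJ -> 0 <= D -> 0 <= DeltaF ->
  exists (B1 T : R -> nat) (eta alpha : R -> R),
    [/\ (fun e : R => (B1 e)%:R : R) =O_ (0^'+) (fun e : R => e^-1),
        eta =O_ (0^'+) (fun e : R => e),
        alpha =O_ (0^'+) (fun e : R => e) &
        (fun e : R => (T e)%:R : R) =O_ (0^'+) (fun e : R => e ^- 2)] /\
    forall eps : R, 0 < eps ->
      [/\ (0 < B1 eps)%N, (0 < T eps)%N,
          0 < eta eps <= 1 & 0 < alpha eps <= 1] /\
      forall (d : nat -> nat) (dK : d K = 1%N)
        (X : set 'rV[R]_(d 0%N)) (f : level_maps d)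
        (dS dO : measure_display) (S : measurableType dS)
        (Om : measurableType dO) (P : probability Om R)
        (o : oracle d S) (lmo : 'cV[R]_(d 0%N) -> 'rV[R]_(d 0%N))
        (x1 : 'rV[R]_(d 0%N)) (B0 : nat)
        (xi : nat -> nat -> nat -> {RV P >-> S}) (tau : {RV P >-> nat}),
      let F := objective dK f in
      let run (w : Om) := pmvr o dK lmo x1 B0 (B1 eps) (eta eps) (alpha eps)
                            (fun t i j => xi t i j w) in
      (0 < B0)%N ->
      is_lmo X lmo ->
      pmvr_randomness (T eps) K B0 (B1 eps) xi tau ->
      assumption1 X D ->
      assumption2 K f Lf LJ ->
      (forall t i j, drawn (T eps) K B0 (B1 eps) (t, i, j) ->
         assumption3 f o sigma sigmaJ i (xi t i j) /\
         assumption4 o cLf cLJ i (xi t i j)) ->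
      assumption5 X F x1 DeltaF ->
      ('E_P[fun w => fw_gap X F (xt (run w (tau w)))] <= eps%:E)%E.
Proof.
move=> _ Lf0 LJ0 cLf0 cLJ0 s0 sJ0 D0 DF0.
pose L := 1 + Lf + LJ + cLf + cLJ + sigma + sigmaJ + D.
(* The constant of [expected_gap_bound], increased to be at least 1. It involves [K] and the
   constants of the assumptions only, so it can be fixed before the dimensions and the sample
   space. *)
pose C := 1 + (DeltaF + 2 * L * dir_cst L K + smooth_cst L K * L ^+ 2).
have L1 : 1 <= L by rewrite /L; lra.
have L0 : 0 <= L := le_trans ler01 L1.
have C1 : 1 <= C.
  have d0 := dir_cst_ge0 K L0; have c0 := le_trans ler01 (smooth_cst_ge1 L K).
  by rewrite lerDl addr_ge0 ?addr_ge0 ?mulr_ge0 ?exprn_ge0.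
have bnd n := inv_step_bigO C1 n.
exists (fun eps => (Num.truncn (step_size C eps ^- 1)).+1).
exists (fun eps => (Num.truncn (step_size C eps ^- 2)).+1).
exists (step_size C), (step_size C).
split; first by split; [exact: (bnd 1%N)|exact: step_size_bigO|exact: step_size_bigO|exact: (bnd 2)].
move=> eps eps0; have e0 := step_size_gt0 C1 eps0; have e1 := step_size_le1 C1 eps.
split; first by rewrite e0 e1.
move=> d dK X f dS dO S Om P o lmo x1 B0 xi tau F run B0p lmoP rnd A1 A2 A34 [Xx1 A5].
set e := step_size C eps in e0 e1 run rnd A34 *.
set T := (Num.truncn (e ^- 2)).+1 in rnd A34; set B1 := (Num.truncn (e ^- 1)).+1 in run rnd A34 *.
have B1e : B1%:R^-1 <= e.
  by rewrite -[leRHS]invrK lef_pV2 ?posrE ?invr_gt0 ?ltr0n//; exact/ltW/truncnS_gt.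
have Te : 1 <= e ^+ 2 * T%:R.
  rewrite -ler_pdivrMl ?exprn_gt0// mulr1; exact/ltW/truncnS_gt.
have H : pmvr_setup dK X f o lmo x1 T B0 B1 xi tau L e.
  by apply: assumptions_setup lmoP rnd A1 A2 A34 Xx1 => //; rewrite /L; lra.
have lmo_min v x : X x -> inner (lmo v) v <= inner x v by have [h _] := lmoP; exact: (h v).2.
apply: le_trans (expected_gap_bound H lmo_min DF0 (objective_gap H A5) Te rnd.1) _.
rewrite lee_fin; apply: le_trans (step_size_le C1 eps).
by rewrite ler_wpM2r ?(ltW e0)// /C lerDr.
Qed.
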